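(* Let $p\in(0,1)$ and $\alpha:=1/p-1$. For a function $g$ on $\mathbb R^n$ the following are equivalent: (i) $g\in L^\infty(\mathbb R^n)\cap\mathcal L^{\Phi_p}_{\rm loc}(\mathbb R^n)$; (ii) $g$ is a pointwise multiplier of $\Lambda_{n\alpha}(\mathbb R^n)$, i.e. there is $C_g>0$ with $\|gf\|_{\Lambda_{n\alpha}}\le C_g\|f\|_{\Lambda_{n\alpha}}$ for all $f\in\Lambda_{n\alpha}(\mathbb R^n)$. Moreover, there is a positive constant $C$ independent of $f,g$ such that, for $g$ as in (i) and all $f\in\Lambda_{n\alpha}(\mathbb R^n)$, $\|gf\|_{\Lambda_{n\alpha}(\mathbb R^n)}\le C[\|g\|_{L^\infty(\mathbb R^n)}+\|g\|_{\mathcal L^{\Phi_p}_{\rm loc}(\mathbb R^n)}]\|f\|_{\Lambda_{n\alpha}(\mathbb R^n)}$.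
   Context: For $\beta>0$, the inhomogeneous Lipschitz space $\Lambda_\beta(\mathbb R^n)$ is the set of measurable $f$ equal a.e. to a continuous $g$ with $\|f\|_{\Lambda_\beta}:=\|f\|_{L^\infty}+\sup_{x\in\mathbb R^n}\sup_{h\ne0}|D_h^{\lfloor\beta\rfloor+1}g(x)|/|h|^\beta<\infty$, where $D_hf(x):=f(x+h)-f(x)$ and $D_h^{k+1}:=D_h^kD_h$. $\Phi_p(\tau):=\tau/(1+\tau^{1-p})$, and $\|f\|_{L^{\Phi_p}}:=\inf\{\lambda>0:\int\Phi_p(|f|/\lambda)\le1\}$. For $g\in L^1_{\rm loc}$, a ball $B$ and $k\in\mathbb Z_+$, $P_B^kg$ is the unique polynomial $P$ of degree $\le k$ with $\int_B(g-P)R=0$ for all polynomials $R$ of degree $\le k$. With $d:=\lfloor n(1/p-1)\rfloor$, the local Orlicz Campanato space $\mathcal L^{\Phi_p}_{\rm loc}(\mathbb R^n)$ is the set of $g\in L^1_{\rm loc}$ with $\|g\|_{\mathcal L^{\Phi_p}_{\rm loc}}:=\sup_{B:|B|<1}\frac{1}{\|\mathbf 1_B\|_{L^{\Phi_p}}}\int_B|g-P_B^dg|\,dx+\sup_{B:|B|\ge1}\frac{1}{\|\mathbf 1_B\|_{L^{\Phi_p}}}\int_B|g|\,dx<\infty$ (suprema over balls $B\subset\mathbb R^n$). *)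

(* Defs.v *)
From mathcomp Require Import all_boot all_order all_algebra.
From mathcomp Require Import all_classical all_reals all_analysis measurable_realfun.

Set Implicit Arguments.
Unset Strict Implicit.
Unset Printing Implicit Defensive.

Import Order.TTheory GRing.Theory Num.Theory.
Local Open Scope classical_set_scope.
Local Open Scope ring_scope.

Section Defs.
Variable R : realType.

Definition tadd n (x y : n.-tuple R) : n.-tuple R :=
  [tuple tnth x i + tnth y i | i < n].
Definition tsub n (x y : n.-tuple R) : n.-tuple R :=
  [tuple tnth x i - tnth y i | i < n].
Definition tnorm n (x : n.-tuple R) : R :=
  Num.sqrt (\sum_(i < n) tnth x i ^+ 2).
Definition ball_of n (c : n.-tuple R) (r : R) : set (n.-tuple R) :=
  [set y | tnorm (tsub y c) < r].
Definition tcontinuous n (f : n.-tuple R -> R) : Prop :=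
  forall x (e : R), 0 < e -> exists2 del : R, 0 < del &
    forall y, tnorm (tsub y x) < del -> `|f y - f x| < e.

(* iterated Lebesgue integral; by Tonelli it is the Lebesgue integral on R^n
   for non-negative Borel measurable functions (the only ones it is used on) *)
Fixpoint leb_int (n : nat) : (n.-tuple R -> \bar R) -> \bar R :=
  match n return (n.-tuple R -> \bar R) -> \bar R with
  | 0 => fun h => h [tuple]
  | m.+1 => fun h =>
      (\int[@lebesgue_measure R]_x leb_int (fun t : m.-tuple R => h (cons_tuple x t)))%E
  end.

(* upper Lebesgue integral of a non-negative function: infimum of integrals
   of Borel majorants; equals the Lebesgue integral for Lebesgue
   measurable non-negative functions *)
Definition uint n (h : n.-tuple R -> \bar R) : \bar R :=
  ereal_inf [set leb_int h' | h' in [set h' : n.-tuple R -> \bar R |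
     @measurable_fun _ _ (n.-tuple R) (\bar R : measurableType _) setT h' /\ forall x, (0 <= h' x)%E /\ (h x <= h' x)%E]].

Definition restr n (B : set (n.-tuple R)) (h : n.-tuple R -> R) :=
  fun x => if `[< B x >] then h x else 0.

Definition lmeas n (A : set (n.-tuple R)) : \bar R :=
  uint (fun x => (\1_A x)%:E).

Definition null n (N : set (n.-tuple R)) : Prop := lmeas N = 0%E.
Definition ae_eq n (f g : n.-tuple R -> R) : Prop := null [set x | f x != g x].

Definition lmeasurable n (g : n.-tuple R -> R) : Prop :=
  exists2 g' : n.-tuple R -> R,
    @measurable_fun _ _ (n.-tuple R) R setT g' & ae_eq g g'.

(* integral over B of a (Lebesgue measurable, integrable) real function *)
Definition sint n (B : set (n.-tuple R)) (h : n.-tuple R -> R) : \bar R :=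
  (uint (fun x => (Num.max (restr B h x) 0)%:E) - uint (fun x => (Num.max (- restr B h x) 0)%:E))%E.

Definition aint n (B : set (n.-tuple R)) (h : n.-tuple R -> R) : \bar R :=
  uint (fun x => (restr B (fun y => `|h y|) x)%:E).

Definition esssup n (h : n.-tuple R -> R) : \bar R :=
  ereal_inf [set M%:E | M in [set M : R | null [set x | M < h x]]].
Definition Linf_norm n (g : n.-tuple R -> R) : \bar R :=
  esssup (fun x => `|g x|).
Definition in_Linf n (g : n.-tuple R -> R) : Prop :=
  lmeasurable g /\ (Linf_norm g < +oo)%E.
Definition L1loc n (g : n.-tuple R -> R) : Prop :=
  lmeasurable g /\ forall c r, (aint (ball_of c r) g < +oo)%E.

Definition Dh n (h : n.-tuple R) (f : n.-tuple R -> R) : n.-tuple R -> R :=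
  fun x => f (tadd x h) - f x.
Definition lip_seminorm n (beta : R) (g : n.-tuple R -> R) : \bar R :=
  ereal_sup [set (`|iter (Num.truncn beta).+1 (Dh h) g x| / tnorm h `^ beta)%:E
             | x in setT & h in [set h : n.-tuple R | h != [tuple of nseq n 0]]].
(* ||f||_{Lambda_beta}; +oo iff f is not in Lambda_beta (the continuous
   representative g is unique when it exists) *)
Definition lam_norm n (beta : R) (f : n.-tuple R -> R) : \bar R :=
  ereal_inf [set (Linf_norm f + lip_seminorm beta g)%E
            | g in [set g | tcontinuous g /\ ae_eq f g]].
Definition in_Lambda n (beta : R) (f : n.-tuple R -> R) : Prop :=
  (lam_norm beta f < +oo)%E.

Definition Phi (p tau : R) : R := tau / (1 + tau `^ (1 - p)).
Definition orlicz_norm n (p : R) (f : n.-tuple R -> R) : \bar R :=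
  ereal_inf [set l%:E | l in [set l : R | 0 < l /\
     (uint (fun x => (Phi p (`|f x| / l))%:E) <= 1)%E]].

Definition poly_le n (d : nat) (P : n.-tuple R -> R) : Prop :=
  exists c : {ffun {ffun 'I_n -> 'I_d.+1} -> R}, forall x,
    P x = \sum_(a : {ffun 'I_n -> 'I_d.+1} | (\sum_(i < n) (a i : nat) <= d)%N)
             c a * \prod_(i < n) tnth x i ^+ a i.

Definition is_proj n (d : nat) (B : set (n.-tuple R)) (g P : n.-tuple R -> R) :=
  poly_le d P /\ forall Q, poly_le d Q -> sint B (fun x => (g x - P x) * Q x) = 0%E.

Definition osc n (d : nat) (B : set (n.-tuple R)) (g : n.-tuple R -> R) : \bar R :=
  ereal_inf [set aint B (fun x => g x - P x) | P in is_proj d B g].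

Definition ind n (B : set (n.-tuple R)) : n.-tuple R -> R := \1_B.

Definition camp_norm n (p : R) (g : n.-tuple R -> R) : \bar R :=
  let d := Num.truncn (n%:R * (p^-1 - 1)) in
  (ereal_sup [set v | exists (c : n.-tuple R) (r : R),
       [/\ (0 < r)%R, (lmeas (ball_of c r) < 1)%E &
         v = (osc d (ball_of c r) g
              * ((fine (orlicz_norm p (ind (ball_of c r))))^-1)%:E)%E]]
   + ereal_sup [set v | exists (c : n.-tuple R) (r : R),
       [/\ (0 < r)%R, (1 <= lmeas (ball_of c r))%E &
         v = (aint (ball_of c r) g
              * ((fine (orlicz_norm p (ind (ball_of c r))))^-1)%:E)%E]])%E.

Definition in_camp n (p : R) (g : n.-tuple R -> R) : Prop :=
  L1loc g /\ (camp_norm p g < +oo)%E.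

End Defs.

(* Main.v *)
Require Import Defs.
From HB Require Import structures.
From mathcomp Require Import all_boot all_order all_algebra.
From mathcomp Require Import all_classical all_reals all_analysis measurable_realfun.
From mathcomp Require Import ring lra zify.

Set Implicit Arguments.
Unset Strict Implicit.
Unset Printing Implicit Defensive.
Import Order.TTheory GRing.Theory Num.Theory numFieldNormedType.Exports.
Local Open Scope classical_set_scope.
Local Open Scope ring_scope.

(** With [beta = n (1/p - 1)], the Luxemburg norm of the indicator of a ball [B]
    solves [l + l^p = |B|], hence is comparable to [|B|^(1/p)] for small balls and
    to [|B|] for large ones.  So (i) says that [g] is bounded and has, on every
    small ball of radius [r], mean oscillation [O(r^beta)] around polynomials of
    degree at most [floor beta]; by Campanato's and Whitney's theorems this means
    that [g] itself belongs to [Lambda_beta].  Testing (ii) on [f = 1] gives the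
    same conclusion, and [Lambda_beta] is an algebra: along a fixed direction a
    weak Marchaud inequality bounds [D_h^j f] by [|h|^(j beta / k)], and these
    exponents add up to [beta] in the Leibniz formula for [D_h^k (f g)].

    From oscillations to differences: the almost-optimal polynomials on the
    concentric cubes of side [2^-j] at [x] have values at [x] converging
    geometrically, the limit [g~ x] stays within [O(r^beta)] of the polynomial of
    any cube of side [r] near [x], and [D_h^k] kills that polynomial.

    From differences to oscillations: on a line, the interpolation error of
    Newton's polynomial with step [s] is controlled by that with step [s / 2] plus
    [O(s^beta)]; in several variables one interpolates coordinatewise and drops
    the Newton coefficients of total degree at least [k], which are mixed
    differences, controlled by pure ones through Kemperman's identity.  The
    [L^2] projection onto polynomials then does at least as well. *)

(** Everything is phrased with differences, and [k = floor beta + 1] exceeds [beta] strictly even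
    when [beta] is an integer, so integral and fractional exponents are treated alike. This strict
    inequality makes the series over doublings of [h] in the Marchaud step converge. Halving the
    Newton step infinitely often proves something only if the interpolation error tends to [0] with
    the step. The required uniform continuity is the case [j = 1] of Marchaud, a Hoelder bound with
    exponent [beta / k]; its constant disappears in the limit. The passage from oscillations to
    differences must be linear in the norms, because it carries the final estimate. The converse
    only has to yield finiteness, so its constants may depend on [g]. All norms are extended-real
    infima, possibly not attained. The estimates are therefore made for real numbers strictly above
    the norms, and the slack is removed at the very end. The integrals in the definitions are upper
    integrals of arbitrary functions. A measure on tuples is built whose integral they compute on
    Borel functions, and [g] is replaced by a continuous representative off a null set. *)

Section ConsTuple.
Variables (T : Type) (n : nat).
Implicit Types (x : T) (t : n.-tuple T).

Lemma tnth_cons0 x t : tnth (cons_tuple x t) ord0 = x.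
Proof. by []. Qed.

Lemma tnth_consS x t i : tnth (cons_tuple x t) (lift ord0 i) = tnth t i.
Proof. by rewrite !(tnth_nth x). Qed.

Lemma cons_tuple_eta (a : n.+1.-tuple T) : a = cons_tuple (thead a) [tuple of behead a].
Proof. by rewrite [LHS]tuple_eta; exact: val_inj. Qed.

Lemma ord_cases (P : 'I_n.+1 -> Prop) : P ord0 -> (forall i, P (lift ord0 i)) ->
  forall i, P i.
Proof.
move=> P0 PS i; have [->//|] := eqVneq i ord0.
by rewrite eq_sym => /unlift_some[j -> _]; exact: PS.
Qed.
End ConsTuple.

(** * Real tuples as a normed module *)

Section TupleSpace.
Variables (R : realType) (n : nat).
Implicit Types x y z : n.-tuple R.

Let topp x : n.-tuple R := [tuple - tnth x i | i < n].
Let tscale (a : R) x : n.-tuple R := [tuple a * tnth x i | i < n].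

Fact taddA : associative (@tadd R n).
Proof. by move=> x y z; apply: eq_from_tnth => i; rewrite !tnth_mktuple addrA. Qed.
Fact taddC : commutative (@tadd R n).
Proof. by move=> x y; apply: eq_from_tnth => i; rewrite !tnth_mktuple addrC. Qed.
Fact tadd0 : left_id [tuple of nseq n 0] (@tadd R n).
Proof.
by move=> x; apply: eq_from_tnth => i; rewrite !tnth_mktuple tnth_nseq add0r.
Qed.
Fact taddN : left_inverse [tuple of nseq n 0] topp (@tadd R n).
Proof.
by move=> x; apply: eq_from_tnth => i; rewrite !tnth_mktuple tnth_nseq addNr.
Qed.
(** Built on [tadd] and [[tuple of nseq n 0]] themselves, so that [Dh] is convertible to [fdiff]
    below and the condition on [h] in [lip_seminorm] reads [h != 0]. *)
HB.instance Definition _ :=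
  GRing.isZmodule.Build (n.-tuple R) taddA taddC tadd0 taddN.

Lemma tnthD x y i : tnth (x + y) i = tnth x i + tnth y i.
Proof. by rewrite [LHS]tnth_mktuple. Qed.
Lemma tnth_zero i : tnth (0 : n.-tuple R) i = 0.
Proof. by rewrite [LHS]tnth_nseq. Qed.
Lemma tnthN x i : tnth (- x) i = - tnth x i.
Proof. by rewrite [LHS]tnth_mktuple. Qed.

Fact tscaleA (a b : R) x : tscale a (tscale b x) = tscale (a * b) x.
Proof. by apply: eq_from_tnth => i; rewrite !tnth_mktuple mulrA. Qed.
Fact tscale1 : left_id 1 tscale.
Proof. by move=> x; apply: eq_from_tnth => i; rewrite !tnth_mktuple mul1r. Qed.
Fact tscaleDr : right_distributive tscale +%R.
Proof.
by move=> a x y; apply: eq_from_tnth => i; rewrite !(tnth_mktuple, tnthD) mulrDr.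
Qed.
Fact tscaleDl x : {morph tscale^~ x : a b / a + b}.
Proof.
by move=> a b; apply: eq_from_tnth => i; rewrite !(tnth_mktuple, tnthD) mulrDl.
Qed.
HB.instance Definition _ := GRing.Zmodule_isLmodule.Build R (n.-tuple R)
  tscaleA tscale1 tscaleDr tscaleDl.

Lemma tnthZ a x i : tnth (a *: x) i = a * tnth x i.
Proof. by rewrite [LHS]tnth_mktuple. Qed.
Lemma tnthB x y i : tnth (x - y) i = tnth x i - tnth y i.
Proof. by rewrite tnthD tnthN. Qed.
Lemma tnthMn x m i : tnth (x *+ m) i = tnth x i *+ m.
Proof. by elim: m => [|m ih]; rewrite ?tnth_zero// !mulrS tnthD ih. Qed.

Lemma tsubE x y : tsub x y = x - y.
Proof. by apply: eq_from_tnth => i; rewrite tnthB tnth_mktuple. Qed.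

Lemma tnormZ a x : tnorm (a *: x) = `|a| * tnorm x.
Proof.
rewrite /tnorm -sqrtr_sqr -sqrtrM ?sqr_ge0// mulr_sumr.
by congr Num.sqrt; apply: eq_bigr => i _; rewrite tnthZ exprMn.
Qed.

Lemma ler_tnth_tnorm x i : `|tnth x i| <= tnorm x.
Proof.
rewrite /tnorm -sqrtr_sqr ler_sqrt; last by apply: sumr_ge0 => j _; exact: sqr_ge0.
by rewrite (bigD1 i)//= lerDl sumr_ge0// => j _; exact: sqr_ge0.
Qed.

Lemma tnorm_ge0 x : 0 <= tnorm x.
Proof. exact: sqrtr_ge0. Qed.

Lemma tnorm_gt0 x : x != 0 -> 0 < tnorm x.
Proof.
apply: contraNT; rewrite -leNgt => x0; apply/eqP/eq_from_tnth => i.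
by rewrite tnth_zero; apply/eqP; rewrite -normr_le0 (le_trans (ler_tnth_tnorm x i)).
Qed.

Lemma tnorm0 : tnorm (0 : n.-tuple R) = 0.
Proof. by rewrite -[0](scale0r (0 : n.-tuple R)) tnormZ normr0 mul0r. Qed.

(** The l1 norm has a coordinatewise triangle inequality and dominates [tnorm], which makes it the
    handy one for sums of many steps. *)
Definition tnorm1 x : R := \sum_(i < n) `|tnth x i|.

Lemma ler_tnorm1D x y : tnorm1 (x + y) <= tnorm1 x + tnorm1 y.
Proof. by rewrite -big_split ler_sum// => i _; rewrite tnthD ler_normD. Qed.

Lemma tnorm1Z a x : tnorm1 (a *: x) = `|a| * tnorm1 x.
Proof. by rewrite mulr_sumr; apply: eq_bigr => i _; rewrite tnthZ normrM. Qed.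

Lemma tnorm1_ge0 x : 0 <= tnorm1 x.
Proof. exact: sumr_ge0. Qed.

Lemma ler_tnorm_tnorm1 x : tnorm x <= tnorm1 x.
Proof.
rewrite -[leRHS]ger0_norm ?tnorm1_ge0// -sqrtr_sqr ler_sqrt ?sqr_ge0//.
rewrite expr2 mulr_suml ler_sum// => i _.
rewrite -real_normK ?num_real// expr2 ler_wpM2l//.
by rewrite /tnorm1 (bigD1 i)//= lerDl sumr_ge0.
Qed.

End TupleSpace.

(** * Iterated differences in one direction *)

Section Differences.
Variables (R : realType) (V : zmodType).
Implicit Types (f g : V -> R) (h x : V).

Definition fdiff h f : V -> R := fun x => f (x + h) - f x.

Lemma iter_fdiffD h j f g x :
  iter j (fdiff h) (fun y => f y + g y) x = iter j (fdiff h) f x + iter j (fdiff h) g x.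
Proof.
elim: j x => [//|j ih] x.
by rewrite !iterS /fdiff !ih; ring.
Qed.

Lemma iter_fdiffZ h j a f x :
  iter j (fdiff h) (fun y => a * f y) x = a * iter j (fdiff h) f x.
Proof. by elim: j x => [//|j ih] x; rewrite !iterS /fdiff !ih mulrBr. Qed.

Lemma iter_fdiffB h j f g x :
  iter j (fdiff h) (fun y => f y - g y) x = iter j (fdiff h) f x - iter j (fdiff h) g x.
Proof. by elim: j x => [//|j ih] x; rewrite !iterS /fdiff !ih; ring. Qed.

Lemma iter_fdiff_shift h j f a x :
  iter j (fdiff h) (fun y => f (y + a)) x = iter j (fdiff h) f (x + a).
Proof. by elim: j x => [//|j ih] x; rewrite !iterS /fdiff !ih addrAC. Qed.

Lemma iter_fdiff_bound h i j f e :
  (forall x, `|iter j (fdiff h) f x| <= e) ->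
  forall x, `|iter (i + j) (fdiff h) f x| <= 2 ^+ i * e.
Proof.
move=> fe; elim: i => [|i ih] x; first by rewrite expr0 mul1r.
rewrite addSn iterS /fdiff (le_trans (ler_normB _ _))// exprS -mulrA mulr_natl mulr2n.
exact: lerD.
Qed.

Lemma iter_fdiff_pointwise h j f e x :
  (forall i, (i <= j)%N -> `|f (x + h *+ i)| <= e) ->
  `|iter j (fdiff h) f x| <= 2 ^+ j * e.
Proof.
elim: j x => [|j ih] x fe.
  by rewrite expr0 mul1r; have := fe 0 isT; rewrite addr0.
rewrite iterS /fdiff (le_trans (ler_normB _ _))// exprS -mulrA mulr_natl mulr2n.
apply: lerD; apply: ih => i ij; last by apply: fe; exact: leqW.
by rewrite -addrA -mulrS; exact: fe.
Qed.

(** Only the coefficient of [f x] is identified: it is the one that survives in Kemperman's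
    identity, where its absolute value [1] matters. *)
Lemma iter_fdiff_expand j : exists2 a : nat -> R, a 0%N = (-1) ^+ j &
  forall h f x, iter j (fdiff h) f x = \sum_(i < j.+1) a i * f (x + h *+ i).
Proof.
elim: j => [|j [a a0 ih]].
  by exists (fun=> 1) => // h f x; rewrite big_ord1 /= addr0 mul1r.
exists (fun i => if i is i'.+1 then a i' - (if (i' < j)%N then a i'.+1 else 0)
                 else - a 0%N); first by rewrite a0 exprS mulN1r.
move=> h f x; rewrite iterS /fdiff !ih [RHS]big_ord_recl.
rewrite [X in _ - X = _]big_ord_recl /=.
rewrite [X in _ = _ + X](eq_bigr (fun i : 'I_j.+1 => a i * f (x + h + h *+ i)
  - (if (i < j)%N then a i.+1 else 0) * f (x + h *+ i.+1))); last first.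
  by move=> i _; rewrite mulrBl /bump /= add1n mulrS addrA.
rewrite sumrB.
rewrite [X in _ = _ + (_ - X)]big_ord_recr /= ltnn mul0r !addr0.
rewrite [X in _ = _ + (_ - X)](eq_bigr (fun i : 'I_j => a i.+1 * f (x + h *+ i.+1)));
  last by move=> i _; rewrite ltn_ord.
by rewrite opprD addrCA mulNr.
Qed.

(** Leibniz formula as an inequality. From [D (f g) = D f * g (. + h) + f * D g] one gets [2 ^ m]
    terms, and the condition [u i * v (m - i) <= e] is inherited when the index of [u] or of [v] is
    shifted by one. *)
Lemma iter_fdiff_mul_bound h m f g (u v : nat -> R) e :
  (forall i x, (i <= m)%N -> `|iter i (fdiff h) f x| <= u i) ->
  (forall i x, (i <= m)%N -> `|iter i (fdiff h) g x| <= v i) ->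
  (forall i, (i <= m)%N -> u i * v (m - i)%N <= e) ->
  forall x, `|iter m (fdiff h) (fun y => f y * g y) x| <= 2 ^+ m * e.
Proof.
elim: m f g u v => [|m ih] f g u v fu gv uve x /=.
  rewrite mul1r normrM (le_trans _ (uve 0%N isT))//.
  by rewrite ler_pM// ?(fu 0%N)// ?(gv 0%N).
have -> : fdiff h (iter m (fdiff h) (fun y => f y * g y)) x =
   iter m (fdiff h) (fun y => fdiff h f y * g (y + h)) x +
   iter m (fdiff h) (fun y => f y * fdiff h g y) x.
  rewrite -iterS iterSr -iter_fdiffD; congr (iter m _ _ x); apply/funext => y.
  by rewrite /fdiff; ring.
rewrite exprS -mulrA mulr_natl mulr2n (le_trans (ler_normD _ _))// lerD//.
- apply: (ih _ _ (fun i => u i.+1) v).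
  + by move=> i y im; rewrite -iterSr; exact: fu.
  + by move=> i y im; rewrite iter_fdiff_shift gv// leqW.
  + by move=> i im; rewrite -subSS; exact: uve.
- apply: (ih _ _ u (fun i => v i.+1)).
  + by move=> i y im; rewrite fu// leqW.
  + by move=> i y im; rewrite -iterSr; exact: gv.
  + by move=> i im; rewrite -subSn//; apply: uve; exact: leqW.
Qed.

(** [D_2h] is [D_h] composed with the sum of the identity and the shift by [h], whence a factor [2]
    per order. *)
Lemma iter_fdiff_double_bound h j f e : (forall x, `|iter j (fdiff h) f x| <= e) ->
  forall x, `|iter j (fdiff (h + h)) f x| <= 2 ^+ j * e.
Proof.
elim: j f e => [|j ih] f e fe x; first by rewrite expr0 mul1r; exact: fe.
have dd g : fdiff (h + h) g = fun y => fdiff h g (y + h) + fdiff h g y.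
  by apply/funext => y; rewrite /fdiff addrA; ring.
rewrite iterSr exprSr -mulrA; apply: ih => y.
rewrite dd iter_fdiffD iter_fdiff_shift -iterSr mulr_natl mulr2n.
by rewrite (le_trans (ler_normD _ _))// lerD.
Qed.

(** Since [D_2h = D_h^2 + 2 D_h], the operator [D_2h^j - 2^j D_h^j] is a multiple of [D_h^(j+1)];
    the induction peels off one factor at a time. *)
Lemma iter_fdiff_double_approx h j f e :
  (forall x, `|iter j.+1 (fdiff h) f x| <= e) ->
  forall x, `|iter j (fdiff (h + h)) f x - 2 ^+ j * iter j (fdiff h) f x|
            <= j%:R * 2 ^+ j * e.
Proof.
elim: j f e => [|j ih] f e fe x.
  by rewrite expr0 mulr1 mul1r mul0r subrr normr0.
have dd : fdiff (h + h) f = fun y => fdiff h (fdiff h f) y + 2 * fdiff h f y.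
  by apply/funext => y; rewrite /fdiff addrA; ring.
rewrite iterSr dd iter_fdiffD iter_fdiffZ.
rewrite [iter j.+1 _ f]iterSr exprS -mulrA -addrA -mulrBr.
apply: (le_trans (ler_normD _ _)); rewrite normrM ger0_norm//.
have e0 : 0 <= e by exact: le_trans (fe x).
have h1 : `|iter j (fdiff (h + h)) (fdiff h (fdiff h f)) x| <= 2 ^+ j * e.
  by apply: iter_fdiff_double_bound => y; rewrite -!iterSr; exact: fe.
have h2 : `|iter j (fdiff (h + h)) (fdiff h f) x - 2 ^+ j * iter j (fdiff h) (fdiff h f) x|
    <= j%:R * 2 ^+ j * e.
  by apply: ih => y; rewrite -iterSr; exact: fe.
apply: (le_trans (lerD h1 (ler_wpM2l (ler0n _ 2) h2))).
rewrite -natr1.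
have : 0 <= 2 ^+ j * e by rewrite mulr_ge0// exprn_ge0.
by move=> ?; nra.
Qed.

End Differences.

(** * Marchaud inequality and products of Lipschitz functions *)

Section Marchaud.
Variables (R : realType) (n : nat).
Local Notation V := (n.-tuple R).

Lemma tnorm_double (h : V) : tnorm (h + h) = 2 * tnorm h.
Proof. by rewrite -mulr2n -scaler_nat tnormZ ger0_norm. Qed.

Lemma double_neq0 (h : V) : h != 0 -> h + h != 0.
Proof.
move=> h0; have := tnorm_gt0 h0; apply: contraTneq => hh.
by have := tnorm_double h; rewrite hh tnorm0; lra.
Qed.

Lemma double_archi (t : R) : 0 < t -> exists m : nat, 1 <= 2 ^+ m * t.
Proof.
move=> t0; exists (Num.bound t^-1); rewrite -ler_pdivrMr// mul1r.
rewrite (le_trans (ltW (archi_boundP _)))// ?invr_ge0 ?ltW//.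
by rewrite -natrX ltr_nat ltn_expl.
Qed.

(* [fdiff h] at scales [h] and [2h] compare through
   [D_2h^j f = 2^j D_h^j f + O(|D_h^(j+1) f|)]; iterating over doublings up to
   [|h| >= 1] loses nothing because [j * beta / k < j]. *)
Lemma marchaud_step (beta : R) (k j : nat) (K L : R) (f : V -> R) :
  0 < beta -> beta < k%:R -> 0 <= K -> 0 <= L -> (0 < j)%N ->
  (forall x, `|f x| <= L) ->
  (forall h x : V, h != 0 -> `|iter j.+1 (fdiff h) f x| <= K * tnorm h `^ (j.+1%:R * beta / k%:R)) ->
  forall h x : V, h != 0 -> `|iter j (fdiff h) f x| <=
   (2 ^+ j * L + j%:R * K / (1 - 2 `^ (j%:R * beta / k%:R - j%:R)))
     * tnorm h `^ (j%:R * beta / k%:R).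
Proof.
move=> b0 bk K0 L0 j0 fL fK.
set ga := j%:R * beta / k%:R; set q := 2 `^ (ga - j%:R).
have k0 : 0 < k%:R :> R by rewrite (lt_trans b0).
have ga0 : 0 <= ga by rewrite divr_ge0 ?mulr_ge0// ltW.
have gaj : ga < j%:R.
  by rewrite /ga ltr_pdivrMr// ltr_pM2l// ltr0n.
have q1 : q < 1.
  rewrite /q /powR gt_eqF// expR_lt1 nmulr_rlt0 ?subr_lt0//.
  by rewrite ln_gt0// ltr1n.
(* The first summand is the trivial bound used for [|h| >= 1]. The second makes [K'] stable under
   [X |-> q * X + j * K], the effect of one doubling on the constant. *)
set K' := _ + _ / _.
have K'L : 2 ^+ j * L <= K'.
  by rewrite lerDl divr_ge0 ?mulr_ge0// subr_ge0 ltW.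
have K'K : q * K' + j%:R * K <= K'.
  rewrite -lerBrDl -{1}[K']mul1r -mulrBl [leRHS]mulrC -ler_pdivrMr ?subr_gt0//.
  by rewrite /K' lerDr mulr_ge0// exprn_ge0.
have big h x : 1 <= tnorm h -> `|iter j (fdiff h) f x| <= K' * tnorm h `^ ga.
  move=> h1; rewrite (@le_trans _ _ (2 ^+ j * L))//.
    by apply: iter_fdiff_pointwise => i _; exact: fL.
  rewrite (le_trans K'L)// ler_peMr//; last first.
    by rewrite -(powRr0 (tnorm h)) ler_powR.
  by rewrite (le_trans _ K'L)// mulr_ge0// exprn_ge0.
(* Induction on the number [m] of doublings that bring [h] to length at least [1]. *)
suff H m h x : h != 0 -> 1 <= 2 ^+ m * tnorm h ->
    `|iter j (fdiff h) f x| <= K' * tnorm h `^ ga.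
  move=> h x h0; have [m hm] := double_archi (tnorm_gt0 h0).
  exact: (H m).
elim: m h x => [|m ih] h x h0; first by rewrite mul1r; exact: big.
rewrite exprS mulrAC mulrC -tnorm_double => hm.
have [/big//|h1] := leP 1 (tnorm h).
have t0 := tnorm_gt0 h0.
have {}ih := ih (h + h) x (double_neq0 h0) hm.
have := @iter_fdiff_double_approx _ _ h j f (K * tnorm h `^ (j.+1%:R * beta / k%:R)).
move=> /(_ (fun y => fK h y h0) x) appr.
have le1 : tnorm h `^ (j.+1%:R * beta / k%:R) <= tnorm h `^ ga.
  apply: ger_powR; first by rewrite t0 ltW.
  by rewrite /ga ler_wpM2r ?invr_ge0 ?(ltW k0)// ler_wpM2r ?(ltW b0)// ler_nat.
have e2j : 2 ^+ j * q = 2 `^ ga.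
  have n20 : 2 != 0 :> R by rewrite pnatr_eq0.
  by rewrite /q powRB ?n20 ?implybT// powR_mulrn// mulrC divfK// expf_neq0.
rewrite tnorm_double powRM ?tnorm_ge0// in ih.
have p2 : 0 < 2 ^+ j :> R by rewrite exprn_gt0.
rewrite -(ler_pM2l p2) -[X in X * `|_|]gtr0_norm// -normrM.
rewrite -[2 ^+ j * iter _ _ _ _](subKr (iter j (fdiff (h + h)) f x)).
apply: (le_trans (ler_normB _ _)); apply: (le_trans (lerD ih appr)).
rewrite -e2j.
apply: (@le_trans _ _ (2 ^+ j * (q * K' + j%:R * K) * tnorm h `^ ga)).
  rewrite mulrDr mulrDl lerD//.
    by rewrite [leLHS](_ : _ = 2 ^+ j * (q * K') * tnorm h `^ ga)//; ring.
  rewrite [leLHS](_ : _ = 2 ^+ j * (j%:R * K) * tnorm h `^ (j.+1%:R * beta / k%:R));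
    last by ring.
  by rewrite ler_wpM2l// !mulr_ge0// exprn_ge0.
by rewrite mulrA ler_wpM2r ?powR_ge0// ler_wpM2l// ltW.
Qed.

Lemma marchaud (beta : R) (k : nat) : 0 < beta -> beta < k%:R ->
  exists2 C : R, 0 < C & forall (L : R) (f : V -> R), 0 <= L ->
  (forall x, `|f x| <= L) ->
  (forall h x : V, h != 0 -> `|iter k (fdiff h) f x| <= L * tnorm h `^ beta) ->
  forall j (h x : V), (j <= k)%N -> h != 0 ->
    `|iter j (fdiff h) f x| <= C * L * tnorm h `^ (j%:R * beta / k%:R).
Proof.
move=> b0 bk.
have k0 : 0 < k%:R :> R by rewrite (lt_trans b0).
(* Descending induction on the order, from [k] down to [k - i >= 1]; order [0] is the sup bound
   itself. *)
suff H i : (i < k)%N -> exists2 C : R, 1 <= C & forall (L : R) (f : V -> R), 0 <= L ->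
  (forall x, `|f x| <= L) ->
  (forall h x : V, h != 0 -> `|iter k (fdiff h) f x| <= L * tnorm h `^ beta) ->
  forall j h x, (k - i <= j <= k)%N -> h != 0 ->
    `|iter j (fdiff h) f x| <= C * L * tnorm h `^ (j%:R * beta / k%:R).
  have kk : (k.-1 < k)%N by rewrite ltn_predL -(ltr0n R).
  have [C C1 HC] := H _ kk; exists C; first by rewrite (lt_le_trans _ C1).
  move=> L f L0 fL fk [h x _ h0|j h x jk h0].
    rewrite /= !mul0r powRr0 mulr1 (le_trans (fL x))// ler_peMl//.
  by apply: HC => //; lia.
elim: i => [_|i ih ik].
  exists 1 => // L f L0 fL fk j h x; rewrite subn0 -eqn_leq => /eqP <- h0.
  by rewrite mul1r mulrAC divff ?mul1r ?fk// gt_eqF.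
have [C C1 HC] := ih (ltnW ik).
set j0 := (k - i.+1)%N.
set D := 2 ^+ j0 + j0%:R * C / (1 - 2 `^ (j0%:R * beta / k%:R - j0%:R)).
exists (Num.max C D); first by rewrite le_max C1.
move=> L f L0 fL fk j h x /andP[kj jk] h0.
have [kij|] := leqP (k - i) j.
  rewrite (le_trans (HC L f L0 fL fk j h x _ h0)) ?kij//.
  by rewrite ler_wpM2r ?powR_ge0// ler_wpM2r// le_max lexx.
move=> jki; have {jki kj jk} -> : j = j0 by rewrite /j0; lia.
have j0k : j0.+1 = (k - i)%N by rewrite /j0; lia.
have C0 : 0 <= C by rewrite (le_trans _ C1).
have j00 : (0 < j0)%N by rewrite /j0; lia.
have st h' y : h' != 0 ->
    `|iter j0.+1 (fdiff h') f y| <= C * L * tnorm h' `^ (j0.+1%:R * beta / k%:R).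
  by move=> h'0; rewrite j0k HC// leqnn leq_subr.
apply: (le_trans (marchaud_step b0 bk (mulr_ge0 C0 L0) L0 j00 fL st _ h0)).
rewrite ler_wpM2r ?powR_ge0//.
rewrite [leLHS](_ : _ = D * L); last by rewrite /D; ring.
by rewrite ler_wpM2r// le_max lexx orbT.
Qed.

(* The exponents [j beta / k] and [(k - j) beta / k] of the Leibniz terms add up
   to [beta], which is why the crude interpolation of [marchaud] suffices. *)
Lemma lipschitz_mul (beta : R) (k : nat) : 0 < beta -> beta < k%:R ->
  exists2 C : R, 0 < C & forall (L M : R) (f g : V -> R), 0 <= L -> 0 <= M ->
  (forall x, `|f x| <= L) ->
  (forall h x : V, h != 0 -> `|iter k (fdiff h) f x| <= L * tnorm h `^ beta) ->
  (forall x, `|g x| <= M) ->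
  (forall h x : V, h != 0 -> `|iter k (fdiff h) g x| <= M * tnorm h `^ beta) ->
  forall h x : V, h != 0 ->
    `|iter k (fdiff h) (fun y => f y * g y) x| <= C * L * M * tnorm h `^ beta.
Proof.
move=> b0 bk; have [C C0 HC] := marchaud b0 bk.
have k0 : 0 < k%:R :> R by rewrite (lt_trans b0).
exists (2 ^+ k * C ^+ 2); first by rewrite mulr_gt0// exprn_gt0.
move=> L M f g L0 M0 fL fk gM gk h x h0.
rewrite -!mulrA.
apply: (@iter_fdiff_mul_bound _ _ h k f g
  (fun i => C * L * tnorm h `^ (i%:R * beta / k%:R))
  (fun i => C * M * tnorm h `^ (i%:R * beta / k%:R))) => i.
- by move=> y ik; exact: HC.
- by move=> y ik; exact: HC.
move=> ik; rewrite [leLHS](_ : _ = C * (C * (L * (M * (tnorm h `^ (i%:R * beta / k%:R)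
    * tnorm h `^ ((k - i)%N%:R * beta / k%:R)))))); last by ring.
rewrite -powRD; last by rewrite (gt_eqF (tnorm_gt0 h0)) implybT.
rewrite (_ : _ + _ = beta)//.
by rewrite natrB//; field; rewrite gt_eqF.
Qed.

End Marchaud.

(** * Continuity, and polynomials of bounded degree *)

Section Continuity.
Variables (R : realType) (n : nat).
Implicit Types f g : n.-tuple R -> R.

Lemma tcontinuous_cst (a : R) : tcontinuous (fun _ : n.-tuple R => a).
Proof. by move=> x e e0; exists 1 => // y _; rewrite subrr normr0. Qed.

Lemma tcontinuous_tnth i : tcontinuous (fun x : n.-tuple R => tnth x i).
Proof.
move=> x e e0; exists e => // y yx; rewrite -tnthB -tsubE.
exact: le_lt_trans (ler_tnth_tnorm _ _) yx.
Qed.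

Lemma tcontinuousD f g : tcontinuous f -> tcontinuous g -> tcontinuous (fun x => f x + g x).
Proof.
move=> cf cg x e e0; have e20 : 0 < e / 2 by rewrite divr_gt0.
have [d d0 Hd] := cf x _ e20; have [d' d'0 Hd'] := cg x _ e20.
exists (Num.min d d'); first by rewrite lt_min d0.
move=> y; rewrite lt_min => /andP[/Hd h /Hd' h'].
rewrite opprD addrACA (le_lt_trans (ler_normD _ _))//; lra.
Qed.

Lemma tcontinuousM f g : tcontinuous f -> tcontinuous g -> tcontinuous (fun x => f x * g x).
Proof.
move=> cf cg x e e0.
pose K := `|f x| + `|g x| + 1.
have K0 : 0 < K by rewrite ltr_wpDl// addr_ge0.
pose e' := Num.min 1 (e / 2 / K).
have e'0 : 0 < e' by rewrite lt_min ltr01 !divr_gt0.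
have [d d0 Hd] := cf x _ e'0; have [d' d'0 Hd'] := cg x _ e'0.
exists (Num.min d d'); first by rewrite lt_min d0.
move=> y; rewrite lt_min => /andP[/Hd /ltW h /Hd' /ltW h'].
have e'1 : e' <= 1 by rewrite ge_min lexx.
have e'K : e' * K <= e / 2 by rewrite -ler_pdivlMr// ge_min lexx orbT.
rewrite [X in `|X|](_ : _ = (f y - f x) * (g y - g x)
   + (f x * (g y - g x) + (f y - f x) * g x)); last by ring.
apply: (@le_lt_trans _ _ (e' * K)); last by lra.
rewrite /K [leRHS]mulrDr mulr1 [leRHS]addrC; apply: le_trans (ler_normD _ _) _.
apply: lerD.
  by rewrite normrM (le_trans (ler_pM _ _ h (le_trans h' e'1)))// mulr1.
rewrite [leRHS]mulrDr (le_trans (ler_normD _ _))// !normrM.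
by rewrite [e' * `|f x|]mulrC lerD// ?ler_wpM2l ?ler_wpM2r.
Qed.

End Continuity.

Section Polynomials.
Variables (R : realType) (n : nat).
Local Notation V := (n.-tuple R).

(** An inductive form of [poly_le]: the degree grows only through multiplication by a coordinate, so
    that shifts, differences and slices are handled by structural induction. [poly_leP] is the
    bridge. *)
Inductive pol : nat -> (V -> R) -> Prop :=
| pol_cst d a : pol d (fun=> a)
| polD d P Q : pol d P -> pol d Q -> pol d (fun x => P x + Q x)
| pol_mulX d i P : pol d P -> pol d.+1 (fun x => tnth x i * P x).

Lemma pol_ext d P Q : P =1 Q -> pol d P -> pol d Q.
Proof. by move=> /funext ->. Qed.

Lemma polW d e P : (d <= e)%N -> pol d P -> pol e P.
Proof.
move=> + Pd; elim: Pd e => {d P}.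
- by move=> d a e _; exact: pol_cst.
- by move=> d P Q _ ihP _ ihQ e de; apply: polD; [exact: ihP|exact: ihQ].
- by move=> d i P _ ih [//|e] de; apply: pol_mulX; exact: ih.
Qed.

Lemma polZ d a P : pol d P -> pol d (fun x => a * P x).
Proof.
elim=> {d P}.
- by move=> d b; exact: pol_cst.
- move=> d P Q _ ihP _ ihQ; apply: pol_ext (polD ihP ihQ) => x.
  by rewrite mulrDr.
- by move=> d i P _ ih; apply: pol_ext (pol_mulX i ih) => x; rewrite mulrCA.
Qed.

Lemma polB d P Q : pol d P -> pol d Q -> pol d (fun x => P x - Q x).
Proof.
move=> dP dQ; apply: pol_ext (polD dP (polZ (-1) dQ)) => x.
by rewrite mulN1r.
Qed.

Lemma polM d e P Q : pol d P -> pol e Q -> pol (d + e) (fun x => P x * Q x).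
Proof.
move=> Pd Qe; elim: Pd => {d P}.
- by move=> d a; apply: polZ; apply: polW Qe; rewrite leq_addl.
- move=> d P P' _ ihP _ ihP'; apply: pol_ext (polD ihP ihP') => x.
  by rewrite mulrDl.
- move=> d i P _ ih; rewrite addSn; apply: pol_ext (pol_mulX i ih) => x.
  by rewrite mulrA.
Qed.

Lemma pol_sum d (I : Type) (r : seq I) (A : pred I) (F : I -> V -> R) :
  (forall i, A i -> pol d (F i)) -> pol d (fun x => \sum_(i <- r | A i) F i x).
Proof.
move=> Fd; elim: r => [|i r ih].
  by apply: pol_ext (pol_cst d 0) => x; rewrite big_nil.
have [Ai|nAi] := boolP (A i).
  by apply: pol_ext (polD (Fd i Ai) ih) => x; rewrite big_cons Ai.
by apply: pol_ext ih => x; rewrite big_cons (negbTE nAi).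
Qed.

Lemma pol_shift d h P : pol d P -> pol d (fun x => P (x + h)).
Proof.
elim=> {d P}.
- by move=> d b; exact: pol_cst.
- by move=> d P Q _ ihP _ ihQ; exact: polD.
- move=> d i P _ ih.
  apply: pol_ext (polD (pol_mulX i ih) (polZ (tnth h i) (polW (leqnSn d) ih))) => x.
  by rewrite tnthD mulrDl.
Qed.

(** The match treats degree [-1] as the zero function. The step is
    [D_h (x_i P) = x_i D_h P + h_i P (. + h)]. *)
Lemma pol_fdiff d h P : pol d P ->
  if d is d'.+1 then pol d' (fdiff h P) else fdiff h P =1 fun=> 0.
Proof.
elim=> {d P}.
- case=> [|d] a; first by move=> x; rewrite /fdiff subrr.
  by apply: pol_ext (pol_cst d 0) => x; rewrite /fdiff subrr.
- case=> [|d] P Q _ ihP _ ihQ.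
    move=> x; have := ihP x; have := ihQ x; rewrite /fdiff => h1 h2.
    by rewrite opprD addrACA h1 h2 addr0.
  by apply: pol_ext (polD ihP ihQ) => x; rewrite /fdiff; ring.
- move=> d i P Pd ih.
  have E x : fdiff h (fun y => tnth y i * P y) x =
     tnth x i * fdiff h P x + tnth h i * P (x + h).
    by rewrite /fdiff tnthD; ring.
  have Ps := polZ (tnth h i) (pol_shift h Pd).
  case: d Pd ih Ps => [|d] Pd ih Ps.
    by apply: pol_ext Ps => x; rewrite E ih mulr0 add0r.
  by apply: pol_ext (polD (pol_mulX i ih) Ps) => x; rewrite E.
Qed.

Lemma pol_iter_fdiff d h P x : pol d P -> iter d.+1 (fdiff h) P x = 0.
Proof.
elim: d P => [|d ih] P Pd; first exact: (pol_fdiff h Pd).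
by rewrite iterSr ih//; exact: (pol_fdiff h Pd).
Qed.

Lemma pol_expX i m : pol m (fun x => tnth x i ^+ m).
Proof.
elim: m => [|m ih]; first exact: pol_cst.
by apply: pol_ext (pol_mulX i ih) => x; rewrite exprS.
Qed.

Lemma pol_monomial d (a : {ffun 'I_n -> 'I_d.+1}) : (\sum_(i < n) (a i : nat) <= d)%N ->
  pol d (fun x => \prod_(i < n) tnth x i ^+ a i).
Proof.
move=> ad; apply: polW ad _.
elim: (index_enum 'I_n) => [|i r ih].
  by apply: pol_ext (pol_cst _ 1) => x; rewrite big_nil.
rewrite big_cons; apply: pol_ext (polM (pol_expX i (a i)) ih) => x.
by rewrite big_cons.
Qed.

Lemma pol_continuous d P : pol d P -> tcontinuous P.
Proof.
elim=> {d P}.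
- by move=> d b; exact: tcontinuous_cst.
- by move=> d P Q _ ihP _ ihQ; exact: tcontinuousD.
- by move=> d i P _ ih; apply: tcontinuousM => //; exact: tcontinuous_tnth.
Qed.

Lemma poly_leP d P : poly_le d P <-> pol d P.
Proof.
split=> [[c cP]|].
  apply: pol_ext (fun x => esym (cP x)) _; apply: pol_sum => a ad.
  by apply: polZ; exact: pol_monomial.
elim=> {d P}.
- move=> d a; exists [ffun b : {ffun 'I_n -> 'I_d.+1} => if b == [ffun=> ord0] then a else 0] => x.
  rewrite (bigD1 [ffun=> ord0])/=; last first.
    by rewrite big1// => i _; rewrite ffunE.
  rewrite ffunE eqxx big1 ?mulr1 => [|i _]; last by rewrite ffunE expr0.
  by rewrite big1 ?addr0// => b /andP[_ /negbTE b0]; rewrite ffunE b0 mul0r.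
- move=> d P Q _ [c cP] _ [c' cQ].
  exists [ffun a => c a + c' a] => x; rewrite cP cQ -big_split.
  by apply: eq_bigr => a _; rewrite ffunE mulrDl.
- move=> d i P _ [c cP].
  pose up (a : {ffun 'I_n -> 'I_d.+1}) : {ffun 'I_n -> 'I_d.+2} :=
    [ffun j => inord (a j + (j == i))].
  have upE a j : up a j = (a j + (j == i))%N :> nat.
    rewrite ffunE inordK//; have := ltn_ord (a j); case: (j == i) => /=; lia.
  have sum_up a : (\sum_(j < n) (up a j : nat) = (\sum_(j < n) (a j : nat)).+1)%N.
    under eq_bigr do rewrite upE.
    rewrite big_split/= (_ : (\sum_(j < n) (j == i) = 1)%N) ?addn1//.
    by rewrite (bigD1 i)//= eqxx big1// => j /negbTE ->.
  (* [up] adds one to the exponent of [x_i]; each new coefficient is the sum over a fibre of [up],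
     which is [0] when the fibre is empty. *)
  exists [ffun b => \sum_(a : {ffun 'I_n -> 'I_d.+1} |
     (\sum_(j < n) (a j : nat) <= d)%N && (up a == b)) c a] => x.
  rewrite cP mulr_sumr (partition_big up (fun b => (\sum_(j < n) (b j : nat) <= d.+1)%N)).
    apply: eq_bigr => b _; rewrite ffunE mulr_suml; apply: eq_bigr => a /andP[_ /eqP <-].
    rewrite mulrCA; congr (_ * _).
    under [RHS]eq_bigr do rewrite upE exprD.
    rewrite big_split/= mulrC; congr (_ * _).
    by rewrite (bigD1 i)//= eqxx expr1 big1 ?mulr1// => j /negbTE ->.
  by move=> a ad; rewrite sum_up.
Qed.

End Polynomials.

Lemma pol_slice (R : realType) n d (P : n.+1.-tuple R -> R) x :
  pol d P -> pol d (fun t => P (cons_tuple x t)).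
Proof.
elim=> {d P}.
- by move=> d b; exact: pol_cst.
- by move=> d P Q _ ihP _ ihQ; exact: polD.
- move=> d i P _ ih; elim/ord_cases: i => [|i].
    by apply: polZ; exact: polW ih.
  by apply: pol_ext (pol_mulX i ih) => t; rewrite tnth_consS.
Qed.

Lemma pol_line (R : realType) n d (P : n.+1.-tuple R -> R) t : pol d P ->
  exists2 q : {poly R}, (size q <= d.+1)%N & forall x, P (cons_tuple x t) = q.[x].
Proof.
elim=> {d P}.
- move=> d a; exists a%:P; first exact: leq_trans (size_polyC_leq1 a) _.
  by move=> x; rewrite hornerC.
- move=> d P Q _ [p sp pP] _ [q sq qQ]; exists (p + q).
    by rewrite (leq_trans (size_polyD _ _))// geq_max sp.
  by move=> x; rewrite pP qQ hornerD.
- move=> d i P _ [p sp pP]; elim/ord_cases: i => [|i].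
    exists (p * 'X); last by move=> x; rewrite hornerM hornerX pP mulrC.
    by rewrite (leq_trans (size_polyMleq _ _))// size_polyX addn2.
  exists (tnth t i *: p); last by move=> x; rewrite hornerZ pP tnth_consS.
  by rewrite (leq_trans (size_scale_leq _ _))// leqW.
Qed.

Lemma pol_cons (R : realType) n d (P : n.-tuple R -> R) :
  pol d P -> pol d (fun y : n.+1.-tuple R => P [tuple of behead y]).
Proof.
elim=> {d P}.
- by move=> d b; exact: pol_cst.
- by move=> d P Q _ ihP _ ihQ; exact: polD.
- move=> d i P _ ih; apply: pol_ext (pol_mulX (lift ord0 i) ih) => y.
  by rewrite {1}[y]cons_tuple_eta tnth_consS.
Qed.

Lemma leq_bin_expn2 m i : ('C(m, i) <= 2 ^ m)%N.
Proof.
elim: m i => [|m ih] [|i]; rewrite ?bin0 ?expn_gt0// binS expnS mul2n -addnn.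
exact: leq_add.
Qed.

(** * Newton interpolation on a line *)

Section Newton.
Variable R : realType.
Implicit Types (F G : R -> R) (c s x : R) (k : nat).

Definition binp i : {poly R} := (i`!%:R)^-1 *: \prod_(j < i) ('X - j%:R%:P).

Lemma binp_nat i m : (binp i).[m%:R] = 'C(m, i)%:R.
Proof.
have i0 : i`!%:R != 0 :> R by rewrite pnatr_eq0 -lt0n fact_gt0.
rewrite /binp hornerZ horner_prod.
under eq_bigr do rewrite hornerXsubC.
apply: (mulfI i0); rewrite mulrA divff// mul1r -natrM mulnC bin_ffact.
have [im|mi] := leqP i m.
  rewrite ffact_prod natr_prod; apply: eq_bigr => j _.
  by rewrite natrB// ltnW// (leq_trans (ltn_ord j)).
by rewrite ffact_small// (bigD1 (Ordinal mi))//= subrr mul0r.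
Qed.

Lemma size_binp i : (size (binp i) <= i.+1)%N.
Proof.
rewrite (leq_trans (size_scale_leq _ _))//.
by rewrite size_prod_XsubC /index_enum -enumT size_enum_ord.
Qed.

Lemma binp_bound i k y : (i <= k)%N -> `|y| <= 2 * k%:R -> `|(binp i).[y]| <= (3 * k%:R) ^+ i.
Proof.
move=> ik yk; rewrite /binp hornerZ horner_prod normrM normr_prod.
rewrite -[leRHS]mul1r ler_pM//.
- exact: prodr_ge0.
- by rewrite ger0_norm ?invr_ge0// invf_le1 ?ltr0n ?fact_gt0// ler1n fact_gt0.
rewrite (@le_trans _ _ (\prod_(j < i) (3 * k%:R)))//; last first.
  by rewrite prodr_const card_ord.
apply: ler_prod => j _; rewrite normr_ge0 hornerXsubC (le_trans (ler_normB _ _))//.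
have : j%:R <= k%:R :> R by rewrite ler_nat (leq_trans (ltnW (ltn_ord j))).
by rewrite normr_nat; lra.
Qed.

(** Exact for arbitrary [F], as ['C(m, i)] vanishes for [i > m]; cutting the sum at [k] then leaves
    differences of order at least [k]. *)
Lemma newton_forward F s m N c : (m < N)%N ->
  F (c + s *+ m) = \sum_(i < N) 'C(m, i)%:R * iter i (fdiff s) F c.
Proof.
elim: m N c => [|m ih] [//|N] c mN.
  rewrite big_ord_recl /= bin0 mul1r big1 => [|i _]; first by rewrite !addr0.
  by rewrite mul0r.
have mN' : (m < N.+1)%N by exact: ltnW.
rewrite mulrS addrA (ih _ _ mN').
rewrite (eq_bigr (fun i : 'I_N.+1 => 'C(m, i)%:R * iter i (fdiff s) F c +
   'C(m, i)%:R * iter i.+1 (fdiff s) F c)); last first.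
  by move=> i _; rewrite iterS /fdiff; ring.
rewrite big_split /= big_ord_recl [X in _ + X]big_ord_recr [RHS]big_ord_recl /=.
rewrite [in 'C(m, N)]bin_small// mul0r addr0 !bin0 -addrA; congr (_ + _).
rewrite -big_split; apply: eq_bigr => i _.
by rewrite /bump /= !add1n binS natrD mulrDl.
Qed.

(** The polynomial of degree less than [k] that interpolates [F] at
    [c, c + s, ..., c + (k - 1) s]. *)
Definition newton k c s F x : R :=
  \sum_(i < k) iter i (fdiff s) F c * (binp i).[(x - c) / s].

Lemma newton_node k c s F m : s != 0 -> (m < k)%N ->
  newton k c s F (c + s *+ m) = F (c + s *+ m).
Proof.
move=> s0 mk; rewrite /newton (newton_forward F s c mk); apply: eq_bigr => i _.
by rewrite addrAC subrr add0r -[s *+ m]mulr_natl mulfK// binp_nat mulrC.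
Qed.

Lemma newtonB k c s F G x :
  newton k c s (fun y => F y - G y) x = newton k c s F x - newton k c s G x.
Proof.
rewrite /newton -sumrB; apply: eq_bigr => i _.
by rewrite iter_fdiffB mulrBl.
Qed.

Lemma newton_poly k c s F : exists2 q : {poly R}, (size q <= k)%N &
  forall x, newton k c s F x = q.[x].
Proof.
exists (\sum_(i < k) iter i (fdiff s) F c *: (binp i \Po (s^-1 *: ('X - c%:P)))).
  apply: (leq_trans (size_sum _ _ _)); apply/bigmax_leqP => i _.
  rewrite (leq_trans (size_scale_leq _ _))// (leq_trans (size_comp_poly_leq _ _))//.
  have s2 : (size (s^-1 *: ('X - c%:P)) <= 2)%N.
    by rewrite (leq_trans (size_scale_leq _ _))// size_XsubC.
  apply: (leq_trans _ (ltn_ord i)); rewrite ltnS.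
  apply: (@leq_trans (i * 1)%N); last by rewrite muln1.
  apply: leq_mul; first by have := size_binp i; case: (size _).
  by move: s2; case: (size _).
move=> x; rewrite horner_sum; apply: eq_bigr => i _.
rewrite [RHS]hornerZ horner_comp (hornerZ s^-1) hornerXsubC.
by rewrite [s^-1 * _]mulrC.
Qed.

Lemma newton_id k c s (q : {poly R}) x : s != 0 -> (size q <= k)%N ->
  newton k c s (horner q) x = q.[x].
Proof.
move=> s0 qk; have [p pk pE] := newton_poly k c s (horner q).
rewrite pE; apply/eqP; rewrite -subr_eq0 -hornerN -hornerD; apply/eqP.
suff -> : p - q = 0 by rewrite horner0.
pose rs := [seq c + s *+ m | m <- iota 0 k].
apply/eqP; apply: contraT => pq0.
have spq : (size (p - q)%R <= k)%N.
  by rewrite (leq_trans (size_polyD _ _))// size_polyN geq_max pk.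
have rall : all (root (p - q)) rs.
  apply/allP => _ /mapP[m + ->]; rewrite mem_iota add0n => /andP[_ mk].
  by rewrite rootE hornerD hornerN -pE newton_node// subrr.
have runiq : uniq rs.
  rewrite map_inj_uniq ?iota_uniq// => i j /addrI /eqP.
  by rewrite -!(mulr_natl s) (inj_eq (mulIf s0)) eqr_nat => /eqP.
by have := max_poly_roots pq0 rall runiq; rewrite size_map size_iota ltnNge spq.
Qed.

(** Norm bound for interpolation, evaluated within [2 k] steps of [c]: [2 ^+ i] comes from the
    [i]-th difference, and [3 k = 2 k + k] bounds each factor of the binomial polynomial. *)
Definition newton_bound k : R := \sum_(i < k) 2 ^+ i * (3 * k%:R) ^+ i.

Lemma newton_bound_ge0 k : 0 <= newton_bound k.
Proof. by apply: sumr_ge0 => i _; rewrite mulr_ge0 ?exprn_ge0// mulr_ge0. Qed.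

Lemma newton_le k c s F x e :
  (forall m, (m < k)%N -> `|F (c + s *+ m)| <= e) -> `|(x - c) / s| <= 2 * k%:R ->
  `|newton k c s F x| <= newton_bound k * e.
Proof.
move=> Fe xc; rewrite mulr_suml (le_trans (ler_norm_sum _ _ _))//.
apply: ler_sum => i _; rewrite normrM mulrAC ler_pM//.
  by apply: iter_fdiff_pointwise => m mi; apply: Fe; exact: leq_ltn_trans (ltn_ord i).
by apply: binp_bound => //; exact: ltnW.
Qed.

(** Let [q] be the interpolant with step [s / 2] from [c]. On the [2 k + 1] nodes [c + m s / 2],
    [F - q] is a tail of Newton's expansion, hence [O(w)]. The nodes of the coarse interpolant, and
    those of the fine one started at [c + k s / 2], are among them; interpolation reproduces [q], so
    both interpolants are [O(w)]-close to [q]. *)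
Lemma newton_halving k : exists2 B : R, 0 <= B & forall F c s w, 0 < s ->
  (forall x, `|iter k (fdiff (s / 2)) F x| <= w) ->
  forall x, c <= x <= c + k%:R * s ->
  exists2 c', c' <= x <= c' + k%:R * (s / 2) &
    `|newton k c' (s / 2) F x - newton k c s F x| <= B * w.
Proof.
(* One factor bounds ['C(m, i)] for [m <= 2 k], the other the cost of passing from differences of
   order [k] to order [i <= 2 k]. *)
pose A : R := \sum_(i < (2 * k).+1) 2 ^+ (2 * k) * 2 ^+ (2 * k).
have A0 : 0 <= A by apply: sumr_ge0 => i _; rewrite mulr_ge0 ?exprn_ge0.
have NA0 : 0 <= newton_bound k * A by rewrite mulr_ge0 ?newton_bound_ge0.
exists (2 * (newton_bound k * A)); first by rewrite mulr_ge0.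
move=> F c s w s0 Fw x /andP[cx xc].
have w0 : 0 <= w by exact: le_trans (Fw 0).
set t := s / 2; have t0 : 0 < t by rewrite divr_gt0.
have st : s = t *+ 2 by rewrite /t; lra.
have [q qk qE] := newton_poly k c t F.
have Fq m : (m <= 2 * k)%N -> `|F (c + t *+ m) - q.[c + t *+ m]| <= A * w.
  move=> mk; rewrite -qE (newton_forward F t c (_ : (m < (2 * k).+1)%N))//.
  rewrite /newton addrAC subrr add0r -[t *+ m]mulr_natl.
  under [X in _ - X]eq_bigr do rewrite mulfK ?gt_eqF// binp_nat mulrC.
  have kk : (k <= (2 * k).+1)%N by lia.
  rewrite (big_ord_widen _ (fun i => 'C(m, i)%:R * iter i (fdiff t) F c) kk).
  rewrite [X in _ - X]big_mkcond /= -sumrB mulr_suml (le_trans (ler_norm_sum _ _ _))//.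
  apply: ler_sum => i _; case: ltnP => [ik|ki].
    by rewrite subrr normr0 mulr_ge0// mulr_ge0// exprn_ge0.
  rewrite subr0 normrM normr_nat -mulrA ler_pM//.
    rewrite -natrX ler_nat (leq_trans _ (leq_pexp2l _ mk))//.
    exact: leq_bin_expn2.
  have := @iter_fdiff_bound _ _ t (i - k) k F w Fw c; rewrite subnK//.
  move=> /le_trans -> //; rewrite ler_wpM2r// ler_weXn2l ?ler1n//.
  by have := ltn_ord i; lia.
have near c' r : 0 < r -> `|(x - c') / r| <= 2 * k%:R ->
   (forall m, (m < k)%N -> exists2 j, (j <= 2 * k)%N & c' + r *+ m = c + t *+ j) ->
   `|newton k c' r F x - q.[x]| <= newton_bound k * A * w.
  move=> r0 xr nodes; rewrite -(newton_id c' x (lt0r_neq0 r0) qk) -newtonB -mulrA.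
  apply: newton_le => // m /nodes[j jk ->]; exact: Fq.
have ns : `|newton k c s F x - q.[x]| <= newton_bound k * A * w.
  apply: near => //.
    rewrite normrM normfV (gtr0_norm s0) ler_pdivrMr// ger0_norm ?subr_ge0//.
    by rewrite lerBlDl (le_trans xc)// lerD2l ler_wpM2r ?(ltW s0)//; have := ler0n R k; lra.
  by move=> m mk; exists (2 * m)%N; [lia|rewrite st -mulrnA].
suff [c' c'x nc'] : exists2 c', c' <= x <= c' + k%:R * t &
    `|newton k c' t F x - q.[x]| <= newton_bound k * A * w.
  exists c' => //; rewrite -(subrKA q.[x]) (le_trans (ler_normD _ _))//.
  by rewrite [X in _ + X]distrC [2]/(1 + 1) mulrDl mul1r mulrDl lerD.
(* In the left half the fine interpolant is [q] itself; in the right half it is restarted at the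
   midpoint. *)
have [xh|xh] := leP x (c + k%:R * t).
  exists c; first by rewrite cx.
  by rewrite qE subrr normr0 mulr_ge0.
exists (c + k%:R * t).
  by rewrite ltW//= -addrA -mulrDr -mulr2n -st.
apply: near => //.
  rewrite normrM normfV (gtr0_norm t0) ler_pdivrMr// ger0_norm ?subr_ge0 ?(ltW xh)//.
  rewrite lerBlDl (le_trans xc)// -addrA lerD2l st mulrnAr.
  have : 0 <= k%:R * t by rewrite mulr_ge0// ltW.
  by rewrite -mulrA; lra.
move=> m mk; exists (k + m)%N; first by lia.
by rewrite mulrnDr addrA mulr_natl.
Qed.

End Newton.

Section Whitney1.
Variable R : realType.

Lemma le_geometric0 (X a q : R) : 0 <= q -> q < 1 ->
  (forall m : nat, X <= a * q ^+ m) -> X <= 0.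
Proof.
move=> q0 q1 Xq.
have cv : geometric a q @ \oo --> (0 : R) by apply: cvg_geometric; rewrite ger0_norm.
rewrite -(cvg_lim _ cv)//; apply: limr_ge; first by apply/cvg_ex; exists 0.
by near=> m; exact: Xq.
Unshelve. all: by end_near. Qed.

Lemma powR_half (s b : R) : 0 <= s -> (s / 2) `^ b = 2 `^ (- b) * s `^ b.
Proof. by move=> s0; rewrite mulrC powRM ?invr_ge0// -powR_inv1// -powRrM mulN1r. Qed.

Lemma powR2N_lt1 (b : R) : 0 < b -> (2 : R) `^ (- b) < 1.
Proof.
by move=> b0; rewrite /powR gt_eqF// expR_lt1 nmulr_rlt0 ?oppr_lt0// ln_gt0// ltr1n.
Qed.

(* The interpolation error [K s] at scale [s] obeys [K s <= K (s / 2) + C M s^beta]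
   and tends to [0] with [s] by uniform continuity. *)
Lemma newton_error (k : nat) (beta : R) : (0 < k)%N -> 0 < beta ->
  exists2 C : R, 0 <= C & forall (F : R -> R) (M L del : R), 0 <= M -> 0 <= L -> 0 < del ->
  (forall h x, 0 < h -> `|iter k (fdiff h) F x| <= M * h `^ beta) ->
  (forall x y, `|F x - F y| <= L * `|x - y| `^ del) ->
  forall c s x, 0 < s -> c <= x <= c + k%:R * s ->
    `|F x - newton k c s F x| <= C * M * s `^ beta.
Proof.
move=> k0 b0; have [B B0 HB] := newton_halving R k.
set q := (2 : R) `^ (- beta).
have q0 : 0 <= q by exact: powR_ge0.
have q1 : q < 1 by exact: powR2N_lt1.
(* Chosen so that [(B + C) * q <= C]: a halving adds [B] to the constant and multiplies by
   [q = 2 ^ (- beta)]. *)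
pose C := B / (1 - q).
have C0 : 0 <= C by rewrite divr_ge0// subr_ge0 ltW.
have CE : (B + C) * q <= C.
  have BE : B = C * (1 - q) by rewrite divfK// subr_eq0 gt_eqF.
  have : 0 <= C * (1 - q) ^+ 2 by rewrite mulr_ge0// sqr_ge0.
  rewrite BE; move: (C) => D; rewrite expr2; lra.
exists C => // F M L del M0 L0 d0 FM FL c s x s0 cxs.
pose E := newton_bound R k * (L * k%:R `^ del).
have E0 : 0 <= E by rewrite mulr_ge0 ?newton_bound_ge0// mulr_ge0// powR_ge0.
(* Interpolation reproduces the constant [F y], so the error is controlled by the variation of [F]
   between [y] and the nodes. *)
have base a r y : 0 < r -> a <= y <= a + k%:R * r ->
    `|F y - newton k a r F y| <= E * r `^ del.
  move=> r0 /andP[ay yr].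
  have cstE := @newton_id R k a r (F y)%:P y (lt0r_neq0 r0).
  rewrite hornerC in cstE; rewrite -[X in X - _]cstE; last first.
    exact: leq_trans (size_polyC_leq1 _) k0.
  rewrite -newtonB -mulrA; apply: newton_le.
    move=> m mk; rewrite hornerC (le_trans (FL _ _))// -mulrA ler_wpM2l//.
    rewrite -powRM ?ler0n ?(ltW r0)//; apply: ge0_ler_powR; rewrite ?nnegrE ?(ltW d0)//.
      by rewrite mulr_ge0 ?(ltW r0).
    have mr : 0 <= r *+ m <= k%:R * r.
      by rewrite mulrn_wge0 ?(ltW r0)//= -[r *+ m]mulr_natl ler_wpM2r ?(ltW r0)// ler_nat ltnW.
    by rewrite ler_norml; apply/andP; split; lra.
  rewrite normrM normfV (gtr0_norm r0) ler_pdivrMr// ger0_norm ?subr_ge0//.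
  by rewrite lerBlDl (le_trans yr)// lerD2l ler_wpM2r ?(ltW r0)//; have := ler0n R k; lra.
(* After [m] halvings the Hoelder constant survives only with the factor [2 ^ (- del m)], which
   tends to [0]. *)
have claim m : forall a r y, 0 < r -> a <= y <= a + k%:R * r ->
    `|F y - newton k a r F y| <= C * M * r `^ beta + E * r `^ del * (2 `^ (- del)) ^+ m.
  elim: m => [|m ih] a r y r0 ayr.
    rewrite expr0 mulr1 (le_trans (base _ _ _ r0 ayr))// lerDr.
    exact: mulr_ge0 (mulr_ge0 C0 M0) (powR_ge0 _ _).
  have r20 : 0 < r / 2 by rewrite divr_gt0.
  have [a' a'y a'E] := HB F a r _ r0 (fun z => FM _ z r20) y ayr.
  rewrite -(subrKA (newton k a' (r / 2) F y)) (le_trans (ler_normD _ _))//.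
  rewrite (le_trans (lerD (ih _ _ _ r20 a'y) a'E))//.
  rewrite !powR_half ?(ltW r0)// -/q exprS.
  rewrite [leLHS](_ : _ = (B + C) * q * (M * r `^ beta) +
    E * r `^ del * (2 `^ (- del) * (2 `^ (- del)) ^+ m)); last by ring.
  by rewrite lerD2r -[C * M * _]mulrA ler_wpM2r// mulr_ge0// powR_ge0.
rewrite -subr_le0; apply: (@le_geometric0 _ (E * s `^ del) (2 `^ (- del))).
- exact: powR_ge0.
- exact: powR2N_lt1.
- by move=> m; rewrite lerBlDl; exact: claim.
Qed.

End Whitney1.

(** * Mixed differences and Whitney approximation in several variables *)

Section MixedDifferences.
Variables (R : realType).

Definition mdiff (V : zmodType) (hs : seq V) (f : V -> R) : V -> R :=
  foldr (@fdiff R V) f hs.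

Lemma mdiff_sum (V : zmodType) (hs : seq V) N (a : nat -> R) (f : nat -> V -> R) x :
  mdiff hs (fun y => \sum_(i < N) a i * f i y) x = \sum_(i < N) a i * mdiff hs (f i) x.
Proof.
elim: hs x => [//|h hs ih] x; rewrite /mdiff /= /fdiff -!/(mdiff hs _) !ih -sumrB.
by apply: eq_bigr => i _; rewrite mulrBr.
Qed.

Lemma mdiff_eq0 (V : zmodType) (hs : seq V) (f : V -> R) x : 0 \in hs -> mdiff hs f x = 0.
Proof.
elim: hs x => [//|h hs ih] x; rewrite in_cons /mdiff /= /fdiff -!/(mdiff hs _).
by move=> /predU1P[<-|h0]; [rewrite addr0 subrr|rewrite !ih// subrr].
Qed.

Lemma mdiff_comp (V W : zmodType) (phi : V -> W) (l : V -> W) (hs : seq V) (f : W -> R) x :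
  (forall y h, phi (y + h) = phi y + l h) ->
  mdiff hs (f \o phi) x = mdiff (map l hs) f (phi x).
Proof.
move=> phiD; elim: hs x => [//|h hs ih] x.
by rewrite /mdiff /= /fdiff -!/(mdiff _ _) !ih phiD.
Qed.

Lemma mdiff_cat (V : zmodType) (hs hs' : seq V) (f : V -> R) :
  mdiff (hs ++ hs') f = mdiff hs (mdiff hs' f).
Proof. by rewrite /mdiff foldr_cat. Qed.

Lemma mdiff_nseq (V : zmodType) j h (f : V -> R) : mdiff (nseq j h) f = iter j (fdiff h) f.
Proof. by elim: j => [//|j ih]; rewrite /mdiff /= -/(mdiff _ _) ih. Qed.

Variable n : nat.
Local Notation V := (n.-tuple R).

(** The bound on [F] is uniform in the first component, so only the second has to be followed along
    the steps. *)
Lemma mdiff_pair_bound (F : V * V -> R) r e (dirs : seq (V * V)) z :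
  (forall x y, tnorm1 y <= r -> `|F (x, y)| <= e) ->
  tnorm1 z.2 + \sum_(u <- dirs) tnorm1 u.2 <= r ->
  `|mdiff dirs F z| <= 2 ^+ size dirs * e.
Proof.
move=> Fe; elim: dirs z => [|u dirs ih] [x y] /=.
  by rewrite big_nil addr0 mul1r; exact: Fe.
rewrite big_cons => yr; rewrite /fdiff -!/(mdiff _ _) (le_trans (ler_normB _ _))//.
rewrite exprS -mulrA mulr_natl mulr2n lerD// ih//=.
  by rewrite (le_trans _ yr)// addrA lerD2r ler_tnorm1D.
by rewrite (le_trans _ yr)// lerD2l lerDr tnorm1_ge0.
Qed.

(* Kemperman's identity: differencing [(x, y) |-> D_y^k f x] along the
   directions [(h_i, - h_i / i)], only the term [f x] of the binomial expansion
   of [D_y^k f x] survives, since that of [f (x + m y)] does not move in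
   direction [m]. *)
Lemma kemperman k (f : V -> R) (M beta s : R) (hs : seq V) x :
  0 <= M -> 0 <= beta -> 0 <= s -> size hs = k -> all (fun h => tnorm1 h <= s) hs ->
  (forall h x, `|iter k (fdiff h) f x| <= M * tnorm h `^ beta) ->
  `|mdiff hs f x| <= 2 ^+ k * (M * (k%:R * s) `^ beta).
Proof.
move=> M0 b0 s0 szhs /allP hs_s fM.
have [a a0 aE] := iter_fdiff_expand R V k.
pose F (z : V * V) := iter k (fdiff z.2) f z.1.
pose dirs := [seq (nth 0 hs i, - (i.+1%:R^-1 *: nth 0 hs i)) | i <- iota 0 k].
have FE : F = fun z => \sum_(m < k.+1) a m * f (z.1 + z.2 *+ m).
  by apply/funext => z; rewrite /F aE.
have key : mdiff dirs F (x, 0) = a 0%N * mdiff hs f x.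
  rewrite FE (mdiff_sum _ _ _ (fun m z => f (z.1 + z.2 *+ m))).
  have affE m : mdiff dirs (fun z => f (z.1 + z.2 *+ m)) (x, 0) =
      mdiff [seq u.1 + u.2 *+ m | u <- dirs] f x.
    rewrite (mdiff_comp (phi := fun z : V * V => z.1 + z.2 *+ m)
      (l := fun u => u.1 + u.2 *+ m)) /= ?mul0rn ?addr0// => y h.
    by rewrite mulrnDl addrACA.
  rewrite big_ord_recl affE big1 ?addr0 => [|m _].
    congr (_ * mdiff _ _ _); rewrite -map_comp -[RHS](mkseq_nth 0) szhs.
    by apply: eq_map => i /=; rewrite addr0.
  rewrite affE mdiff_eq0 ?mulr0//; apply/mapP.
  exists (nth 0 hs m, - (m.+1%:R^-1 *: nth 0 hs m)).
    by apply/mapP; exists (m : nat); rewrite // mem_iota /= add0n.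
  rewrite /= /bump /= add1n mulNrn -scaler_nat scalerA divff ?pnatr_eq0//.
  by rewrite scale1r subrr.
have -> : `|mdiff hs f x| = `|mdiff dirs F (x, 0)|.
  by rewrite key normrM a0 normrX normrN1 expr1n mul1r.
have szd : size dirs = k by rewrite size_map size_iota.
rewrite -{1}szd; apply: (@mdiff_pair_bound _ (k%:R * s)).
  move=> y z zs; rewrite (le_trans (fM _ _))// ler_wpM2l//.
  apply: ge0_ler_powR; rewrite ?nnegrE ?tnorm_ge0 ?mulr_ge0//.
  exact: le_trans (ler_tnorm_tnorm1 _) zs.
rewrite /= (_ : tnorm1 0 = 0) ?add0r; last first.
  by rewrite -[0](scale0r (0 : V)) tnorm1Z normr0 mul0r.
rewrite big_map (_ : k%:R * s = \sum_(i <- iota 0 k) s); last first.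
  by rewrite big_const_seq count_predT size_iota iter_addr_0 mulr_natl.
rewrite big_seq [leRHS]big_seq; apply: ler_sum => i.
rewrite mem_iota add0n => /andP[_ ik] /=.
rewrite -scaleNr tnorm1Z normrN ger0_norm ?invr_ge0//.
rewrite -[leRHS]mul1r ler_pM ?tnorm1_ge0 ?invr_ge0//.
  by rewrite invf_le1 ?ltr0n// ler1n.
by apply: hs_s; apply: mem_nth; rewrite szhs.
Qed.

End MixedDifferences.

Section ConsNorm.
Variables (R : realType) (n : nat).
Implicit Types (t h : n.-tuple R) (x u : R).

Lemma cons_tupleD x u t h : cons_tuple (x + u) (t + h) = cons_tuple x t + cons_tuple u h.
Proof.
apply: eq_from_tnth => i; elim/ord_cases: i => [|i].
  by rewrite tnthD !tnth_cons0.
by rewrite tnthD !tnth_consS tnthD.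
Qed.

Lemma tnorm_cons0 h : tnorm (cons_tuple 0 h) = tnorm h.
Proof.
rewrite /tnorm big_ord_recl tnth_cons0 expr0n add0r.
by under eq_bigr do rewrite tnth_consS.
Qed.

Lemma tnorm_cons_zero u : tnorm (cons_tuple u (0 : n.-tuple R)) = `|u|.
Proof.
rewrite /tnorm big_ord_recl tnth_cons0 big1 ?addr0 ?sqrtr_sqr// => i _.
by rewrite tnth_consS tnth_zero expr0n.
Qed.

Lemma tnorm1_cons u h : tnorm1 (cons_tuple u h) = `|u| + tnorm1 h.
Proof.
rewrite /tnorm1 big_ord_recl tnth_cons0; congr (_ + _).
by apply: eq_bigr => i _; rewrite tnth_consS.
Qed.

Lemma tnorm1_zero : tnorm1 (0 : n.-tuple R) = 0.
Proof. by rewrite -[0](scale0r (0 : n.-tuple R)) tnorm1Z normr0 mul0r. Qed.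

End ConsNorm.

Section TensorNewton.
Variables (R : realType) (k : nat) (s : R).

(** Tensor product of one-variable interpolations; its total degree may exceed [k - 1], which
    [tnewton_truncate] repairs. *)
Fixpoint tnewton n : n.-tuple R -> (n.-tuple R -> R) -> n.-tuple R -> R :=
  match n return n.-tuple R -> (n.-tuple R -> R) -> n.-tuple R -> R with
  | 0 => fun _ g x => g x
  | m.+1 => fun c g x => newton k (thead c) s
      (fun u => tnewton [tuple of behead c] (fun t => g (cons_tuple u t)) [tuple of behead x])
      (thead x)
  end.

Lemma tnewtonB n (c : n.-tuple R) f g x :
  tnewton c (fun y => f y - g y) x = tnewton c f x - tnewton c g x.
Proof.
elim: n c f g x => [//|n ih] c f g x /=.
by rewrite -newtonB; congr newton; apply/funext => u; rewrite ih.
Qed.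

(** Interpolation is linear, so it commutes with differences in a parameter; thus the Newton
    coefficients in the first variable may be taken before interpolating in the others. *)
Lemma tnewton_iter_fdiff n (c : n.-tuple R) (g : R -> n.-tuple R -> R) j u x h :
  iter j (fdiff h) (fun v => tnewton c (g v) x) u =
  tnewton c (fun t => iter j (fdiff h) (fun v => g v t) u) x.
Proof.
elim: j u => [//|j ih] u; rewrite iterS /fdiff !ih -tnewtonB.
by congr tnewton.
Qed.

Definition box n (c : n.-tuple R) : set (n.-tuple R) :=
  [set x | forall i, tnth c i <= tnth x i <= tnth c i + k%:R * s].

Lemma box_cons n (c : n.+1.-tuple R) x : box c x ->
  thead c <= thead x <= thead c + k%:R * s /\
  box [tuple of behead c] [tuple of behead x].
Proof.
rewrite {1}[c]cons_tuple_eta {1}[x]cons_tuple_eta => cx; split.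
  by have := cx ord0; rewrite !tnth_cons0.
by move=> i; have := cx (lift ord0 i); rewrite !tnth_consS.
Qed.

Hypothesis s0 : 0 < s.

Lemma box_ratio c x : c <= x <= c + k%:R * s -> `|(x - c) / s| <= 2 * k%:R.
Proof.
move=> /andP[cx xc].
rewrite normrM normfV (gtr0_norm s0) ler_pdivrMr// ger0_norm ?subr_ge0//.
by rewrite lerBlDl (le_trans xc)// lerD2l ler_wpM2r ?(ltW s0)//; have := ler0n R k; lra.
Qed.

End TensorNewton.

Section Whitney.
Variables (R : realType) (k : nat) (beta : R).
Hypotheses (k0 : (0 < k)%N) (b0 : 0 < beta).

Definition lip_diff n (g : n.-tuple R -> R) (M : R) :=
  forall h x, `|iter k (fdiff h) g x| <= M * tnorm h `^ beta.
Definition hoelder_diff n (g : n.-tuple R -> R) (L del : R) :=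
  forall x h, `|g (x + h) - g x| <= L * tnorm h `^ del.

Lemma iter_fdiff_comp (V W : zmodType) (phi : V -> W) (h : V) (h' : W) j
    (f : W -> R) x : (forall y, phi (y + h) = phi y + h') ->
  iter j (fdiff h) (f \o phi) x = iter j (fdiff h') f (phi x).
Proof. by move=> phiD; elim: j x => [//|j ih] x; rewrite !iterS /fdiff !ih phiD. Qed.

Lemma iter_fdiff_cons0 n (g : n.+1.-tuple R -> R) j (h t : n.-tuple R) u :
  iter j (fdiff h) (fun y => g (cons_tuple u y)) t =
  iter j (fdiff (cons_tuple 0 h)) g (cons_tuple u t).
Proof.
apply: (iter_fdiff_comp (phi := fun y : n.-tuple R => cons_tuple u y)) => y.
by rewrite -cons_tupleD addr0.
Qed.

Lemma iter_fdiff_cons_zero n (g : n.+1.-tuple R -> R) j (h : R) (t : n.-tuple R) u :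
  iter j (fdiff h) (fun v => g (cons_tuple v t)) u =
  iter j (fdiff (cons_tuple h 0)) g (cons_tuple u t).
Proof.
apply: (iter_fdiff_comp (phi := fun v : R => cons_tuple v t)) => y.
by rewrite -cons_tupleD addr0.
Qed.

Lemma lip_diff_slice n (g : n.+1.-tuple R -> R) M u :
  lip_diff g M -> lip_diff (fun t => g (cons_tuple u t)) M.
Proof. by move=> gM h x; rewrite iter_fdiff_cons0 -tnorm_cons0; exact: gM. Qed.

Lemma hoelder_slice n (g : n.+1.-tuple R -> R) L del u :
  hoelder_diff g L del -> hoelder_diff (fun t => g (cons_tuple u t)) L del.
Proof.
move=> gL x h; rewrite -{1}[u]addr0 cons_tupleD -tnorm_cons0.
exact: gL.
Qed.

(** With [T1] the interpolation in the first variable and [T'] that in the rest,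
    [g - T1 T' g = (g - T1 g) + T1 (g - T' g)]: the one-variable bound, and the induction hypothesis
    multiplied by the norm of [T1]. *)
Lemma tnewton_error n : exists2 C : R, 0 <= C &
  forall (g : n.-tuple R -> R) (M L del : R), 0 <= M -> 0 <= L -> 0 < del ->
  lip_diff g M -> hoelder_diff g L del ->
  forall s c x, 0 < s -> box k s c x -> `|g x - tnewton k s c g x| <= C * M * s `^ beta.
Proof.
elim: n => [|n [Cn Cn0 ih]].
  by exists 0 => // g M L del *; rewrite /= subrr normr0 !mul0r.
have [C1 C10 H1] := newton_error k0 b0.
exists (C1 + newton_bound R k * Cn); first by rewrite addr_ge0// mulr_ge0// newton_bound_ge0.
move=> g M L del M0 L0 d0 gM gL s c x s0 /box_cons[cx0 cxS] /=.
set t := [tuple of behead x] in cxS *; set c' := [tuple of behead c] in cxS *.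
rewrite {1}[x]cons_tuple_eta -/t.
rewrite -(subrKA (newton k (thead c) s (fun u => g (cons_tuple u t)) (thead x))).
rewrite (le_trans (ler_normD _ _))// mulrDl mulrDl lerD//.
  apply: (H1 _ _ L del) => //.
    move=> h y h0; rewrite iter_fdiff_cons_zero (le_trans (gM _ _))//.
    by rewrite tnorm_cons_zero gtr0_norm.
  move=> y z; have -> : cons_tuple y t = cons_tuple z t + cons_tuple (y - z) 0.
    by rewrite -cons_tupleD addr0 addrC subrK.
  by rewrite -(tnorm_cons_zero n (y - z)); exact: gL.
rewrite -newtonB -!mulrA; apply: newton_le; last exact: box_ratio.
move=> m mk; rewrite mulrA; apply: (ih _ _ L del) => //.
- exact: lip_diff_slice.
- exact: hoelder_slice.
Qed.

Lemma pol_horner n d (q : {poly R}) i (c s : R) : (size q <= d.+1)%N ->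
  pol d (fun x : n.-tuple R => q.[(tnth x i - c) / s]).
Proof.
move=> qd; have py : pol 1 (fun x : n.-tuple R => (tnth x i - c) / s).
  apply: pol_ext (polD (pol_mulX i (pol_cst n 0 s^-1)) (pol_cst n 1 (- c / s))) => x.
  by rewrite mulrDl.
have pyX m : pol m (fun x : n.-tuple R => ((tnth x i - c) / s) ^+ m).
  elim: m => [|m ih]; first exact: pol_cst.
  by apply: pol_ext (polM py ih) => x; rewrite exprS.
apply: (@pol_ext _ _ _ (fun x : n.-tuple R =>
    \sum_(m < size q) q`_m * ((tnth x i - c) / s) ^+ m)).
  by move=> x; rewrite horner_coef.
apply: pol_sum => m _; apply: polZ; apply: polW (pyX m).
by rewrite -ltnS (leq_trans (ltn_ord m)).
Qed.

(* Each Newton coefficient in the first variable is a [j]-th difference, so its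
   slice only needs to be approximated by degree [< d - j]. *)
Lemma tnewton_truncate n : exists2 C : R, 0 <= C &
  forall d (g : n.-tuple R -> R) (e s : R) c, (d <= k)%N -> 0 < s ->
  (forall hs x, size hs = d -> all (fun h => tnorm1 h <= s) hs -> `|mdiff hs g x| <= e) ->
  exists2 P : n.-tuple R -> R, (if d is d'.+1 then pol d' P else P =1 fun=> 0) &
    forall x, box k s c x -> `|tnewton k s c g x - P x| <= C * e.
Proof.
elim: n => [|n [Cn Cn0 ih]].
  exists 1 => // d g e s c dk s0 ge.
  exists (if d is d'.+1 then fun=> g [tuple] else fun=> 0).
    by case: d {ge dk} => [//|d]; exact: pol_cst.
  move=> x _ /=; rewrite (tuple0 x); case: d dk ge => [|d] dk ge.
    by rewrite subr0 mul1r; exact: (ge [::]).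
  rewrite subrr normr0 mul1r.
  apply: (le_trans (normr_ge0 _) (ge (nseq d.+1 0) [tuple] (size_nseq _ _) _)).
  by apply/allP => h /nseqP[-> _]; rewrite tnorm1_zero ltW.
exists (\sum_(j < k) 2 ^+ k * (3 * k%:R) ^+ j * Cn).
  by apply: sumr_ge0 => j _; rewrite !mulr_ge0 ?exprn_ge0// mulr_ge0.
move=> d g e s c dk s0 ge.
pose c' : n.-tuple R := [tuple of behead c].
pose F j t := iter j (fdiff s) (fun u => g (cons_tuple u t)) (thead c).
have Fe j hs t : (j < k)%N -> size hs = (d - j)%N ->
    all (fun h => tnorm1 h <= s) hs -> `|mdiff hs (F j) t| <= 2 ^+ k * e.
  move=> jk szhs hs_s.
  have e0 : 0 <= e.
    apply: (le_trans (normr_ge0 _) (ge (nseq d 0) 0 (size_nseq _ _) _)).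
    by apply/allP => h /nseqP[-> _]; rewrite tnorm1_zero ltW.
  have FE : F j = (iter j (fdiff (cons_tuple s 0)) g) \o cons_tuple (thead c).
    by apply/funext => y; rewrite /F iter_fdiff_cons_zero.
  have -> : mdiff hs (F j) t = mdiff [seq cons_tuple 0 h | h <- hs]
     (iter j (fdiff (cons_tuple s 0)) g) (cons_tuple (thead c) t).
    by rewrite FE; apply: mdiff_comp => y h; rewrite -cons_tupleD addr0.
  have all0 : all (fun h => tnorm1 h <= s) [seq cons_tuple 0 h | h <- hs].
    rewrite all_map; apply: sub_all hs_s => h /=.
    by rewrite tnorm1_cons normr0 add0r.
  have alls m : all (fun h => tnorm1 h <= s) (nseq m (cons_tuple s (0 : n.-tuple R))).
    by apply/allP => h /nseqP[-> _]; rewrite tnorm1_cons tnorm1_zero addr0 gtr0_norm.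
  (* For [j <= d], the [j] steps in the first variable and the [d - j] in the others form a mixed
     difference of order [d]. For [j > d] the list [hs] is empty and each of the [j - d] surplus
     steps costs a factor [2]. *)
  have [jd|dj] := leqP j d.
    rewrite -mdiff_nseq -mdiff_cat (le_trans (ge _ _ _ _)) ?all_cat ?all0 ?alls//.
      by rewrite size_cat size_map size_nseq szhs subnK.
    by rewrite ler_peMl// exprn_ege1// ler1n.
  have -> : hs = [::] by apply: size0nil; rewrite szhs; lia.
  rewrite /= -(subnK (ltnW dj)).
  apply: le_trans (@iter_fdiff_bound _ _ _ (j - d) d g e _ _) _.
    by move=> y; rewrite -mdiff_nseq; apply: ge; rewrite ?size_nseq.
  by rewrite ler_wpM2r// ler_weXn2l ?ler1n// (leq_trans (leq_subr _ _))// ltnW.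
have /choice[P HP] (j : 'I_k) : exists P : n.-tuple R -> R,
    (if (d - j)%N is d'.+1 then pol d' P else P =1 fun=> 0) /\
    forall t, box k s c' t -> `|tnewton k s c' (F j) t - P t| <= Cn * (2 ^+ k * e).
  have [P Pd PE] := ih (d - j)%N (F j) (2 ^+ k * e) s c' (leq_trans (leq_subr _ _) dk) s0
     (fun hs t => Fe j hs t (ltn_ord j)).
  by exists P.
exists (fun x : n.+1.-tuple R => \sum_(j < k) P j [tuple of behead x] * (binp R j).[(thead x - thead c) / s]).
  case: d dk ge Fe HP => [|d] dk ge Fe HP.
    move=> x; apply: big1 => j _; have [P0 _] := HP j.
    by rewrite [P j _]P0 mul0r.
  apply: pol_sum => j _; have [+ _] := HP j.
  have [jd|dj] := leqP j d.
    rewrite subSn// => Pd; rewrite -[d](subnK jd); apply: polM.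
      exact: pol_cons.
    apply: pol_ext (pol_horner ord0 (thead c) s (size_binp R j)) => x.
    by [].
  rewrite (_ : (d.+1 - j)%N = 0%N); last by lia.
  move=> P0; apply: pol_ext (pol_cst _ d 0) => x.
  by rewrite P0 mul0r.
move=> x /box_cons[cx0 cxS] /=.
rewrite /newton -sumrB mulr_suml (le_trans (ler_norm_sum _ _ _))//.
apply: ler_sum => j _; rewrite tnewton_iter_fdiff -mulrBl normrM.
have [_ HPj] := HP j.
rewrite (le_trans (ler_pM _ _ (HPj _ cxS) (binp_bound (ltnW (ltn_ord j)) (box_ratio s0 cx0))))//.
by rewrite le_eqVlt; apply/orP; left; apply/eqP; ring.
Qed.

(** The truncation is fed with Kemperman's bound at order [k]. The Hoelder constants [L] and [del]
    are absent from the estimate: they only made the halving argument converge. *)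
Lemma whitney n : exists2 C : R, 0 <= C &
  forall (g : n.-tuple R -> R) (M L del : R), 0 <= M -> 0 <= L -> 0 < del ->
  lip_diff g M -> hoelder_diff g L del ->
  forall s c, 0 < s -> exists2 P, pol k.-1 P &
    forall x, box k s c x -> `|g x - P x| <= C * M * s `^ beta.
Proof.
have [C1 C10 H1] := tnewton_error n; have [C2 C20 H2] := tnewton_truncate n.
exists (C1 + C2 * (2 ^+ k * k%:R `^ beta)).
  by rewrite addr_ge0// !mulr_ge0 ?exprn_ge0 ?powR_ge0.
move=> g M L del M0 L0 d0 gM gL s c s0.
have := H2 k g (2 ^+ k * (M * (k%:R * s) `^ beta)) s c (leqnn k) s0.
case.
  by move=> hs x szhs hs_s; apply: kemperman => //; rewrite ltW.
have kpred (P : n.-tuple R -> R) : (if k is d'.+1 then pol d' P else P =1 fun=> 0) -> pol k.-1 P.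
  by case: (k) (k0).
move=> P /kpred Pk PE; exists P => // x cx.
rewrite -(subrKA (tnewton k s c g x)) (le_trans (ler_normD _ _))//.
rewrite (le_trans (lerD (H1 g M L del M0 L0 d0 gM gL s c x s0 cx) (PE x cx)))//.
rewrite powRM ?(ltW s0)//.
by rewrite le_eqVlt; apply/orP; left; apply/eqP; ring.
Qed.

End Whitney.

(** * Lebesgue measure on tuples and the upper integral *)

Section ConsMeasure.
Variables (R : realType) (n : nat).
Let T := measurableTypeR R.
Variable lam : {sigma_finite_measure set T -> \bar R}.
Variable mu : {sigma_finite_measure set (n.-tuple R) -> \bar R}.

Definition tuple_of_pair (z : T * n.-tuple R) : n.+1.-tuple R := cons_tuple z.1 z.2.

Lemma measurable_tuple_of_pair : measurable_fun setT tuple_of_pair.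
Proof. exact: (measurable_cons measurable_fst measurable_snd). Qed.

(** The product measure is transported to tuples so that the construction iterates; Tonelli for it
    is then exactly the recursion of [leb_int]. Sigma-finiteness is carried along because the next
    product requires it. *)
Definition cons_measure : set (n.+1.-tuple R) -> \bar R :=
  pushforward (lam \x mu)%E tuple_of_pair.

Let m0 : cons_measure set0 = 0%E.
Proof. by rewrite /cons_measure /pushforward preimage_set0 measure0. Qed.
Let m_ge0 A : (0 <= cons_measure A)%E.
Proof. by rewrite /cons_measure /pushforward measure_ge0. Qed.
Let m_add : semi_sigma_additive cons_measure.
Proof.
move=> F mF tF mUF; rewrite /cons_measure /pushforward preimage_bigcup.
apply: measure_semi_sigma_additive.
- by move=> i; rewrite -[X in measurable X]setTI; exact: measurable_tuple_of_pair.
- apply/trivIsetP => /= i j _ _ ij; rewrite -preimage_setI.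
  by move/trivIsetP : tF => /(_ _ _ _ _ ij) ->//; rewrite preimage_set0.
- rewrite -preimage_bigcup -[X in measurable X]setTI.
  exact: measurable_tuple_of_pair.
Qed.
HB.instance Definition _ := isMeasure.Build _ _ _ cons_measure m0 m_ge0 m_add.

Let m_sigma : sigma_finite setT cons_measure.
Proof.
have /sigma_finiteP[F [FT ndF mF]] := sigma_finiteT lam.
have /sigma_finiteP[G [GT ndG mG]] := sigma_finiteT mu.
pose psi (t : n.+1.-tuple R) : T * n.-tuple R := (thead t, [tuple of behead t]).
have mpsi : measurable_fun setT psi.
  by apply/measurable_fun_pairP; split; [exact: measurable_tnth|exact: measurable_behead].
have phiK : cancel tuple_of_pair psi.
  move=> [x t]; rewrite /psi /tuple_of_pair /=; congr pair.
  exact: val_inj.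
exists (fun i => psi @^-1` (F i `*` G i)).
  rewrite -preimage_bigcup -(@preimage_setT _ _ psi); congr (_ @^-1` _).
  rewrite -setXTT FT GT predeqE => -[x y]; split.
    move=> [/= [i _ Fix] [k _ Gky]]; exists (maxn i k) => //; split.
    - by move: x Fix; exact/subsetPset/ndF/leq_maxl.
    - by move: y Gky; exact/subsetPset/ndG/leq_maxr.
  by move=> [i _ []/= ? ?]; split; exists i.
move=> i; have [mFi Foo] := mF i; have [mGi Goo] := mG i; split.
  by rewrite -[X in measurable X]setTI; apply: mpsi => //; exact: measurableX.
rewrite /cons_measure /pushforward -comp_preimage.
rewrite (_ : psi \o _ = id); last by apply/funext => z /=; rewrite phiK.
by rewrite preimage_id product_measure1E// lte_mul_pinfty// ge0_fin_numE.
Qed.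
HB.instance Definition _ := Measure_isSigmaFinite.Build _ _ _ cons_measure m_sigma.

Lemma integral_cons_measure (h : n.+1.-tuple R -> \bar R) :
  measurable_fun setT h -> (forall x, 0 <= h x)%E ->
  (\int[cons_measure]_x h x =
   \int[lam]_x \int[mu]_t h (cons_tuple x t))%E.
Proof.
move=> mh h0.
rewrite [LHS](_ : _ = \int[pushforward (lam \x mu) tuple_of_pair]_x h x)%E//.
rewrite ge0_integral_pushforward//; last exact: measurable_tuple_of_pair.
rewrite preimage_setT fubini_tonelli1//=.
by apply: measurableT_comp => //; exact: measurable_tuple_of_pair.
Qed.

End ConsMeasure.

Section TupleMeasure.
Variable R : realType.

Let leb : {sigma_finite_measure set (measurableTypeR R) -> \bar R} := @lebesgue_measure R.

Fixpoint tuple_measure n : {sigma_finite_measure set (n.-tuple R) -> \bar R} :=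
  if n is m.+1 then cons_measure leb (tuple_measure m) : {sigma_finite_measure set (m.+1.-tuple R) -> \bar R}
  else \d_([tuple] : 0.-tuple R).

Lemma leb_intE n (h : n.-tuple R -> \bar R) :
  measurable_fun setT h -> (forall x, 0 <= h x)%E ->
  leb_int h = (\int[tuple_measure n]_x h x)%E.
Proof.
elim: n h => [|n ih] h mh h0.
  by rewrite [RHS]integral_dirac// diracT mul1e.
rewrite [RHS]integral_cons_measure//=; apply: eq_integral => x _.
rewrite ih//.
by apply: measurableT_comp => //; exact: measurable_cons.
Qed.

End TupleMeasure.

Section UpperIntegral.
Variables (R : realType) (n : nat).
Local Notation V := (n.-tuple R).
Local Notation mu := (tuple_measure R n).
Local Open Scope ereal_scope.
Implicit Types (h : V -> \bar R).

Lemma uintE h : measurable_fun setT h -> (forall x, 0 <= h x) ->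
  uint h = \int[mu]_x h x.
Proof.
move=> mh h0; apply/eqP; rewrite eq_le; apply/andP; split.
  rewrite -leb_intE//; apply: ereal_inf_lbound.
  by exists h => //; split.
apply: le_ereal_inf_tmp => _ [h' [mh' hh'] <-].
rewrite leb_intE//; last by move=> x; have [] := hh' x.
by apply: ge0_le_integral => // x _; have [] := hh' x.
Qed.

Lemma uint_ge0 h : 0 <= uint h.
Proof.
apply: le_ereal_inf_tmp => _ [h' [mh' hh'] <-].
have h'0 x : 0 <= h' x by have [] := hh' x.
by rewrite leb_intE//; apply: integral_ge0 => x _.
Qed.

Lemma le_uint h1 h2 : (forall x, h1 x <= h2 x) -> uint h1 <= uint h2.
Proof.
move=> h12; apply: le_ereal_inf_tmp => _ [h' [mh' hh'] <-].
apply: ereal_inf_lbound; exists h' => //; split => // x.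
by have [? ?] := hh' x; split => //; exact: le_trans (h12 x) _.
Qed.

Lemma uint_lt_exists h (e : \bar R) : uint h < e -> exists h' : V -> \bar R,
  [/\ measurable_fun setT h', (forall x, 0 <= h' x), (forall x, h x <= h' x) &
      \int[mu]_x h' x < e].
Proof.
move=> /ereal_inf_lt [_ [h' [mh' hh'] <-]] h'e; exists h'; split => //.
- by move=> x; have [] := hh' x.
- by move=> x; have [] := hh' x.
- by rewrite -leb_intE// => x; have [] := hh' x.
Qed.

(** Nearly optimal Borel majorants add up. For arbitrary functions this is an inequality, the one
    behind the triangle inequalities for [aint]. *)
Lemma uintD h1 h2 : uint (fun x => h1 x + h2 x) <= uint h1 + uint h2.
Proof.
have [h1oo|h1oo] := eqVneq (uint h1) +oo.
  by rewrite h1oo addye ?leey// gt_eqF// (lt_le_trans _ (uint_ge0 h2)).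
have [h2oo|h2oo] := eqVneq (uint h2) +oo.
  by rewrite h2oo addey ?leey// gt_eqF// (lt_le_trans _ (uint_ge0 h1)).
have f1 : uint h1 \is a fin_num by rewrite ge0_fin_numE ?uint_ge0// ltey.
have f2 : uint h2 \is a fin_num by rewrite ge0_fin_numE ?uint_ge0// ltey.
apply/lee_addgt0Pr => e e0.
have e20 : (0 < e / 2)%R by rewrite divr_gt0.
have [g1 [mg1 g10 hg1 ig1]] : exists h' : V -> \bar R,
  [/\ measurable_fun setT h', (forall x, 0 <= h' x), (forall x, h1 x <= h' x) &
      \int[mu]_x h' x < uint h1 + (e / 2)%:E].
  by apply: uint_lt_exists; rewrite lteDl// lte_fin.
have [g2 [mg2 g20 hg2 ig2]] : exists h' : V -> \bar R,
  [/\ measurable_fun setT h', (forall x, 0 <= h' x), (forall x, h2 x <= h' x) &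
      \int[mu]_x h' x < uint h2 + (e / 2)%:E].
  by apply: uint_lt_exists; rewrite lteDl// lte_fin.
apply: (@le_trans _ _ (\int[mu]_x (g1 x + g2 x))).
  rewrite -uintE.
  - by apply: le_uint => x; exact: leeD.
  - exact: emeasurable_funD.
  - by move=> x; exact: adde_ge0.
rewrite ge0_integralD// [e%:E](_ : _ = (e / 2)%:E + (e / 2)%:E).
  by rewrite (addeACA (uint h1)); apply: leeD; exact: ltW.
by rewrite -EFinD -splitr.
Qed.

(** The infimum of countably many Borel majorants with integrals tending to [0] is a Borel majorant
    of integral [0]. *)
Lemma uint0_negligible h : uint h = 0 -> mu.-negligible [set x | 0 < h x].
Proof.
move=> h0.
have /choice[g gP] (m : nat) : exists h' : V -> \bar R,
  [/\ measurable_fun setT h', (forall x, 0 <= h' x), (forall x, h x <= h' x) &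
      \int[mu]_x h' x < (m.+1%:R^-1)%:E].
  by apply: uint_lt_exists; rewrite h0 lte_fin invr_gt0.
pose H x := einfs (g ^~ x) 0%N.
have mH : measurable_fun setT H.
  by apply: measurable_fun_einfs => m; have [] := gP m.
have H0 x : 0 <= H x.
  by apply: le_ereal_inf_tmp => _ [m _ <-]; have [_ + _ _] := gP m; exact.
have hH x : h x <= H x.
  by apply: le_ereal_inf_tmp => _ [m _ <-]; have [_ _ + _] := gP m; exact.
have Hg m x : H x <= g m x by apply: ereal_inf_lbound; exists m.
have iH : \int[mu]_x H x = 0.
  apply/eqP; rewrite eq_le integral_ge0// andbT.
  apply/lee_addgt0Pr => e e0; rewrite add0e.
  have [mg g0 _ /ltW ig] := gP (Num.truncn e^-1).
  rewrite (@le_trans _ _ (\int[mu]_x g (Num.truncn e^-1) x))//.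
    exact: ge0_le_integral.
  rewrite (le_trans ig)// lee_fin invf_ple ?posrE//.
  exact/ltW/truncnS_gt.
have /ae_eq_integral_abs : \int[mu]_x `|H x| = 0.
  by rewrite -[RHS]iH; apply: eq_integral => x _; rewrite gee0_abs.
move=> /(_ measurableT mH)[A [mA A0 HA]].
exists A; split => // x /= hx; apply: HA => /= /(_ I) Hx0.
by have := lt_le_trans hx (hH x); rewrite Hx0 ltxx.
Qed.

Lemma le_uint_ae h1 h2 N : mu.-negligible N ->
  (forall x, ~ N x -> h1 x <= h2 x) -> uint h1 <= uint h2.
Proof.
move=> [A [mA A0 NA]] h12; apply: le_ereal_inf_tmp => _ [h' [mh' hh'] <-].
have h'0 x : 0 <= h' x by have [] := hh' x.
(* Infinite on the null set [A]: the integral of [h'] is unchanged, but [g] now majorizes [h1]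
   everywhere. *)
pose g x := h' x + (\1_A x)%:E * +oo.
have mg : measurable_fun setT g.
  apply: emeasurable_funD => //; apply: emeasurable_funM => //.
  exact/measurable_EFinP/measurable_indic.
have g0 x : 0 <= g x by rewrite adde_ge0// mule_ge0 ?lee_fin.
rewrite leb_intE//.
have -> : \int[mu]_x h' x = \int[mu]_x g x.
  apply: ge0_ae_eq_integral => //.
  exists A; split => // x /=; apply: contra_notP => Ax _.
  by rewrite /g indicE memNset// mul0e adde0.
rewrite -uintE//; apply: le_uint => x.
have [Ax|nAx] := pselect (A x).
  rewrite /g indicE mem_set// mul1e addey ?leey//.
  by rewrite gt_eqF// (lt_le_trans _ (h'0 x)).
rewrite /g indicE memNset// mul0e adde0.
have [_ h2h'] := hh' x; rewrite (le_trans _ h2h')//.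
by apply: h12; apply: contra_not nAx; exact: NA.
Qed.

Lemma uint_ae h1 h2 N : mu.-negligible N ->
  (forall x, ~ N x -> h1 x = h2 x) -> uint h1 = uint h2.
Proof.
by move=> N0 h12; apply/eqP; rewrite eq_le; apply/andP; split;
  apply: (le_uint_ae N0) => x /h12 ->.
Qed.

Lemma null_negligible (N : set V) : null N <-> mu.-negligible N.
Proof.
split => [/uint0_negligible|N0].
  apply: negligibleS => x Nx /=.
  by rewrite indicE mem_set// lte_fin.
rewrite /null /lmeas (@uint_ae _ (cst 0) N)//.
  by rewrite uintE// integral0.
by move=> x Nx; rewrite indicE memNset.
Qed.

Lemma lmeasE (A : set V) : measurable A -> lmeas A = mu A.
Proof.
move=> mA; rewrite /lmeas uintE//; first by rewrite integral_indic// setIT.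
exact/measurable_EFinP/measurable_indic.
Qed.

End UpperIntegral.

(** * Cubes, balls and Borel measurability of continuous functions *)

Section Cubes.
Variable R : realType.
Local Open Scope ereal_scope.

(** Half-open, so that the [2 ^ n] halves of a cube partition it. *)
Definition cube n (a : n.-tuple R) (s : R) : set (n.-tuple R) :=
  [set y | forall i, (tnth a i <= tnth y i < tnth a i + s)%R].

Lemma measurable_cube n (a : n.-tuple R) s : measurable (cube a s).
Proof.
rewrite (_ : cube a s = \bigcap_(i in [set: 'I_n])
    ((fun y : n.-tuple R => tnth y i) @^-1` `[tnth a i, (tnth a i + s)%R[)).
  apply: fin_bigcap_measurable; first exact: finite_finset.
  move=> i _; rewrite -[X in measurable X]setTI.
  exact: (@measurable_tnth _ R).
apply/seteqP; split => [y ya i _|y ya i]; first by rewrite /= in_itv/= ya.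
by have := ya i I; rewrite /= in_itv.
Qed.

Lemma cube_cons n (a : n.+1.-tuple R) s x (t : n.-tuple R) :
  cube a s (cons_tuple x t) <->
  (thead a <= x < thead a + s)%R /\ cube [tuple of behead a] s t.
Proof.
rewrite {1}[a]cons_tuple_eta; split=> [H|[H0 H]].
  split; first by have := H ord0; rewrite !tnth_cons0.
  by move=> i; have := H (lift ord0 i); rewrite !tnth_consS.
by apply: ord_cases => [|i]; rewrite ?tnth_consS//; exact: H.
Qed.

Lemma tuple_measure_cube n (a : n.-tuple R) s : (0 <= s)%R ->
  tuple_measure R n (cube a s) = (s ^+ n)%:E.
Proof.
move=> s0.
have indE m (b : m.-tuple R) : tuple_measure R m (cube b s) =
    leb_int (fun y => (\1_(cube b s) y)%:E).
  rewrite leb_intE.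
  - by rewrite integral_indic ?setIT//; exact: measurable_cube.
  - by apply/measurable_EFinP/measurable_indic; exact: measurable_cube.
  - by move=> x; rewrite lee_fin.
elim: n a => [|n ih] a.
  by rewrite indE /= indicE mem_set// => -[].
rewrite indE /=.
under eq_integral.
  move=> x _; rewrite (_ : leb_int _ =
      (s ^+ n)%:E * (\1_(`[thead a, (thead a + s)%R[%classic) x)%:E); first over.
  rewrite -(ih [tuple of behead a]) indE; have [xa|xa] := boolP (thead a <= x < thead a + s)%R.
    rewrite [X in _ * X%:E]indicE mem_set /= ?in_itv//= mule1.
    congr leb_int; apply/funext => t; rewrite !indicE.
    suff -> : (cons_tuple x t \in cube a s) = (t \in cube [tuple of behead a] s) by [].
    apply/idP/idP; rewrite !inE => /=; first by case/cube_cons.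
    by move=> ?; apply/cube_cons.
  rewrite [X in _ * X%:E]indicE memNset /= ?in_itv/= ?mule0; last by apply/negP.
  rewrite (_ : (fun _ => _) = cst 0); last first.
    apply/funext => t; rewrite indicE memNset// => /cube_cons[].
    by rewrite (negbTE xa).
  by rewrite leb_intE// integral0.
rewrite ge0_integralZl//; last 2 first.
- exact/measurable_EFinP/measurable_indic.
- by rewrite lee_fin exprn_ge0.
rewrite integral_indic// setIT [X in _ * X](_ : _ = s%:E); last first.
  transitivity (@lebesgue_measure R `[thead a, (thead a + s)%R[%classic) => //.
  rewrite lebesgue_measure_itv/= lte_fin ltrDl; case: ltP => [_|].
    by rewrite -EFinB addrAC subrr add0r.
  by move=> ?; congr (_%:E); apply/eqP; rewrite eq_le s0.
by rewrite -EFinM exprSr.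
Qed.

End Cubes.

Section Balls.
Variables (R : realType) (n : nat).
Local Notation V := (n.-tuple R).
Implicit Types (c x y : V) (r : R).

Lemma measurable_ball_of c r : measurable (ball_of c r).
Proof.
have [r0|r0] := leP r 0.
  rewrite (_ : ball_of c r = set0)// -subset0 => y.
  by rewrite /ball_of /= ltNge (le_trans r0)// tnorm_ge0.
pose q y : R := \sum_(i < n) (tnth y i - tnth c i) ^+ 2.
have mq : measurable_fun setT q.
  apply: measurable_sum => i; apply: measurable_funX.
  by apply: measurable_funB => //; exact: (@measurable_tnth _ R).
rewrite (_ : ball_of c r = q @^-1` `]-oo, r ^+ 2[).
  by rewrite -[X in measurable X]setTI; exact: mq.
apply/seteqP; split=> y; rewrite /ball_of /= in_itv /= tsubE /tnorm /q.
  under eq_bigr do rewrite tnthB.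
  move=> h; rewrite -[ltLHS]sqr_sqrtr ?sumr_ge0// => [|i _]; last exact: sqr_ge0.
  by rewrite ltr_pXn2r// ?nnegrE ?sqrtr_ge0// ltW.
under [X in _ -> Num.sqrt X < _]eq_bigr do rewrite tnthB.
move=> h; rewrite -[ltRHS](ger0_norm (ltW r0)) -sqrtr_sqr ltr_sqrt//.
by rewrite exprn_gt0.
Qed.

Lemma cube_sub_ball c r a s : 0 < s ->
  (forall i, tnth c i - s <= tnth a i <= tnth c i) -> n%:R * s < r ->
  cube a s `<=` ball_of c r.
Proof.
move=> s0 ca nsr y ya; rewrite /ball_of /= tsubE.
rewrite (le_lt_trans (ler_tnorm_tnorm1 _))// (le_lt_trans _ nsr)//.
rewrite (_ : n%:R * s = \sum_(i < n) s); last by rewrite sumr_const card_ord mulr_natl.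
apply: ler_sum => i _; rewrite tnthB ler_norml; have := ya i; have := ca i => /=.
by move=> /andP[? ?] /andP[? ?]; apply/andP; split; lra.
Qed.

Lemma ball_sub_cube c r : ball_of c r `<=` cube (c - [tuple r | i < n]) (2 * r).
Proof.
move=> y; rewrite /ball_of /= tsubE => yr i; rewrite tnthB tnth_mktuple.
have := le_lt_trans (ler_tnth_tnorm (y - c) i) yr.
by rewrite tnthB ltr_norml => /andP[? ?]; apply/andP; split; lra.
Qed.

Lemma ball_measure_le c r : 0 <= r ->
  (tuple_measure R n (ball_of c r) <= ((2 * r) ^+ n)%:E)%E.
Proof.
move=> r0; rewrite -(tuple_measure_cube (c - [tuple r | i < n])) ?mulr_ge0//.
rewrite le_measure ?inE//; first exact: measurable_ball_of.
- exact: measurable_cube.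
- exact: ball_sub_cube.
Qed.

(** A cube of side [r / (n + 1)] has l1 diameter below [r]. Constants depending on [n] are harmless,
    so the exact volume of the ball is replaced by this and [ball_measure_le]. *)
Lemma ball_measure_ge c r : 0 < r ->
  (((r / n.+1%:R) ^+ n)%:E <= tuple_measure R n (ball_of c r))%E.
Proof.
move=> r0; have s0 : 0 < r / n.+1%:R by rewrite divr_gt0.
rewrite -(tuple_measure_cube c) ?(ltW s0)//.
rewrite le_measure ?inE//; first exact: measurable_cube.
- exact: measurable_ball_of.
- apply: cube_sub_ball => //.
    by move=> i; rewrite lexx andbT gerBl ltW.
  rewrite mulrCA gtr_pMr// ltr_pdivrMr// mul1r.
  by rewrite ltr_nat.
Qed.

(** The sigma-algebra on tuples is generated by coordinates while [tcontinuous] uses [tnorm]; the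
    link is that the preimage of an open ray is a countable union of boxes with rational centres. *)
Lemma tcontinuous_measurable (f : V -> R) : tcontinuous f -> measurable_fun setT f.
Proof.
move=> cf; apply: (measurability _ (RGenOInfty.measurableE R)) => //.
move=> /= _ [_ [a ->] <-]; rewrite setTI.
pose box (q : n.-tuple rat) (j : nat) : set V :=
  [set y | forall i, `|tnth y i - ratr (tnth q i)| < j.+1%:R^-1].
have mbox q j : measurable (box q j).
  rewrite (_ : box q j = \bigcap_(i in [set: 'I_n]) ((fun y : V =>
      `|tnth y i - ratr (tnth q i)|) @^-1` `]-oo, j.+1%:R^-1[)).
    apply: fin_bigcap_measurable; first exact: finite_finset.
    move=> i _; rewrite -[X in measurable X]setTI.
    have : measurable_fun setT (fun y : V => `|tnth y i - ratr (tnth q i)|).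
      apply: measurableT_comp => //; apply: measurable_funB => //.
      exact: (@measurable_tnth _ R).
    exact.
  apply/seteqP; split => [y yq i _|y yq i]; first by rewrite /= in_itv/= yq.
  by have := yq i I; rewrite /= in_itv.
set U := f @^-1` _.
rewrite (_ : U = \bigcup_(z : n.-tuple rat * nat)
    (if `[< box z.1 z.2 `<=` U >] then box z.1 z.2 else set0)).
  apply: countable_bigcupT_measurable => //.
  by move=> [q j] /=; case: asboolP.
apply/seteqP; split => [x Ux|x [[q j] _ /=]]; last first.
  by case: asboolP => // qU; exact: qU.
have ax : 0 < f x - a by move: Ux; rewrite /U /= in_itv/= andbT subr_gt0.
have [del del0 Hdel] := cf x _ ax.
pose j := Num.truncn (2 * n%:R / del).
have jdel : n%:R * (2 * j.+1%:R^-1) < del.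
  rewrite mulrA ltr_pdivrMr// [ltRHS]mulrC -ltr_pdivrMr// [n%:R * 2]mulrC.
  exact: truncnS_gt.
have /choice[q xq] (i : 'I_n) : exists q : rat, `|tnth x i - ratr q| < j.+1%:R^-1.
  have j0 : 0 < j.+1%:R^-1 :> R by rewrite invr_gt0.
  move: (j.+1%:R^-1) j0 => e e0; have : tnth x i - e < tnth x i + e by lra.
  move=> /rat_in_itvoo[q]; rewrite in_itv/= => /andP[? ?]; exists q.
  by rewrite ltr_norml; apply/andP; split; lra.
exists ([tuple q i | i < n], j) => //=.
rewrite asboolT; first by move=> i; rewrite tnth_mktuple.
move=> y yq; rewrite /U /= in_itv/= andbT.
have /Hdel : tnorm (tsub y x) < del.
  rewrite tsubE (le_lt_trans (ler_tnorm_tnorm1 _))// (le_lt_trans _ jdel)//.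
  rewrite (_ : n%:R * _ = \sum_(i < n) (2 * j.+1%:R^-1));
    last by rewrite sumr_const card_ord mulr_natl.
  apply: ler_sum => i _; rewrite tnthB; have := yq i; have := xq i; rewrite tnth_mktuple.
  move: (j.+1%:R^-1) => e.
  rewrite !ltr_norml ler_norml => /andP[? ?] /andP[? ?].
  by apply/andP; split; lra.
by rewrite ltr_norml => /andP[? ?]; lra.
Qed.

End Balls.

(** * Pointwise bounds for polynomials by their mean values *)

Section Lagrange.
Variable R : realType.

Lemma lagrange_interpolation d (y : 'I_d.+1 -> R) (q : {poly R}) x :
  injective y -> (size q <= d.+1)%N ->
  q.[x] = \sum_i q.[y i] * \prod_(j < d) ((x - y (lift i j)) / (y i - y (lift i j))).
Proof.
move=> yi qd.
pose p := \sum_i q.[y i] *: \prod_(j < d) ((y i - y (lift i j))^-1 *: ('X - (y (lift i j))%:P)).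
have pE z : p.[z] =
    \sum_i q.[y i] * \prod_(j < d) ((z - y (lift i j)) / (y i - y (lift i j))).
  rewrite horner_sum; apply: eq_bigr => i _; rewrite hornerZ horner_prod.
  by congr (_ * _); apply: eq_bigr => j _; rewrite hornerZ hornerXsubC mulrC.
rewrite -pE; apply/eqP; rewrite -subr_eq0 -hornerN -hornerD; apply/eqP.
suff -> : q - p = 0 by rewrite horner0.
apply/eqP; apply: contraT => qp0.
have pd : (size p <= d.+1)%N.
  apply: (leq_trans (size_sum _ _ _)); apply/bigmax_leqP => i _.
  rewrite (leq_trans (size_scale_leq _ _))//.
  rewrite scaler_prod (leq_trans (size_scale_leq _ _))//.
  by rewrite size_prod_XsubC /index_enum -enumT size_enum_ord.
have qpd : (size (q - p)%R <= d.+1)%N.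
  by rewrite (leq_trans (size_polyD _ _))// size_polyN geq_max qd.
have rall : all (root (q - p)) (codom y).
  apply/allP => _ /codomP[i ->]; rewrite rootE hornerD hornerN pE (bigD1 i)//=.
  rewrite [X in _ * X]big1 => [|j _]; last first.
    by rewrite divff// subr_eq0 (inj_eq yi) neq_lift.
  rewrite mulr1 big1 ?addr0 ?subrr// => i' i'i.
  have [j ij _] := unlift_some i'i.
  by rewrite (bigD1 j)//= -ij subrr mul0r mul0r mulr0.
have runiq : uniq (codom y) by rewrite map_inj_uniq ?enum_uniq.
by have := max_poly_roots qp0 rall runiq; rewrite size_codom card_ord ltnNge qpd.
Qed.

Lemma lagrange_bound d (y : 'I_d.+1 -> R) (q : {poly R}) x v (r : R) :
  (size q <= d.+1)%N -> 0 < r ->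
  (forall i j, i != j -> r <= `|y i - y j|) -> (forall i, `|q.[y i]| <= v) ->
  forall s, (forall i, `|x - y i| <= s) -> `|q.[x]| <= d.+1%:R * (v * (s / r) ^+ d).
Proof.
move=> qd r0 yr qv s xs.
have yi : injective y.
  move=> i j yij; apply/eqP; apply: contraT => /yr.
  by rewrite yij subrr normr0 leNgt r0.
have s0 : 0 <= s by exact: le_trans (xs ord0).
rewrite (lagrange_interpolation x yi qd) (le_trans (ler_norm_sum _ _ _))//.
rewrite (_ : d.+1%:R * _ = \sum_(i < d.+1) (v * (s / r) ^+ d)); last first.
  by rewrite sumr_const card_ord mulr_natl.
apply: ler_sum => i _; rewrite normrM ler_pM// normr_prod.
rewrite [leRHS](_ : _ = \prod_(j < d) (s / r)); last by rewrite prodr_const card_ord.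
apply: ler_prod => j _; rewrite normr_ge0 normrM normfV /=.
have ij := yr i (lift i j) (neq_lift _ _).
by rewrite ler_pM ?invr_ge0// lef_pV2// posrE (lt_le_trans r0).
Qed.

End Lagrange.

Section PolySup.
Variable R : realType.
Local Open Scope ereal_scope.

Lemma measurable_horner (q : {poly R}) : measurable_fun setT (fun u : R => q.[u]%R).
Proof. by apply: continuous_measurable_fun => u; exact: continuous_horner. Qed.

Lemma poly_point_le (q : {poly R}) (a b r : R) : (a < b)%R -> 
  \int[@lebesgue_measure R]_(u in `[a, b[) `|q.[u]|%:E < r%:E ->
  exists2 y, (a <= y < b)%R & (`|q.[y]| <= r / (b - a))%R.
Proof.
move=> ab qr; apply: contrapT => H.
have ba : (0 < b - a)%R by rewrite subr_gt0.
have Hy y : (a <= y < b)%R -> (r / (b - a) < `|q.[y]|)%R.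
  by move=> yab; rewrite ltNge; apply/negP => le; apply: H; exists y.
have r0 : (0 <= r)%R.
  by rewrite -lee_fin (le_trans _ (ltW qr))// integral_ge0.
move: qr; apply/negP; rewrite -leNgt.
rewrite (@le_trans _ _ (\int[@lebesgue_measure R]_(u in `[a, b[) (cst (r / (b - a))%R%:E) u))//.
  have lab : @lebesgue_measure R `[a, b[%classic = (b - a)%:E.
    by rewrite lebesgue_measure_itv/= lte_fin ab -EFinB.
  by rewrite integral_cst// [X in _ * X]lab -EFinM divfK ?gt_eqF.
apply: ge0_le_integral => //.
- by move=> u _; rewrite lee_fin divr_ge0// ltW.
- apply/measurable_EFinP/measurable_funTS/measurableT_comp => //.
  exact: measurable_horner.
- by move=> u /=; rewrite in_itv/= => /Hy/ltW; rewrite lee_fin.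
Qed.

(** Cut the interval into [m = 2 (d + 1)] equal pieces and pick, in every other one, a point where
    [|q|] is at most its mean. These [d + 1] points are [s / m] apart, so Lagrange interpolation
    bounds [q] on the whole interval. The slack [e] provides the strict inequality that
    [poly_point_le] asks for. *)
Lemma poly_sup_interval d : exists2 C : R, (0 < C)%R &
  forall (q : {poly R}) a s x, (size q <= d.+1)%N -> (0 < s)%R -> (a <= x < a + s)%R ->
  (`|q.[x]| * s)%:E <= C%:E * \int[@lebesgue_measure R]_(u in `[a, (a + s)%R[) `|q.[u]|%:E.
Proof.
pose m : R := (2 * d.+1)%:R.
have m0 : (0 < m)%R by rewrite ltr0n.
exists (d.+1%:R * (m * m ^+ d))%R; first by rewrite !mulr_gt0// exprn_gt0.
move=> q a s x qd s0 axs; set I := \int[_]_(u in _) _.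
have C0 : (0 < d.+1%:R * (m * m ^+ d))%R by rewrite !mulr_gt0// exprn_gt0.
have I0 : 0 <= I by apply: integral_ge0.
have [->|Ifin] := eqVneq I +oo.
  by rewrite gt0_muley ?lte_fin// leey.
have : I \is a fin_num by rewrite ge0_fin_numE// ltey.
move=> /fineK <-; set r := fine I; rewrite -EFinM lee_fin.
have r0 : (0 <= r)%R by exact: fine_ge0.
have sm : (0 < s / m)%R by rewrite divr_gt0.
suff H e : (0 < e)%R -> (`|q.[x]| * s <= d.+1%:R * (m * m ^+ d) * (r + e))%R.
  apply/ler_addgt0Pr => e e0.
  have := H (e / (d.+1%:R * (m * m ^+ d)))%R; rewrite mulrDr [X in (_ + X)%R]mulrC divfK ?gt_eqF//.
  by apply; rewrite divr_gt0.
move=> e0.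
pose lo (i : 'I_d.+1) := (a + s / m * (2 * i)%:R)%R.
have alo i : (a <= lo i)%R by rewrite lerDl mulr_ge0// ltW.
have loa i : (lo i + s / m <= a + s)%R.
  have im : (2 * i + 1 <= 2 * d.+1)%N by have := ltn_ord i; lia.
  rewrite /lo -addrA lerD2l -[leRHS](divfK (lt0r_neq0 m0)).
  rewrite -{2}[(s / m)%R]mulr1 -mulrDr ler_wpM2l ?(ltW sm)//.
  by rewrite -[1%R]/(1%:R) -natrD ler_nat.
have /choice[y yP] (i : 'I_d.+1) : exists y,
    (lo i <= y < lo i + s / m)%R /\ (`|q.[y]| <= (r + e) / (s / m))%R.
  have lt : (lo i < lo i + s / m)%R by rewrite ltrDl.
  have sub : `[lo i, (lo i + s / m)%R[ `<=` `[a, (a + s)%R[.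
    by apply: subset_itv; rewrite bnd_simp.
  have := @poly_point_le q (lo i) (lo i + s / m) (r + e)%R lt.
  have -> : (lo i + s / m - lo i = s / m)%R by move: (lo i) (s / m)%R => u v; ring.
  case.
    rewrite (@le_lt_trans _ _ I)//.
      apply: ge0_subset_integral => //.
      apply/measurable_EFinP/measurable_funTS/measurableT_comp => //.
      exact: measurable_horner.
    by rewrite -[I]fineK// ?lte_fin ?ltrDl// ge0_fin_numE// ltey.
  by move=> y ? ?; exists y.
have gap (i j : 'I_d.+1) : (i < j)%N -> (s / m <= y j - y i)%R.
  move=> ij; have [/andP[_ yi] _] := yP i; have [/andP[yj _] _] := yP j.
  have : (lo i + s / m + s / m <= lo j)%R.
    have ij' : (i%:R + 1 <= j%:R :> R)%R by rewrite natr1 ler_nat.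
    have := mulr_ge0 (ltW sm) (_ : 0 <= j%:R - i%:R - 1 :> R)%R.
    rewrite /lo !natrM => /(_ _); move: (s / m)%R => u h.
    have {}h : (0 <= u * (j%:R - i%:R - 1))%R by apply: h; lra.
    by lra.
  by move: yi yj; move: (lo i) (lo j) (s / m)%R => u v w; lra.
have gap' (i j : 'I_d.+1) : i != j -> (s / m <= `|y i - y j|)%R.
  by rewrite neq_ltn => /orP[]/gap h; [rewrite distrC|];
    rewrite (le_trans h)// ler_norm.
have := lagrange_bound qd sm gap' (fun i => (yP i).2) (s := s).
move=> /(_ x) H; rewrite (le_trans (ler_wpM2r (ltW s0) (H _)))//.
  move=> i; have [/andP[y1 y2] _] := yP i; move: y1 y2 (alo i) (loa i).
  move: (lo i) (s / m)%R => u v; move=> ? ? ? ?; move: axs => /andP[? ?].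
  by rewrite ler_norml; apply/andP; split; lra.
have sE : (s / (s / m) = m)%R by field; rewrite !gt_eqF.
rewrite sE le_eqVlt; apply/orP; left; apply/eqP; field.
by rewrite !gt_eqF.
Qed.

End PolySup.

Section AbsIntegral.
Variables (R : realType) (n : nat).
Local Notation V := (n.-tuple R).
Local Open Scope ereal_scope.

Lemma restrE (B : set V) (h : V -> R) : restr B h = (fun x => \1_B x * h x)%R.
Proof.
apply/funext => x; rewrite /restr indicE; case: asboolP => Bx.
  by rewrite mem_set// mul1r.
by rewrite memNset// mul0r.
Qed.

Lemma measurable_restr (B : set V) (h : V -> R) : measurable B ->
  measurable_fun setT h -> measurable_fun setT (restr B h).
Proof.
by move=> mB mh; rewrite restrE; apply: measurable_funM.
Qed.

Lemma measurable_tnormr (h : V -> R) : measurable_fun setT h ->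
  measurable_fun setT (fun x => `|h x|%R).
Proof. by move=> mh; apply: measurableT_comp. Qed.

Lemma restr_ge0 (B : set V) (h : V -> R) x : (forall x, 0 <= h x)%R -> (0 <= restr B h x)%R.
Proof. by move=> h0; rewrite /restr; case: ifP. Qed.

Lemma aintE (B : set V) (h : V -> R) : measurable B -> measurable_fun setT h ->
  aint B h = \int[tuple_measure R n]_x (restr B (fun y => `|h y|%R) x)%:E.
Proof.
move=> mB mh; rewrite /aint uintE//.
  by apply/measurable_EFinP; apply: measurable_restr => //; exact: measurable_tnormr.
by move=> x; rewrite lee_fin restr_ge0.
Qed.

Lemma aint_ge0 (B : set V) (h : V -> R) : 0 <= aint B h.
Proof. exact: uint_ge0. Qed.

Lemma aint_triangle (A B D : set V) (f g h : V -> R) : D `<=` A -> D `<=` B ->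
  (forall x, `|h x| <= `|f x| + `|g x|)%R -> aint D h <= aint A f + aint B g.
Proof.
move=> DA DB hfg; apply: le_trans (uintD _ _); apply: le_uint => x.
rewrite -EFinD lee_fin /restr; case: asboolP => Dx; last first.
  by rewrite addr_ge0//; case: ifP.
by rewrite !asboolT//; [exact: DB|exact: DA].
Qed.

End AbsIntegral.

Section PolySupCube.
Variable R : realType.
Local Open Scope ereal_scope.

Lemma measurable_pol n d (P : n.-tuple R -> R) : pol d P -> measurable_fun setT P.
Proof. by move=> Pd; apply: tcontinuous_measurable; exact: pol_continuous Pd. Qed.

Lemma integral_tuple_measureS n (h : n.+1.-tuple R -> \bar R) :
  measurable_fun setT h -> (forall x, 0 <= h x) ->
  \int[tuple_measure R n.+1]_x h x =
  \int[@lebesgue_measure R]_u \int[tuple_measure R n]_t h (cons_tuple u t).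
Proof. by move=> mh h0; rewrite -integral_cons_measure. Qed.

Lemma measurable_slice_integral n (h : n.+1.-tuple R -> \bar R) :
  measurable_fun setT h -> (forall x, 0 <= h x) ->
  measurable_fun [set: measurableTypeR R]
    (fun u => \int[tuple_measure R n]_t h (cons_tuple u t)).
Proof.
move=> mh h0.
apply: (@measurable_fun_fubini_tonelli_F _ _ (measurableTypeR R) _ R (tuple_measure R n)
  (fun z : measurableTypeR R * n.-tuple R => h (cons_tuple z.1 z.2))) => //.
by apply: measurableT_comp => //; exact: measurable_tuple_of_pair.
Qed.

(** One coordinate at a time: the one-variable bound on the line through [x] in the first direction,
    then the induction hypothesis on each slice under the integral, then Tonelli. *)
Lemma pol_sup_cube n d : exists2 C : R, (0 < C)%R &
  forall (P : n.-tuple R -> R) a s x, pol d P -> (0 < s)%R -> cube a s x ->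
  (`|P x| * s ^+ n)%:E <= C%:E * aint (cube a s) P.
Proof.
elim: n => [|n [Cn Cn0 ih]].
  exists 1%R => // P a s x; rewrite (tuple0 x) => Pd s0 ax.
  have mP := measurable_pol Pd; have mc := measurable_cube a s.
  rewrite aintE// mul1e mulr1 -leb_intE.
  - by rewrite /= /restr asboolT// => -[].
  - by apply/measurable_EFinP; apply: measurable_restr => //; exact: measurable_tnormr.
  - by move=> y; rewrite lee_fin restr_ge0.
have [C1 C10 H1] := poly_sup_interval R d.
exists (C1 * Cn)%R; first by rewrite mulr_gt0.
move=> P a s x Pd s0 ax.
have mP := measurable_pol Pd; have mc := measurable_cube a s.
pose G y := (restr (cube a s) (fun y => `|P y|%R) y)%:E.
have mG : measurable_fun setT G.
  by apply/measurable_EFinP; apply: measurable_restr => //; exact: measurable_tnormr.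
have G0 y : 0 <= G y by rewrite lee_fin restr_ge0.
rewrite aintE// integral_tuple_measureS//.
move: ax; rewrite {1 2}[x]cons_tuple_eta => /cube_cons[x0 xS].
set x' := [tuple of behead x] in xS *; set a' : n.-tuple R := [tuple of behead a] in xS.
have [q qd qE] := pol_line x' Pd.
rewrite qE exprS mulrA EFinM.
apply: (le_trans (lee_wpmul2r _ (H1 q (thead a) s (thead x) qd s0 x0))).
  by rewrite lee_fin exprn_ge0// ltW.
rewrite EFinM -!muleA lee_wpmul2l ?lee_fin ?(ltW C10)//.
have mqs : measurable_fun setT (fun u : measurableTypeR R => (`|q.[u]|%R)%:E).
  by apply/measurable_EFinP; apply: measurableT_comp => //; exact: measurable_horner.
rewrite muleC -ge0_integralZl//; last 2 first.
- exact: measurable_funTS.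
- by rewrite lee_fin exprn_ge0// ltW.
rewrite integral_mkcond -ge0_integralZl//; last 3 first.
- exact: (measurable_slice_integral mG G0).
- by move=> u _; apply: integral_ge0 => t _; exact: G0.
- by rewrite lee_fin ltW.
apply: ge0_le_integral => //.
- by move=> u _; rewrite patchE; case: ifP => // _; rewrite mule_ge0// lee_fin exprn_ge0// ltW.
- rewrite -measurable_restrictT//; apply: measurable_funTS.
  exact: measurable_funeM.
- by apply: measurable_funeM; exact: (measurable_slice_integral mG G0).
move=> u _; rewrite patchE; case: ifPn => [/set_mem/=|_]; last first.
  by rewrite mule_ge0 ?lee_fin ?(ltW Cn0)//; apply: integral_ge0 => t _; exact: G0.
rewrite in_itv /= => ua.
have Pu := pol_slice u Pd.
have := ih _ a' s x' Pu s0 xS; rewrite qE mulrC EFinM => /le_trans; apply.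
rewrite lee_wpmul2l ?lee_fin ?(ltW Cn0)//.
rewrite aintE; [|exact: measurable_cube|exact: measurable_pol Pu].
have mPu := measurable_pol Pu; have mc' := measurable_cube a' s.
apply: ge0_le_integral => //.
- by move=> t _; rewrite lee_fin restr_ge0.
- by apply/measurable_EFinP; apply: measurable_restr => //; exact: measurable_tnormr.
- by apply: (measurableT_comp mG); exact: measurable_cons.
move=> t _; rewrite /G lee_fin /restr; case: asboolP => at'; last by case: ifP.
by rewrite asboolT//; apply/cube_cons.
Qed.

End PolySupCube.

(** * From polynomial approximation on cubes to a pointwise limit *)

Section GeometricLimit.
Variable R : realType.

(** The radii [e j] satisfy [e j = A q^j + e (j + 1)], so the intervals of radius [e j] around [u j]
    are nested; the supremum of their left ends lies in all of them. *)
Lemma geometric_cauchy (u : nat -> R) (A q : R) : 0 <= A -> 0 <= q -> q < 1 ->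
  (forall j, `|u j.+1 - u j| <= A * q ^+ j) ->
  exists l, forall j, `|l - u j| <= A / (1 - q) * q ^+ j.
Proof.
move=> A0 q0 q1 uA; pose e j := A / (1 - q) * q ^+ j.
have q10 : 0 < 1 - q by rewrite subr_gt0.
have eS j : e j = A * q ^+ j + e j.+1.
  by rewrite /e exprS; field; rewrite gt_eqF.
have e0 j : 0 <= e j by rewrite mulr_ge0 ?exprn_ge0// divr_ge0// ltW.
have lo i j : u i - e i <= u (i + j)%N - e (i + j)%N.
  elim: j => [|j ih]; first by rewrite addn0.
  rewrite addnS (le_trans ih)// eS; have := uA (i + j)%N.
  by rewrite ler_norml => /andP[? ?]; lra.
have hi i j : u (i + j)%N + e (i + j)%N <= u i + e i.
  elim: j => [|j ih]; first by rewrite addn0.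
  rewrite addnS (le_trans _ ih)// [e (i + j)%N]eS; have := uA (i + j)%N.
  by rewrite ler_norml => /andP[? ?]; lra.
have ub i j : u i - e i <= u j + e j.
  rewrite (le_trans (lo i j))// (le_trans _ (hi j i))// addnC.
  by rewrite lerD2l (le_trans _ (e0 _))// oppr_le0.
pose S := [set u i - e i | i in [set: nat]].
have Sub j : ubound S (u j + e j) by move=> _ [i _ <-].
have S0 : S !=set0 by exists (u 0%N - e 0%N); exists 0%N.
exists (sup S) => j; rewrite ler_distl; apply/andP; split.
  by apply: ub_le_sup; [exists (u 0%N + e 0%N)|exists j].
by apply: ge_sup.
Qed.

Lemma dyadic_scale (r0 t : R) : 0 < r0 -> 0 < t -> t <= r0 ->
  exists j, r0 / 2 ^+ j <= t < 2 * (r0 / 2 ^+ j).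
Proof.
move=> r00 t0 tr.
have ex : exists j, r0 / 2 ^+ j <= t.
  have [m hm] := double_archi (divr_gt0 t0 r00); exists m.
  by move: hm; rewrite mulrA ler_pdivlMr// mul1r ler_pdivrMr ?exprn_gt0// [_ * t]mulrC.
case: (ex_minnP ex) => [[|j]] Hj minj; [exists 0%N|exists j.+1]; rewrite Hj /=.
  by move: Hj; rewrite expr0 divr1; lra.
have : ~~ (r0 / 2 ^+ j <= t) by apply/negP => /minj; rewrite ltnn.
rewrite -ltNge => /lt_le_trans; apply; rewrite exprS.
by rewrite le_eqVlt; apply/orP; left; apply/eqP; field; rewrite expf_neq0.
Qed.

Lemma powR_dyadic (r b : R) j : 0 <= r ->
  (r / 2 ^+ j) `^ b = r `^ b * (2 `^ (- b)) ^+ j.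
Proof.
move=> r0; elim: j => [|j ih]; first by rewrite expr0 divr1 mulr1.
rewrite exprSr invfM mulrA powR_half; last by rewrite divr_ge0// exprn_ge0.
by rewrite ih exprS; ring.
Qed.

End GeometricLimit.

Section CampanatoLimit.
Variables (R : realType) (n d : nat) (beta r0 : R).
Hypotheses (b0 : 0 < beta) (r00 : 0 < r0).
Local Notation V := (n.-tuple R).
Implicit Types (x y : V) (r s : R) (g h : V -> R).

Definition ccube x r : set V := cube (x - [tuple r | i < n]) (2 * r).

Lemma ccubeP x r y : ccube x r y <-> forall i, tnth x i - r <= tnth y i < tnth x i + r.
Proof.
by split=> H i; have := H i; rewrite tnthB tnth_mktuple => /andP[? ?];
  apply/andP; split; lra.
Qed.

Lemma ccube_sub x y r s : (forall i, `|tnth y i - tnth x i| <= r - s) ->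
  ccube y s `<=` ccube x r.
Proof.
move=> yx z /ccubeP yz; apply/ccubeP => i.
have := yz i; have := yx i; rewrite ler_norml => /andP[? ?] /andP[? ?].
by apply/andP; split; lra.
Qed.

Lemma ccube_center x r : 0 < r -> ccube x r x.
Proof. by move=> r_gt0; apply/ccubeP => i; apply/andP; split; lra. Qed.

Definition campanato_bound g (N : R) x r (P : V -> R) :=
  pol d P /\ (aint (ccube x r) (fun z => g z - P z)%R <= (N * r ^+ n * r `^ beta)%:E)%E.

(** [P - P'] is a polynomial, small in mean on the smaller cube since [g] is close to both;
    [pol_sup_cube] makes this pointwise. Comparability [r <= 4 s] keeps the volume ratio bounded. *)
Lemma pol_compare : exists2 C : R, 0 < C &
  forall g N x y r s P P' z, 0 <= N -> 0 < s -> s <= r -> r <= 4 * s ->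
  (forall i, `|tnth y i - tnth x i| <= r - s) ->
  campanato_bound g N x r P -> campanato_bound g N y s P' -> ccube y s z ->
  `|P z - P' z| <= C * N * r `^ beta.
Proof.
have [C C0 HC] := pol_sup_cube R n d.
exists (C * 2 * 2 ^+ n); first by rewrite !mulr_gt0// exprn_gt0.
move=> g N x y r s P P' z N0 s0 sr rs yx [Pd gP] [P'd gP'] yz.
have s20 : 0 < 2 * s by rewrite mulr_gt0.
have := HC _ _ _ z (polB Pd P'd) s20 yz.
have tri : (aint (ccube y s) (fun z => P z - P' z)%R <=
   (N * r ^+ n * r `^ beta + N * s ^+ n * s `^ beta)%:E)%E.
  rewrite EFinD; apply: le_trans (leeD gP gP').
  apply: aint_triangle => //; first exact: ccube_sub.
  move=> t; rewrite [X in `|X|](_ : _ = (g t - P' t) - (g t - P t)); last by ring.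
  by rewrite [leRHS]addrC ler_normB.
move=> /le_trans/(_ (lee_wpmul2l _ tri)); rewrite lee_fin (ltW C0) => /(_ isT).
rewrite -EFinM lee_fin => H.
have sn0 : 0 < (2 * s) ^+ n by rewrite exprn_gt0.
rewrite -(ler_pM2r sn0) (le_trans H)//.
have r_ge0 : 0 <= r by rewrite (le_trans (ltW s0)).
have sr_n : s ^+ n <= r ^+ n by rewrite lerXn2r// nnegrE ltW.
have sr_b : s `^ beta <= r `^ beta.
  by apply: ge0_ler_powR => //; rewrite ?nnegrE// ltW.
have rs_n : r ^+ n <= 2 ^+ n * (2 * s) ^+ n.
  by rewrite -exprMn lerXn2r// ?nnegrE//; [rewrite !mulr_ge0// ltW|lra].
have rb0 : 0 <= r `^ beta by exact: powR_ge0.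
have le2 : N * s ^+ n * s `^ beta <= N * r ^+ n * r `^ beta.
  by rewrite ler_pM ?powR_ge0// ?mulr_ge0 ?exprn_ge0// ?(ltW s0)// ler_wpM2l.
apply: (@le_trans _ _ (C * (2 * (N * r ^+ n * r `^ beta)))).
  by rewrite ler_wpM2l ?(ltW C0)//; lra.
apply: (@le_trans _ _ (C * (2 * (N * (2 ^+ n * (2 * s) ^+ n) * r `^ beta)))).
  by rewrite ler_wpM2l ?(ltW C0)// ler_wpM2l// ler_wpM2r// ler_wpM2l.
by rewrite le_eqVlt; apply/orP; left; apply/eqP; ring.
Qed.

Lemma campanato_limit : exists2 C : R, 0 <= C &
  forall g N, 0 <= N ->
  (forall x r, 0 < r -> r <= r0 -> exists P, campanato_bound g N x r P) ->
  exists gt : V -> R, forall x r, 0 < r -> r <= r0 ->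
    exists2 P, campanato_bound g N x r P &
    forall y, (forall i, `|tnth y i - tnth x i| <= r / 2) ->
      `|gt y - P y| <= C * N * r `^ beta.
Proof.
have [C C0 HC] := pol_compare.
set q := (2 : R) `^ (- beta).
have q0 : 0 <= q by exact: powR_ge0.
have q1 : q < 1 by exact: powR2N_lt1.
have q10 : 0 < 1 - q by rewrite subr_gt0.
have Cq0 : 0 <= C / (1 - q) by rewrite divr_ge0 ?ltW.
exists (C + C / (1 - q)); first by rewrite addr_ge0// ltW.
move=> g N N0 gN.
(* One polynomial per cube, chosen once and for all, so that the same family defines [gt] and
   appears in the conclusion. *)
have /choice[P HP] (z : V * R) : exists P, 0 < z.2 -> z.2 <= r0 ->
    campanato_bound g N z.1 z.2 P.
  have [z0|z0] := leP z.2 0; first by exists (fun=> 0).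
  have [zr|zr] := leP z.2 r0; last by exists (fun=> 0).
  by have [P ?] := gN z.1 z.2 z0 zr; exists P.
pose rr j := r0 / 2 ^+ j.
have rr0 j : 0 < rr j by rewrite divr_gt0// exprn_gt0.
have rr_le j : rr j <= r0.
  by rewrite ler_pdivrMr ?exprn_gt0// ler_peMr ?(ltW r00)// exprn_ege1// ler1n.
have rrS j : rr j.+1 = rr j / 2 by rewrite /rr exprSr invfM mulrA.
pose u x j := P (x, rr j) x.
have rrb j : rr j `^ beta = r0 `^ beta * q ^+ j by rewrite powR_dyadic// ltW.
have uS x j : `|u x j.+1 - u x j| <= C * N * r0 `^ beta * q ^+ j.
  rewrite distrC -mulrA -rrb; have rj0 := rr0 j.
  apply: (HC g N x x _ (rr j.+1)) => //.
  - by rewrite rrS; lra.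
  - by rewrite rrS; lra.
  - by move=> i; rewrite subrr normr0 subr_ge0 rrS; lra.
  - exact: (HP (x, rr j) (rr0 j) (rr_le j)).
  - exact: (HP (x, rr j.+1) (rr0 _) (rr_le _)).
  - exact: ccube_center.
have /choice[gt Hgt] x : exists l, forall j, `|l - u x j| <= C / (1 - q) * N * rr j `^ beta.
  have A0 : 0 <= C * N * r0 `^ beta by rewrite !mulr_ge0 ?powR_ge0// ltW.
  have [l Hl] := geometric_cauchy A0 q0 q1 (uS x).
  exists l => j; rewrite (le_trans (Hl j))// rrb.
  by rewrite le_eqVlt; apply/orP; left; apply/eqP; ring.
exists gt => x r r_gt0 rr0_le; exists (P (x, r)); first exact: (HP (x, r)).
move=> y yx.
have r2 : 0 < r / 2 by rewrite divr_gt0.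
(* A dyadic scale with [rr j <= r / 2 < 2 * rr j]: its cube at [y] lies in the cube at [x], and
   [r < 4 * rr j], the ratio allowed by [pol_compare]. *)
have [|j /andP[jr rj]] := dyadic_scale r00 r2; first by lra.
rewrite -/(rr j) in jr rj.
rewrite -(subrKA (u y j)) (le_trans (ler_normD _ _))// addrC 2!mulrDl lerD//.
  rewrite distrC; apply: (HC g N x y r (rr j)) => //; try lra.
  - by move=> i; rewrite (le_trans (yx i))//; lra.
  - exact: (HP (x, r)).
  - exact: (HP (y, rr j) (rr0 j) (rr_le j)).
  - exact: ccube_center.
rewrite (le_trans (Hgt y j))// (ler_wpM2l (mulr_ge0 Cq0 N0))//.
by apply: ge0_ler_powR; rewrite ?nnegrE ?(ltW b0) ?(ltW r_gt0) ?(ltW (rr0 j))//; lra.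
Qed.

End CampanatoLimit.

(** * Almost everywhere identification and the Lipschitz representative *)

Section NullSets.
Variables (R : realType) (n : nat).
Local Notation V := (n.-tuple R).
Local Notation mu := (tuple_measure R n).

Lemma aint_cst (a : V) s v : 0 <= s -> 0 <= v ->
  (aint (cube a s) (fun=> v) = (v * s ^+ n)%:E)%E.
Proof.
move=> s0 v0; have mc := measurable_cube a s.
rewrite aintE// restrE; under eq_integral do rewrite EFinM muleC ger0_norm//.
rewrite ge0_integralZl//.
  rewrite integral_indic// setIT EFinM; congr (_ * _)%E; exact: tuple_measure_cube.
exact/measurable_EFinP/measurable_indic.
Qed.

Lemma aint_split (a : V) s (h : V -> R) :
  (aint (cube a s) h <= \sum_(b : {ffun 'I_n -> bool})
     aint (cube (a + [tuple s / 2 * (b i)%:R | i < n])%R (s / 2)%R) h)%E.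
Proof.
have usum (I : Type) (r : seq I) (F : I -> V -> R) : (forall i x, 0 <= F i x) ->
    (uint (fun x => (\sum_(i <- r) F i x)%:E) <= \sum_(i <- r) uint (fun x => (F i x)%:E))%E.
  move=> F0; elim: r => [|i r ih].
    rewrite big_nil; under [X in uint X]eq_fun do rewrite big_nil.
    by rewrite uintE// integral0.
  rewrite big_cons; under [X in uint X]eq_fun do rewrite big_cons EFinD.
  by apply: le_trans (uintD _ _) _; rewrite leeD2l.
apply: le_trans (usum _ _ _ _); last by move=> b x; apply: restr_ge0.
apply: le_uint => x; rewrite lee_fin {1}/restr; case: asboolP => ax; last first.
  by apply: sumr_ge0 => b _; apply: restr_ge0.
(* Records in which half each coordinate of [x] lies. *)
pose b := [ffun i => tnth a i + s / 2 <= tnth x i].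
rewrite (bigD1 b)//= /restr asboolT; last first.
  move=> i; rewrite tnthD tnth_mktuple ffunE; have /andP[? ?] := ax i.
  by case: (leP (tnth a i + s / 2) (tnth x i)) => ? /=; rewrite ?mulr1 ?mulr0; apply/andP; split; lra.
by rewrite lerDl; apply: sumr_ge0 => b' _; case: ifP.
Qed.

(** Dyadic subdivision in place of Lebesgue differentiation: splitting a cube into [2 ^ n] halves
    preserves the total volume but improves the bound by [2 ^ (- beta)], so the integral of [|h|]
    over any cube is [0]. *)
Lemma negligible_of_aint_small (beta K s0 : R) (h : V -> R) : 0 < beta -> 0 <= K -> 0 < s0 ->
  (forall a s, 0 < s -> s <= s0 -> (aint (cube a s) h <= (K * s ^+ n * s `^ beta)%:E)%E) ->
  mu.-negligible [set x | h x != 0].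
Proof.
move=> b0 K0 s00 hK.
have claim j : forall a s, 0 < s -> s / 2 ^+ j <= s0 ->
    (aint (cube a s) h <= (K * s ^+ n * s `^ beta * (2 `^ (- beta)) ^+ j)%:E)%E.
  elim: j => [|j ih] a s s_gt0 sj.
    by rewrite expr0 mulr1; apply: hK => //; move: sj; rewrite expr0 divr1.
  apply: (le_trans (aint_split a s h)).
  have s2 : 0 < s / 2 by rewrite divr_gt0.
  rewrite (@le_trans _ _ (\sum_(b : {ffun 'I_n -> bool})
    (K * (s / 2) ^+ n * (s / 2) `^ beta * (2 `^ (- beta)) ^+ j)%:E)%E)//.
    apply: lee_sum => b _; apply: ih => //.
    by rewrite (le_trans _ sj)// exprS invfM mulrA.
  rewrite sumEFin lee_fin sumr_const card_ffun card_bool card_ord.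
  rewrite powR_half ?(ltW s_gt0)// -[_ *+ (2 ^ n)%N]mulr_natl natrX exprMn exprVn exprS.
  rewrite le_eqVlt; apply/orP; left; apply/eqP; field.
  by rewrite expf_neq0.
have zero a s : 0 < s -> aint (cube a s) h = 0%E.
  move=> s_gt0.
  have [m hm] : exists m, s / 2 ^+ m <= s0.
    have [m hm] := double_archi (divr_gt0 s00 s_gt0); exists m.
    by move: hm; rewrite mulrA ler_pdivlMr// mul1r ler_pdivrMr ?exprn_gt0// [_ * s0]mulrC.
  have hmj j : s / 2 ^+ (m + j) <= s0.
    rewrite (le_trans _ hm)// ler_pM2l// lef_pV2 ?posrE ?exprn_gt0//.
    by rewrite ler_weXn2l ?ler1n// leq_addr.
  have a0 := aint_ge0 (cube a s) h.
  have fin : aint (cube a s) h \is a fin_num.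
    by rewrite ge0_fin_numE// (le_lt_trans (claim _ _ _ s_gt0 hm))// ltry.
  apply/eqP; rewrite eq_le a0 andbT -(fineK fin) lee_fin.
  apply: (@le_geometric0 _ _ (K * s ^+ n * s `^ beta * (2 `^ (- beta)) ^+ m) (2 `^ (- beta))).
  - exact: powR_ge0.
  - exact: powR2N_lt1.
  - move=> j; rewrite -mulrA -exprD -lee_fin fineK//.
    exact: claim.
pose Q (m : nat) := cube [tuple - m.+1%:R | i < n] (2 * m.+1%:R : R).
have Qneg (m : nat) : mu.-negligible [set x | (0 < (restr (Q m) (fun y => `|h y|) x)%:E)%E].
  by apply: uint0_negligible; apply: zero; rewrite mulr_gt0.
apply: negligibleS (negligible_bigcup Qneg) => x /= hx.
exists (Num.truncn (tnorm x)) => //=; rewrite lte_fin /restr asboolT ?normr_gt0//.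
move=> i; rewrite tnth_mktuple.
have := le_lt_trans (ler_tnth_tnorm x i) (truncnS_gt (tnorm x)).
by rewrite ltr_norml => /andP[? ?]; apply/andP; split; lra.
Qed.

(** If the bound failed at [x] it would fail on a ball, whose measure is positive. *)
Lemma continuous_ae_bound (f g : V -> R) A : tcontinuous f ->
  mu.-negligible [set x | g x != f x] -> mu.-negligible [set x | A < `|g x|] ->
  forall x, `|f x| <= A.
Proof.
move=> cf gf gA x; rewrite leNgt; apply/negP => fA.
have d0 : 0 < `|f x| - A by rewrite subr_gt0.
have [e e0 He] := cf x _ d0.
have : mu.-negligible (ball_of x e).
  apply: negligibleS (negligibleU gf gA) => y /He fyx /=.
  have [->|gy] := eqVneq (g y) (f y); [right|by left].
  by have := lerB_dist (f x) (f y); rewrite distrC => ?; lra.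
move=> /(negligibleP _ (measurable_ball_of x e)) ball0.
have := ball_measure_ge x e0; rewrite ball0 lee_fin leNgt exprn_gt0//.
by rewrite divr_gt0.
Qed.

End NullSets.

Section CampanatoLipschitz.
Variables (R : realType) (n d : nat) (beta r0 : R).
Hypotheses (b0 : 0 < beta) (r00 : 0 < r0).
Local Notation V := (n.-tuple R).

Definition locally_pol (N K : R) (g gt : V -> R) := forall x r, 0 < r -> r <= r0 ->
  exists2 P, campanato_bound d beta g N x r P &
    forall y, (forall i, `|tnth y i - tnth x i| <= r / 2) -> `|gt y - P y| <= K * r `^ beta.

Lemma small_power (K e : R) : 0 <= K -> 0 < e ->
  exists r, [/\ 0 < r, r <= r0 & K * r `^ beta < e].
Proof.
move=> K0 e0; have K1 : 0 < K + 1 by rewrite ltr_wpDl.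
exists (Num.min r0 ((e / (K + 1)) `^ beta^-1)); split.
- by rewrite lt_min r00 powR_gt0// divr_gt0.
- by rewrite ge_min lexx.
apply: (@le_lt_trans _ _ (K * (e / (K + 1)))).
  rewrite ler_wpM2l// -[leRHS]powRr1; last by rewrite divr_ge0// ltW.
  rewrite -(mulVf (lt0r_neq0 b0)) powRrM; apply: ge0_ler_powR.
  - exact: ltW.
  - by rewrite nnegrE le_min (ltW r00) powR_ge0.
  - by rewrite nnegrE powR_ge0.
  - by rewrite ge_min lexx orbT.
by rewrite mulrA ltr_pdivrMr// [ltRHS]mulrC ltr_pM2r// ltrDl.
Qed.

Lemma locally_pol_continuous N K g gt : 0 <= K -> locally_pol N K g gt -> tcontinuous gt.
Proof.
move=> K0 H x e e0; have e30 : 0 < e / 3 by rewrite divr_gt0.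
have [r [r_gt0 rr0 Kr]] := small_power K0 e30.
have [P [Pd _] HP] := H x r r_gt0 rr0.
have [del del0 Hdel] := pol_continuous Pd x e30.
exists (Num.min del (r / 2)); first by rewrite lt_min del0 divr_gt0.
move=> y; rewrite lt_min => /andP[/Hdel yx yr].
have y1 : `|gt y - P y| <= K * r `^ beta.
  apply: HP => i; rewrite -tnthB -tsubE (le_trans (ler_tnth_tnorm _ _))//.
  exact: ltW.
have x1 : `|gt x - P x| <= K * r `^ beta.
  by apply: HP => i; rewrite subrr normr0 divr_ge0// ltW.
rewrite (_ : gt y - gt x = (gt y - P y) + (P y - P x) - (gt x - P x)); last by ring.
rewrite (le_lt_trans (ler_normB _ _))//.
by have := ler_normD (gt y - P y) (P y - P x); lra.
Qed.

(** With [k = d + 1] and [r = 2 k |h|], all points [x + i h], [i <= k], are within [r / 2] of [x],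
    where [gt] is close to a polynomial killed by [D_h^k]. If this [r] exceeds [r0], then [|h|] is
    bounded below and the sup bound [A] is enough. *)
Lemma locally_pol_diff N K A g gt : 0 <= K -> 0 <= A -> locally_pol N K g gt ->
  (forall x, `|gt x| <= A) -> forall h x, h != 0 ->
  `|iter d.+1 (fdiff h) gt x| <= 2 ^+ d.+1 *
     (K * (2 * d.+1%:R) `^ beta + A * (2 * d.+1%:R / r0) `^ beta) * tnorm h `^ beta.
Proof.
move=> K0 A0 H gA h x h0; have t0 := tnorm_gt0 h0.
set k := d.+1; have k0 : 0 < k%:R :> R by rewrite ltr0n.
rewrite mulrDr mulrDl; have [hr|hr] := leP (2 * k%:R * tnorm h) r0.
  have r_gt0 : 0 < 2 * k%:R * tnorm h by rewrite !mulr_gt0.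
  have [P [Pd _] HP] := H x _ r_gt0 hr.
  have -> : iter k (fdiff h) gt x = iter k (fdiff h) (fun y => gt y - P y) x.
    by rewrite iter_fdiffB (pol_iter_fdiff _ _ Pd) subr0.
  rewrite (le_trans (@iter_fdiff_pointwise _ _ _ _ _ (K * (2 * k%:R * tnorm h) `^ beta) _ _))//.
    move=> i ik; apply: HP => l; rewrite tnthD addrAC subrr add0r tnthMn normrMn.
    rewrite -[_ *+ i]mulr_natl (_ : 2 * k%:R * tnorm h / 2 = k%:R * tnorm h); last by field.
    rewrite ler_pM//; last exact: ler_tnth_tnorm.
    by rewrite ler_nat.
  rewrite powRM ?(ltW t0) ?mulr_ge0//.
  rewrite (_ : 2 ^+ k * (K * _) = 2 ^+ k * (K * (2 * k%:R) `^ beta) * tnorm h `^ beta);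
    last by ring.
  by rewrite lerDl !mulr_ge0 ?exprn_ge0 ?powR_ge0.
apply: (@le_trans _ _ (2 ^+ k * A)).
  by apply: iter_fdiff_pointwise => i _; exact: gA.
apply: (@le_trans _ _ (2 ^+ k * (A * (2 * k%:R / r0) `^ beta) * tnorm h `^ beta)); last first.
  by rewrite lerDr !mulr_ge0 ?exprn_ge0 ?powR_ge0.
rewrite -!mulrA ler_wpM2l ?exprn_ge0// ler_peMr//.
rewrite -powRM ?(ltW t0)//; last by rewrite !mulr_ge0// invr_ge0 ltW.
rewrite -{1}(powRr0 ((2 * (k%:R / r0)) * tnorm h)) ler_powR//; last exact: ltW.
by rewrite mulrA -(mulrA _ _ (tnorm h)) [r0^-1 * _]mulrC !mulrA ler_pdivlMr// mul1r -mulrA ltW// mulrA.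
Qed.

Lemma locally_pol_ae N K g gt : 0 <= N -> 0 <= K -> locally_pol N K g gt ->
  (tuple_measure R n).-negligible [set x | g x != gt x].
Proof.
move=> N0 K0 H.
have := @negligible_of_aint_small R n beta (N + K) r0 (fun x => g x - gt x) b0
  (addr_ge0 N0 K0) r00.
move=> small; apply: negligibleS (small _) => [x /=|a s s0 sr0].
  by rewrite subr_eq0.
(* The centre of the cube, so that its points are within [s / 2] of [x], as [locally_pol] asks at
   scale [s]. *)
pose x := a + [tuple s / 2 | i < n].
have [P [Pd gP] HP] := H x s s0 sr0.
have sub : cube a s `<=` ccube x s.
  move=> y ya; apply/ccubeP => i; have /andP[? ?] := ya i.
  by rewrite tnthD tnth_mktuple; apply/andP; split; lra.
rewrite !mulrDl EFinD; apply: (le_trans _ (leeD gP (lexx _))).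
have Ks0 : 0 <= K * s `^ beta by rewrite mulr_ge0// powR_ge0.
rewrite mulrAC -(aint_cst a) ?(ltW s0)//.
apply: le_trans (uintD _ _); apply: le_uint => y.
rewrite -EFinD lee_fin /restr; case: asboolP => ya; last first.
  by rewrite addr_ge0//; case: ifP.
rewrite asboolT; last exact: sub.
rewrite [`|K * _|]ger0_norm// (_ : g y - gt y = (g y - P y) - (gt y - P y)); last by ring.
rewrite (le_trans (ler_normB _ _))// lerD2l; apply: HP => i.
by rewrite tnthD tnth_mktuple ler_norml; have /andP[? ?] := ya i; apply/andP; split; lra.
Qed.

Lemma campanato_lipschitz : exists2 C : R, 0 <= C &
  forall (g : V -> R) N A, 0 <= N -> 0 <= A ->
  (forall x r, 0 < r -> r <= r0 -> exists P, campanato_bound d beta g N x r P) ->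
  (tuple_measure R n).-negligible [set x | A < `|g x|] ->
  exists gt : V -> R, [/\ tcontinuous gt,
    (tuple_measure R n).-negligible [set x | g x != gt x],
    (forall x, `|gt x| <= A) &
    forall h x, h != 0 -> `|iter d.+1 (fdiff h) gt x| <= C * (A + N) * tnorm h `^ beta].
Proof.
have [C C0 HC] := @campanato_limit R n d beta r0 b0 r00.
exists (2 ^+ d.+1 * (C * (2 * d.+1%:R) `^ beta + (2 * d.+1%:R / r0) `^ beta)).
  by rewrite mulr_ge0 ?exprn_ge0// addr_ge0 ?mulr_ge0 ?powR_ge0.
move=> g N A N0 A0 gN gA; have [gt Hgt] := HC g N N0 gN.
have CN0 : 0 <= C * N by rewrite mulr_ge0.
have L : locally_pol N (C * N) g gt by [].
have cgt := locally_pol_continuous CN0 L.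
have ae := locally_pol_ae N0 CN0 L.
have bd := continuous_ae_bound cgt ae gA.
exists gt; split => // h x h0.
rewrite (le_trans (locally_pol_diff CN0 A0 L bd x h0))// ler_wpM2r ?powR_ge0//.
rewrite -[leRHS]mulrA ler_wpM2l ?exprn_ge0//.
have a0 : 0 <= (2 * d.+1%:R : R) `^ beta by exact: powR_ge0.
have c0 : 0 <= (2 * d.+1%:R / r0) `^ beta by exact: powR_ge0.
have := mulr_ge0 (mulr_ge0 C0 a0) A0; have := mulr_ge0 c0 N0.
by move: (_ `^ beta) (_ `^ beta) => a c; lra.
Qed.

End CampanatoLipschitz.

(** * Projection onto polynomials and mean oscillation *)

Section L2Projection.
Context d (T : measurableType d) (R : realType) (mu : {measure set T -> \bar R}).
Variable B : set T.
Hypotheses (mB : measurable B) (Bfin : (mu B < +oo)%E).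
Implicit Types u v w : T -> R.

Definition bmeas u := measurable_fun setT u /\ exists K, forall x, B x -> `|u x| <= K.

Lemma bmeas_integrable u : bmeas u -> mu.-integrable B (EFin \o u).
Proof.
move=> [mu_ [K uK]]; apply: measurable_bounded_integrable => //.
  exact: measurable_funTS.
exists K; split; first exact: num_real.
by move=> M KM x Bx /=; exact: le_trans (uK x Bx) (ltW KM).
Qed.

Lemma bmeas_cst a : bmeas (fun=> a).
Proof. by split=> //; exists `|a|. Qed.

Lemma bmeasD u v : bmeas u -> bmeas v -> bmeas (fun x => u x + v x).
Proof.
move=> [mu_ [K uK]] [mv [L vL]]; split; first exact: measurable_funD.
by exists (K + L) => x Bx; rewrite (le_trans (ler_normD _ _))// lerD ?uK ?vL.
Qed.

Lemma bmeasM u v : bmeas u -> bmeas v -> bmeas (fun x => u x * v x).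
Proof.
move=> [mu_ [K uK]] [mv [L vL]]; split; first exact: measurable_funM.
by exists (K * L) => x Bx; rewrite normrM ler_pM ?uK ?vL.
Qed.

Lemma bmeasZ a u : bmeas u -> bmeas (fun x => a * u x).
Proof. by move=> bu; apply: bmeasM => //; exact: bmeas_cst. Qed.

Lemma bmeasB u v : bmeas u -> bmeas v -> bmeas (fun x => u x - v x).
Proof.
move=> bu bv; have := bmeasD bu (bmeasZ (-1) bv).
by under [in X in X -> _]eq_fun do rewrite mulN1r.
Qed.

Local Notation J u := (Rintegral mu B u).

Lemma JD u v : bmeas u -> bmeas v -> J (fun x => u x + v x) = J u + J v.
Proof. by move=> bu bv; apply: RintegralD => //; exact: bmeas_integrable. Qed.

Lemma JZ a u : bmeas u -> J (fun x => a * u x) = a * J u.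
Proof. by move=> bu; apply: RintegralZl => //; exact: bmeas_integrable. Qed.

Lemma JB u v : bmeas u -> bmeas v -> J (fun x => u x - v x) = J u - J v.
Proof. by move=> bu bv; apply: RintegralB => //; exact: bmeas_integrable. Qed.

Lemma J_sqr_ge0 u : 0 <= J (fun x => u x * u x).
Proof. by apply: Rintegral_ge0 => x _; rewrite -expr2 sqr_ge0. Qed.

Lemma J_orthogonal_null u v : bmeas u -> bmeas v ->
  J (fun x => v x * v x) = 0 -> J (fun x => u x * v x) = 0.
Proof.
move=> bu bv vv0; apply/eqP; apply: contraT => uv0.
(* With this [t] the square of [u - t v] would integrate to [-1]. *)
pose t := (J (fun x => u x * u x) + 1) / (2 * J (fun x => u x * v x)).
have := J_sqr_ge0 (fun x => u x - t * v x).
have -> : (fun x => (u x - t * v x) * (u x - t * v x)) =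
  (fun x => (u x * u x - (2 * t) * (u x * v x)) + t ^+ 2 * (v x * v x)).
  by apply/funext => x; ring.
have buu := bmeasM bu bu; have buv := bmeasM bu bv; have bvv := bmeasM bv bv.
rewrite JD; [|exact: bmeasB (bmeasZ _ buv)|exact: bmeasZ].
rewrite JB//; last exact: bmeasZ.
rewrite !JZ// vv0 mulr0 addr0 /t.
rewrite (_ : 2 * (_ / _) * _ = J (fun x => u x * u x) + 1); last by field.
by lra.
Qed.

Fixpoint lspan (es : seq (T -> R)) : set (T -> R) :=
  if es is e :: es' then [set v | exists a v', lspan es' v' /\ v = (fun x => a * e x + v' x)]
  else [set fun=> 0].

Lemma lspan_bmeas es : (forall i, (i < size es)%N -> bmeas (nth (fun=> 0) es i)) ->
  forall v, lspan es v -> bmeas v.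
Proof.
elim: es => [|e es ih] bes v /=; first by move=> ->; exact: bmeas_cst.
move=> [a [v' [v's ->]]]; apply: bmeasD; first by apply: bmeasZ; exact: (bes 0%N).
by apply: ih => // i ies; exact: (bes i.+1).
Qed.

Lemma lspanD_scale es c u v : lspan es u -> lspan es v -> lspan es (fun x => u x + c * v x).
Proof.
elim: es u v => [|e es ih] u v /=.
  by move=> -> ->; apply/funext => x; rewrite mulr0 addr0.
move=> [a [u' [us ->]]] [b [v' [vs ->]]].
exists (a + c * b), (fun x => u' x + c * v' x); split; first exact: ih.
by apply/funext => x; ring.
Qed.

(** Gram-Schmidt by induction: [f] is the part of [e] orthogonal to the span of the rest, and the
    projection of [u] gains the component [c * f]. *)
Lemma l2_projection es : (forall i, (i < size es)%N -> bmeas (nth (fun=> 0) es i)) ->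
  forall u, bmeas u -> exists2 P, lspan es P &
    forall v, lspan es v -> J (fun x => (u x - P x) * v x) = 0.
Proof.
elim: es => [|e es ih] bes u bu.
  exists (fun=> 0) => // v ->; rewrite (_ : (fun _ => _) = fun=> 0).
    by rewrite Rintegral_cst// mul0r.
  by apply/funext => x; rewrite mulr0.
have be : bmeas e by exact: (bes 0%N).
have bes' i : (i < size es)%N -> bmeas (nth (fun=> 0) es i) by move=> ies; exact: (bes i.+1).
have [P1 sP1 oP1] := ih bes' u bu.
have [e1 se1 oe1] := ih bes' e be.
have bP1 := lspan_bmeas bes' sP1; have be1 := lspan_bmeas bes' se1.
pose f x := e x - e1 x; have bf : bmeas f by exact: bmeasB.
pose w x := u x - P1 x; have bw : bmeas w by exact: bmeasB.
pose c := J (fun x => w x * f x) / J (fun x => f x * f x).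
(* If [f] has norm zero, as for a dependent family, division by zero gives [c = 0], and the left
   side vanishes by [J_orthogonal_null]. *)
have cE : J (fun x => w x * f x) = c * J (fun x => f x * f x).
  have [ff0|ff0] := eqVneq (J (fun x => f x * f x)) 0.
    by rewrite ff0 mulr0; exact: J_orthogonal_null.
  by rewrite /c divfK.
exists (fun x => P1 x + c * f x).
  exists c, (fun x => P1 x + (- c) * e1 x); split; first exact: (lspanD_scale (- c) sP1 se1).
  by apply/funext => x; rewrite /f; ring.
have orth v : lspan es v -> J (fun x => (u x - (P1 x + c * f x)) * v x) = 0.
  move=> sv; have bv := lspan_bmeas bes' sv.
  rewrite (_ : (fun x => _) = (fun x => w x * v x - c * (f x * v x))); last first.
    by apply/funext => x; rewrite /w; ring.
  rewrite JB; [|exact: bmeasM|exact: bmeasZ (bmeasM _ _)].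
  by rewrite JZ; [rewrite oP1// oe1// mulr0 subr0|exact: bmeasM].
move=> _ [a [v [sv ->]]]; have bv := lspan_bmeas bes' sv.
pose z x := u x - (P1 x + c * f x).
have bz : bmeas z by apply: bmeasB => //; apply: bmeasD => //; exact: bmeasZ.
rewrite (_ : (fun x => _) = (fun x => a * (z x * f x) + z x * (v x + a * e1 x))); last first.
  by apply/funext => x; rewrite /z /f; ring.
have bve : bmeas (fun x => v x + a * e1 x) by apply: bmeasD => //; exact: bmeasZ.
rewrite JD; [|exact: bmeasZ (bmeasM _ _)|exact: bmeasM].
rewrite JZ; last exact: bmeasM.
rewrite (orth _ (lspanD_scale a sv se1)) addr0.
rewrite (_ : (fun x => z x * f x) = (fun x => w x * f x - c * (f x * f x))); last first.
  by apply/funext => x; rewrite /z /w; ring.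
rewrite JB; [|exact: bmeasM|exact: bmeasZ (bmeasM _ _)].
by rewrite JZ; [rewrite cE subrr mulr0|exact: bmeasM].
Qed.

(* [|w| <= (w^2 / E + E) / 2] turns the L2-minimality of the projection into an
   L1 bound without square roots. *)
Lemma l1_of_l2 w w0 E : bmeas w -> bmeas w0 -> 0 < E -> (forall x, B x -> `|w0 x| <= E) ->
  J (fun x => w x * (w0 x - w x)) = 0 -> J (fun x => `|w x|) <= E * fine (mu B).
Proof.
move=> bw bw0 E0 w0E orth.
have bww := bmeasM bw bw.
have ww0 : J (fun x => w x * w x) <= E ^+ 2 * fine (mu B).
  rewrite -Rintegral_cst//.
  have bd : bmeas (fun x => w0 x - w x) by exact: bmeasB.
  have w0w0 : J (fun x => w0 x * w0 x) = J (fun x => w x * w x) +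
      J (fun x => (w0 x - w x) * (w0 x - w x)).
    rewrite (_ : (fun x => w0 x * w0 x) = (fun x => (w x * w x + 2 * (w x * (w0 x - w x)))
       + (w0 x - w x) * (w0 x - w x))); last by apply/funext => x; ring.
    rewrite JD; [|apply: bmeasD => //; apply: bmeasZ; exact: bmeasM|exact: bmeasM].
    rewrite JD//; last by apply: bmeasZ; exact: bmeasM.
    by rewrite JZ ?orth ?mulr0 ?addr0//; exact: bmeasM.
  apply: (@le_trans _ _ (J (fun x => w0 x * w0 x))).
    by rewrite w0w0 lerDl J_sqr_ge0.
  apply: le_Rintegral => //; first exact: bmeas_integrable (bmeasM bw0 bw0).
    exact: bmeas_integrable (bmeas_cst _).
  move=> x Bx; rewrite -expr2 -real_normK ?num_real// lerXn2r ?nnegrE ?w0E//.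
  exact: ltW.
have bwE : bmeas (fun x => E^-1 / 2 * (w x * w x) + E / 2).
  by apply: bmeasD; [exact: bmeasZ|exact: bmeas_cst].
apply: (@le_trans _ _ (J (fun x => E^-1 / 2 * (w x * w x) + E / 2))).
  apply: le_Rintegral => //.
  - apply: bmeas_integrable; have [mw [K wK]] := bw; split; first exact: measurableT_comp.
    by exists K => x Bx; rewrite normr_id wK.
  - exact: bmeas_integrable.
  move=> x _; have -> : w x * w x = `|w x| ^+ 2 by rewrite real_normK ?num_real.
  move: (`|w x|) => a.
  rewrite [leRHS](_ : _ = (a ^+ 2 + E ^+ 2) / (2 * E)); last by field; rewrite gt_eqF.
  rewrite ler_pdivlMr ?mulr_gt0//.
  by have := sqr_ge0 (a - E); rewrite sqrrB; lra.
rewrite JD; [|exact: bmeasZ|exact: bmeas_cst].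
rewrite JZ// Rintegral_cst//.
have Ei : 0 <= E^-1 / 2 by rewrite divr_ge0// invr_ge0 ltW.
rewrite (le_trans (lerD (ler_wpM2l Ei ww0) (lexx _)))//.
by rewrite le_eqVlt; apply/orP; left; apply/eqP; field; rewrite gt_eqF.
Qed.

End L2Projection.

Section Oscillation.
Variables (R : realType) (n d : nat).
Local Notation V := (n.-tuple R).
Local Notation mu := (tuple_measure R n).
Variable B : set V.
Hypotheses (mB : measurable B) (Bfin : (mu B < +oo)%E).
Hypothesis Bbd : exists K : R, forall x, B x -> forall i, `|tnth x i| <= K.

Lemma pol_bmeas e P : pol e P -> bmeas B P.
Proof.
elim=> {e P}.
- by move=> e a; exact: bmeas_cst.
- by move=> e P Q _ bP _ bQ; exact: bmeasD.
- move=> e i P _ bP; apply: bmeasM => //; split; first exact: (@measurable_tnth _ R).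
  by have [K BK] := Bbd; exists K => x Bx; exact: BK.
Qed.

Lemma sintE (h ht : V -> R) : bmeas B ht -> mu.-negligible [set x | h x != ht x] ->
  sint B h = (Rintegral mu B ht)%:E.
Proof.
move=> bh hht; have [mh _] := bh.
have mr := measurable_restr mB mh.
have ih := bmeas_integrable mB Bfin bh.
rewrite /Rintegral fineK; last exact: integrable_fin_num ih.
rewrite integral_mkcond (_ : _ \_ B = fun x => (restr B ht x)%:E); last first.
  apply/funext => x; rewrite patchE /restr; case: ifPn => [/set_mem Bx|Bx].
    by rewrite asboolT.
  by rewrite asboolF// => /mem_set; exact/negP.
rewrite integralE /sint; congr (_ - _)%E.
- rewrite (@uint_ae _ _ _ (fun x => (Num.max (restr B ht x) 0)%:E) _ hht).
    rewrite uintE.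
    + by apply: eq_integral => x _; rewrite funepos.unlock -EFin_max.
    + by apply/measurable_EFinP; exact: measurable_maxr.
    + by move=> x; rewrite lee_fin le_max lexx orbT.
  by move=> x /= /negP; rewrite negbK /restr => /eqP ->.
- rewrite (@uint_ae _ _ _ (fun x => (Num.max (- restr B ht x) 0)%:E) _ hht).
    rewrite uintE.
    + by apply: eq_integral => x _; rewrite funeneg.unlock -EFinN -EFin_max.
    + by apply/measurable_EFinP; apply: measurable_maxr => //; exact: measurable_funN.
    + by move=> x; rewrite lee_fin le_max lexx orbT.
  by move=> x /= /negP; rewrite negbK /restr => /eqP ->.
Qed.

Lemma lspan_map_sum (I : Type) (f : I -> V -> R) (c : I -> R) (r : seq I) :
  lspan (map f r) (fun x => \sum_(a <- r) c a * f a x).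
Proof.
elim: r => [|a r ih] /=; first by apply/funext => x; rewrite big_nil.
exists (c a), (fun x => \sum_(b <- r) c b * f b x); split => //.
by apply/funext => x; rewrite big_cons.
Qed.

Lemma lspan_map_pol (I : Type) (f : I -> V -> R) (A : pred I) (r : seq I) v :
  (forall a, A a -> pol d (f a)) -> all A r -> lspan (map f r) v -> pol d v.
Proof.
move=> Af; elim: r v => [|a r ih] v /=; first by move=> _ ->; exact: pol_cst.
move=> /andP[Aa Ar] [c [v' [v's ->]]].
by apply: polD; [apply: polZ; exact: Af|exact: ih].
Qed.

(** For the L2 projection [P] of [gt], [gt - P] is orthogonal to the polynomial [P - P0]; [l1_of_l2]
    then bounds the mean error of [P] by the sup error of [P0]. Replacing [g] by [gt] changes
    neither the projection property nor the integral. *)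
Lemma osc_le (g gt : V -> R) P0 E : bmeas B gt ->
  mu.-negligible [set x | g x != gt x] -> pol d P0 -> 0 < E ->
  (forall x, B x -> `|gt x - P0 x| <= E) -> (osc d B g <= (E * fine (mu B))%:E)%E.
Proof.
move=> bgt ggt P0d E0 gP0.
pose A (a : {ffun 'I_n -> 'I_d.+1}) := (\sum_(i < n) (a i : nat) <= d)%N.
pose f (a : {ffun 'I_n -> 'I_d.+1}) (x : V) := \prod_(i < n) tnth x i ^+ a i.
pose r := [seq a <- index_enum {ffun 'I_n -> 'I_d.+1} | A a].
have fpol a : A a -> pol d (f a) by exact: pol_monomial.
have rA : all A r by exact: filter_all.
have bes i : (i < size (map f r))%N -> bmeas B (nth (fun=> 0) (map f r) i).
  elim: (r) rA i => [//|a r' ih] /= /andP[Aa Ar'] [_|i ir].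
    exact: pol_bmeas (fpol _ Aa).
  exact: ih.
have spanP Q : lspan (map f r) Q <-> pol d Q.
  split; first exact: lspan_map_pol fpol rA.
  move=> /poly_leP[c cQ]; have := lspan_map_sum f c r; congr lspan.
  by apply/funext => x; rewrite cQ /r big_filter.
have [P sP oP] := l2_projection mB Bfin bes bgt.
have Pd : pol d P by apply/spanP.
have bP := pol_bmeas Pd; have bP0 := pol_bmeas P0d.
have bgP : bmeas B (fun x => gt x - P x) by exact: bmeasB.
have bgP0 : bmeas B (fun x => gt x - P0 x) by exact: bmeasB.
apply: (@le_trans _ _ (aint B (fun x => g x - P x))).
  apply: ereal_inf_lbound; exists P => //; split; first exact/poly_leP.
  move=> Q /poly_leP Qd; rewrite (@sintE _ (fun x => (gt x - P x) * Q x)).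
  - by rewrite oP//; apply/spanP.
  - by apply: bmeasM => //; exact: pol_bmeas Qd.
  - by apply: negligibleS ggt => x /=; apply: contraNN => /eqP ->.
have -> : aint B (fun x => g x - P x) = aint B (fun x => gt x - P x).
  apply: (uint_ae ggt) => x /= /negP; rewrite negbK => /eqP gx.
  by rewrite /restr gx.
have [mgP _] := bgP.
have babs : bmeas B (fun x => `|gt x - P x|).
  have [mw [K wK]] := bgP; split; first exact: measurable_tnormr.
  by exists K => x Bx; rewrite normr_id wK.
rewrite aintE//.
have -> : (\int[mu]_x (restr B (fun y => `|gt y - P y|) x)%:E =
   (Rintegral mu B (fun x => `|gt x - P x|))%:E)%E.
  rewrite /Rintegral fineK; last exact: integrable_fin_num (bmeas_integrable mB Bfin babs).
  rewrite [RHS]integral_mkcond; apply: eq_integral => x _.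
  rewrite patchE /restr; have [Bx|nBx] := pselect (B x).
    by rewrite asboolT// mem_set.
  by rewrite asboolF// memNset.
rewrite lee_fin; apply: (l1_of_l2 mB Bfin bgP bgP0) => //.
rewrite (_ : (fun x => _) = (fun x => (gt x - P x) * (P x - P0 x))); last first.
  by apply/funext => x; ring.
by apply: oP; apply/spanP; exact: polB.
Qed.

End Oscillation.

Section BallOscillation.
Variables (R : realType) (n d : nat).
Local Notation V := (n.-tuple R).

Lemma ball_coord_bound (c : V) r :
  exists K : R, forall x, ball_of c r x -> forall i, `|tnth x i| <= K.
Proof.
exists (\sum_i `|tnth c i| + r) => x; rewrite /ball_of /= tsubE => xr i.
have := le_lt_trans (ler_tnth_tnorm (x - c) i) xr; rewrite tnthB => ?.
have : `|tnth c i| <= \sum_i `|tnth c i| by rewrite (bigD1 i)//= lerDl sumr_ge0.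
by have := lerB_dist (tnth x i) (tnth c i); lra.
Qed.

Lemma ball_measure_fin (c : V) r : 0 < r -> (tuple_measure R n (ball_of c r) < +oo)%E.
Proof. by move=> r0; rewrite (le_lt_trans (ball_measure_le c (ltW r0)))// ltry. Qed.

End BallOscillation.

(** * Luxemburg norm of an indicator *)

Section OrliczIndicator.
Variables (R : realType) (n : nat) (p : R).
Hypothesis p0 : 0 < p.
Local Notation V := (n.-tuple R).
Variables (B : set V) (m : R).
Hypotheses (mB : measurable B) (Bm : tuple_measure R n B = m%:E) (m0 : 0 < m).

(** Clear denominators and use [l * (1 / l) ^ (1 - p) = l ^ p]. *)
Lemma Phi_inv_le l : 0 < l -> (Phi p l^-1 * m <= 1) = (m <= l + l `^ p).
Proof.
move=> l0; have q0 : 0 < 1 + l^-1 `^ (1 - p) by rewrite ltr_wpDr// powR_ge0.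
rewrite /Phi mulrAC ler_pdivrMr// mul1r ler_pdivrMl// mulrDr mulr1.
have -> : l * l^-1 `^ (1 - p) = l `^ p.
  rewrite -powR_inv1 ?(ltW l0)// -powRrM -{1}[l]powRr1 ?(ltW l0)// -powRD.
    by congr powR; ring.
  by rewrite (gt_eqF l0) implybT.
by [].
Qed.

Lemma uint_Phi_ind l : 0 < l ->
  uint (fun x => (Phi p (`|ind B x| / l))%:E) = (Phi p l^-1 * m)%:E.
Proof.
move=> l0.
have E : (fun x => (Phi p (`|ind B x| / l))%:E) = (fun x => (Phi p l^-1)%:E * (\1_B x)%:E)%E.
  apply/funext => x; rewrite /ind indicE -EFinM; congr (_%:E).
  case: (x \in B); first by rewrite normr1 mul1r mulr1.
  by rewrite normr0 mul0r mulr0 /Phi mul0r.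
have Phi0 : 0 <= Phi p l^-1.
  by rewrite divr_ge0 ?invr_ge0 ?(ltW l0)// addr_ge0// powR_ge0.
have mI : measurable_fun setT (fun x => (\1_B x : R)%:E).
  exact/measurable_EFinP/measurable_indic.
rewrite E uintE.
- rewrite ge0_integralZl//.
  by rewrite integral_indic// setIT [X in (_ * X)%E]Bm -EFinM.
- exact: measurable_funeM.
- by move=> x; rewrite mule_ge0// lee_fin.
Qed.

(** [l = m ^ (1 / p)] is admissible since [l ^ p = m]. Conversely [m <= l + l ^ p] forces
    [m / 2 <= l] or [m / 2 <= l ^ p], which gives the minimum. *)
Lemma orlicz_ind : exists psi, [/\ orlicz_norm p (ind B) = psi%:E, psi <= m `^ p^-1,
  0 < psi & Num.min (m / 2) ((m / 2) `^ p^-1) <= psi].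
Proof.
pose lo := Num.min (m / 2) ((m / 2) `^ p^-1).
have m20 : 0 < m / 2 by rewrite divr_gt0.
have lo0 : 0 < lo by rewrite lt_min m20 powR_gt0.
have up : (orlicz_norm p (ind B) <= (m `^ p^-1)%:E)%E.
  apply: ereal_inf_lbound; exists (m `^ p^-1) => //=; split; first exact: powR_gt0.
  rewrite uint_Phi_ind ?powR_gt0// lee_fin Phi_inv_le ?powR_gt0//.
  by rewrite -powRrM mulVf ?gt_eqF// powRr1 ?(ltW m0)// lerDr powR_ge0.
have low : (lo%:E <= orlicz_norm p (ind B))%E.
  apply: le_ereal_inf_tmp => _ [l [l0 lB] <-]; move: lB.
  rewrite uint_Phi_ind// !lee_fin Phi_inv_le// /lo ge_min => ml.
  have [//|lm /=] := leP (m / 2) l.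
  have : m / 2 <= l `^ p by lra.
  move=> /(ge0_ler_powR (_ : 0 <= p^-1)); rewrite invr_ge0 (ltW p0) => /(_ isT).
  rewrite !nnegrE (ltW m20) powR_ge0 => /(_ isT isT).
  by rewrite -powRrM mulfV ?gt_eqF// powRr1// ltW.
have fin : orlicz_norm p (ind B) \is a fin_num.
  by rewrite fin_numE gt_eqF ?(lt_le_trans _ low) ?ltNyr// lt_eqF// (le_lt_trans up)// ltry.
exists (fine (orlicz_norm p (ind B))); split.
- by rewrite fineK.
- by rewrite -lee_fin fineK.
- by rewrite (lt_le_trans lo0)// -lee_fin fineK.
- by rewrite -lee_fin fineK.
Qed.

End OrliczIndicator.

(** * The embeddings between bounded Campanato functions and Lipschitz functions *)

Section CampToBound.
Variables (R : realType) (n : nat) (p : R).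
Hypotheses (n0 : (0 < n)%N) (p0 : 0 < p) (p1 : p < 1).
Local Notation V := (n.-tuple R).
Local Notation mu := (tuple_measure R n).
Local Notation beta := (n%:R * (p^-1 - 1)).
Local Notation d := (Num.truncn (n%:R * (p^-1 - 1))).

Lemma beta_gt0 : 0 < beta :> R.
Proof. by rewrite mulr_gt0 ?ltr0n// subr_gt0 invf_gt1. Qed.

Lemma ball_measureP (c : V) r : 0 < r -> exists m, [/\ mu (ball_of c r) = m%:E, 0 < m,
  (r / n.+1%:R) ^+ n <= m & m <= (2 * r) ^+ n].
Proof.
move=> r0; have fin : mu (ball_of c r) \is a fin_num.
  by rewrite ge0_fin_numE ?measure_ge0// ball_measure_fin.
have lo := ball_measure_ge c r0; have hi := ball_measure_le c (ltW r0).
rewrite -(fineK fin) !lee_fin in lo hi; exists (fine (mu (ball_of c r))); split => //.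
  by rewrite fineK.
by rewrite (lt_le_trans _ lo)// exprn_gt0// divr_gt0.
Qed.

Lemma ball_orlicz (c : V) r : 0 < r -> exists m psi, [/\ lmeas (ball_of c r) = m%:E, 0 < m,
  fine (orlicz_norm p (ind (ball_of c r))) = psi & 0 < psi] /\
  [/\ (r / n.+1%:R) ^+ n <= m, m <= (2 * r) ^+ n, psi <= m `^ p^-1 &
      Num.min (m / 2) ((m / 2) `^ p^-1) <= psi].
Proof.
move=> r0; have [m [Bm m0 lo hi]] := ball_measureP c r0.
have mb := measurable_ball_of c r.
have [psi [psiE psi_hi psi0 psi_lo]] := orlicz_ind p0 mb Bm m0.
exists m, psi; split; split => //; first by rewrite lmeasE.
by rewrite psiE.
Qed.

(** Makes the second supremum in [camp_norm] one over a nonempty set, hence nonnegative, so that the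
    first is bounded by the sum. *)
Lemma large_ball : exists (c : V) r, 0 < r /\ (1 <= lmeas (ball_of c r))%E.
Proof.
exists 0, n.+1%:R; split; first by rewrite ltr0n.
have [m [psi [[-> _ _ _] [lo _ _ _]]]] := ball_orlicz (0 : V) (ltr0Sn R n).
by rewrite lee_fin (le_trans _ lo)// divff// expr1n.
Qed.

Lemma osc_ge0 e (B : set V) (g : V -> R) : (0 <= osc e B g)%E.
Proof. by apply: le_ereal_inf_tmp => _ [P _ <-]; exact: aint_ge0. Qed.

Lemma camp_osc_le (g : V -> R) c r : 0 < r -> (lmeas (ball_of c r) < 1)%E ->
  (osc d (ball_of c r) g * ((fine (orlicz_norm p (ind (ball_of c r))))^-1)%:E
   <= camp_norm p g)%E.
Proof.
move=> r0 c1; rewrite /camp_norm.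
apply: le_trans (leeDl _ _); first by apply: ereal_sup_ubound; exists c, r.
have [c' [r' [r'0 c'1]]] := large_ball.
have [m [psi [[_ _ psiE psi0] _]]] := ball_orlicz c' r'0.
apply: le_trans (ereal_sup_ubound _); last first.
  by exists c', r'; split => //; reflexivity.
by rewrite mule_ge0 ?aint_ge0// lee_fin psiE invr_ge0 ltW.
Qed.

Lemma camp_norm_ge0 (g : V -> R) : (0 <= camp_norm p g)%E.
Proof.
have r0 : 0 < 4^-1 :> R by [].
have [m [psi [[mE m0 psiE psi0] [_ hi _ _]]]] := ball_orlicz (0 : V) r0.
apply: le_trans (camp_osc_le g r0 (c := 0) _).
  by rewrite mule_ge0 ?osc_ge0// lee_fin psiE invr_ge0 ltW.
rewrite mE lte_fin (le_lt_trans hi)// exprn_ilt1 -?lt0n//.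
by lra.
Qed.

End CampToBound.

Section Embeddings.
Variables (R : realType) (n : nat) (p : R).
Hypotheses (n0 : (0 < n)%N) (p0 : 0 < p) (p1 : p < 1).
Local Notation V := (n.-tuple R).
Local Notation mu := (tuple_measure R n).
Local Notation beta := (n%:R * (p^-1 - 1)).
Local Notation d := (Num.truncn (n%:R * (p^-1 - 1))).

Let b0 : 0 < beta. Proof. exact: beta_gt0. Qed.

(** [n / p = n + beta]: dividing by the Luxemburg norm of a small ball is averaging and then
    dividing by [r ^ beta]. *)
Lemma powR_inv_p (r : R) : 0 < r -> (r ^+ n) `^ p^-1 = r ^+ n * r `^ beta.
Proof.
move=> r0; rewrite -powR_mulrn ?(ltW r0)// -powRrM -powRD.
  by congr powR; ring.
by rewrite (gt_eqF r0) implybT.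
Qed.

Lemma camp_to_bound : exists2 C : R, 0 < C & exists2 r0 : R, 0 < r0 &
  forall (g : V -> R) (N : R), (camp_norm p g < N%:E)%E ->
  forall x r, 0 < r -> r <= r0 -> exists P, campanato_bound d beta g (C * N) x r P.
Proof.
(* The ball of radius [k * r] contains the cube of side [2 * r], and [r <= 1 / (4 * k)] keeps its
   measure below [1]. *)
pose k : R := 2 * n.+1%:R; have k0 : 0 < k by rewrite mulr_gt0.
exists (((2 * k) ^+ n) `^ p^-1); first by rewrite powR_gt0// exprn_gt0// mulr_gt0.
exists ((4 * k)^-1); first by rewrite invr_gt0 mulr_gt0.
move=> g N gN x r r_gt0 rr0.
have s0 : 0 < k * r by rewrite mulr_gt0.
have [m [psi [[mE m0 psiE psi0] [_ hi psi_hi _]]]] := ball_orlicz p0 x s0.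
have s1 : 2 * (k * r) < 1.
  have : r * (4 * k) <= 1 by rewrite -ler_pdivlMr ?mulr_gt0// mul1r.
  by rewrite mulrCA mulrC; lra.
have N0 : 0 <= N.
  by rewrite -lee_fin (le_trans (camp_norm_ge0 n0 p0 g))// ltW.
have small : (lmeas (ball_of x (k * r)) < 1)%E.
  rewrite mE lte_fin (le_lt_trans hi)// exprn_ilt1 -?lt0n//.
  by rewrite mulr_ge0// ltW.
have := le_lt_trans (camp_osc_le p0 g s0 small) gN.
(* [osc] is an infimum; the strict inequality on [camp_norm] yields an actual polynomial. *)
rewrite psiE lte_pdivrMr// -EFinM => /ereal_inf_lt[_ [P [Pd _] <-] gP].
exists P; split; first exact/poly_leP.
have sub : ccube x r `<=` ball_of x (k * r).
  apply: (@cube_sub_ball _ _ _ _ _ (2 * r)); first by rewrite mulr_gt0.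
    by move=> i; rewrite tnthB tnth_mktuple; apply/andP; split; lra.
  rewrite /k mulrCA mulrA ltr_pM2r// ltr_pM2l// ltr_nat//.
apply: (@le_trans _ _ (aint (ball_of x (k * r)) (fun z => g z - P z))).
  apply: le_uint => z; rewrite lee_fin /restr; case: asboolP => xz; last by case: ifP.
  by rewrite asboolT//; exact: sub.
rewrite (le_trans (ltW gP))// lee_fin.
apply: (@le_trans _ _ (N * ((2 * (k * r)) ^+ n) `^ p^-1)).
  rewrite ler_wpM2l// (le_trans psi_hi)//; apply: ge0_ler_powR => //.
  - by rewrite invr_ge0 ltW.
  - by rewrite nnegrE ltW.
  - by rewrite nnegrE exprn_ge0// mulr_ge0// ltW.
have -> : ((2 * (k * r)) ^+ n) `^ p^-1 = ((2 * k) ^+ n) `^ p^-1 * (r ^+ n * r `^ beta).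
  rewrite -powR_inv_p// -powRM ?exprn_ge0 ?mulr_ge0 ?(ltW k0) ?(ltW r_gt0)//.
  by rewrite -exprMn mulrA.
by rewrite le_eqVlt; apply/orP; left; apply/eqP; ring.
Qed.

Lemma aint_bounded (g gt : V -> R) (B : set V) A : measurable B -> 0 <= A ->
  mu.-negligible [set x | g x != gt x] -> (forall x, `|gt x| <= A) ->
  (aint B g <= A%:E * mu B)%E.
Proof.
move=> mB A0 ggt gtA.
apply: (@le_trans _ _ (uint (fun x => A%:E * (\1_B x)%:E)%E)).
  apply: (le_uint_ae ggt) => x /= /negP; rewrite negbK => /eqP gx.
  rewrite -EFinM lee_fin /restr indicE; case: asboolP => Bx.
    by rewrite mem_set// mulr1 gx.
  by rewrite memNset// mulr0.
have mI : measurable_fun setT (fun x => (\1_B x : R)%:E).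
  exact/measurable_EFinP/measurable_indic.
rewrite uintE.
- by rewrite ge0_integralZl// integral_indic// setIT.
- exact: measurable_funeM.
- by move=> x; rewrite mule_ge0// lee_fin.
Qed.

Section LipschitzToCamp.
Variables (g gt : V -> R) (A M : R).
Hypotheses (A0 : 0 <= A) (M0 : 0 <= M) (cgt : tcontinuous gt).
Hypotheses (ggt : mu.-negligible [set x | g x != gt x]).
Hypotheses (gtA : forall x, `|gt x| <= A).
Hypothesis gtM : forall (h x : V), h != 0 ->
  `|iter d.+1 (fdiff h) gt x| <= M * tnorm h `^ beta.

Lemma lipschitz_lmeasurable : lmeasurable g.
Proof.
exists gt; first exact: tcontinuous_measurable.
by apply/null_negligible.
Qed.

Lemma lipschitz_Linf : (Linf_norm g <= A%:E)%E.
Proof.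
apply: ereal_inf_lbound; exists A => //=; apply/null_negligible.
apply: negligibleS ggt => x /=; apply: contraTN => /eqP ->.
by rewrite -leNgt.
Qed.

Lemma lipschitz_L1loc : L1loc g.
Proof.
split; first exact: lipschitz_lmeasurable.
move=> c r; have r0 : 0 < `|r| + 1 by rewrite ltr_wpDl.
apply: (@le_lt_trans _ _ (aint (ball_of c (`|r| + 1)) g)).
  apply: le_uint => x; rewrite lee_fin /restr; case: asboolP => xc; last by case: ifP.
  rewrite asboolT//; apply: (lt_trans xc); rewrite (le_lt_trans (ler_norm _))//.
  by rewrite ltrDl.
rewrite (le_lt_trans (aint_bounded _ A0 ggt gtA))//; first exact: measurable_ball_of.
by rewrite lte_mul_pinfty ?lee_fin// ball_measure_fin.
Qed.

Let bk : beta < d.+1%:R.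
Proof. exact: truncnS_gt. Qed.

Let lip : lip_diff d.+1 beta gt M.
Proof.
move=> h x; have [->|h0] := eqVneq h 0; last exact: gtM.
have z : fdiff 0 gt = fun=> 0 by apply/funext => y; rewrite /fdiff addr0 subrr.
rewrite iterSr z.
apply: (@le_trans _ _ (2 ^+ d * 0)); last by rewrite mulr0 mulr_ge0// powR_ge0.
by apply: iter_fdiff_pointwise => i _; rewrite normr0.
Qed.

(** Marchaud at order [1]; this is the a priori continuity that [whitney] starts from. *)
Lemma lipschitz_hoelder : exists2 L : R, 0 <= L & hoelder_diff gt L (beta / d.+1%:R).
Proof.
have [C C0 HC] := marchaud n b0 bk.
have AM0 : 0 <= A + M by rewrite addr_ge0.
have L0 : 0 <= C * (A + M) by rewrite mulr_ge0// ltW.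
exists (C * (A + M)) => // x h; have [->|h0] := eqVneq h 0.
  by rewrite addr0 subrr normr0 mulr_ge0// powR_ge0.
have := HC (A + M) gt AM0 _ _ 1%N h x isT h0; rewrite mul1r; apply.
  by move=> y; rewrite (le_trans (gtA y))// lerDl.
move=> h' y h'0; rewrite (le_trans (gtM y h'0))// ler_wpM2r ?powR_ge0//.
by rewrite lerDr.
Qed.

Lemma lipschitz_osc : exists2 K : R, 0 < K & forall c r, 0 < r ->
  (osc d (ball_of c r) g <= (K * r `^ beta)%:E * mu (ball_of c r))%E.
Proof.
have [C C0 HC] := whitney (ltn0Sn d) b0 n.
have [L L0 HL] := lipschitz_hoelder.
have del0 : 0 < beta / d.+1%:R by rewrite divr_gt0.
(* The summand [1] keeps the sup error positive for [osc_le], even when [M = 0]; [2 ^ beta] comes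
   from the Newton step [2 * r], whose box covers the ball. *)
exists ((C * M + 1) * 2 `^ beta).
  by rewrite mulr_gt0 ?powR_gt0// ltr_wpDl// mulr_ge0.
move=> c r r0.
have r20 : 0 < 2 * r by rewrite mulr_gt0.
have [P Pd HP] := HC gt M L _ M0 L0 del0 lip HL (2 * r) (c - [tuple r | i < n]) r20.
have mb := measurable_ball_of c r.
have fin : mu (ball_of c r) \is a fin_num.
  by rewrite ge0_fin_numE ?measure_ge0// ball_measure_fin.
have rb0 : 0 < r `^ beta by rewrite powR_gt0.
have bgt : bmeas (ball_of c r) gt.
  by split; [exact: tcontinuous_measurable|exists A].
rewrite -(fineK fin) -EFinM; apply: (osc_le mb _ _ bgt ggt Pd).
- exact: ball_measure_fin.
- exact: ball_coord_bound.
- by rewrite !mulr_gt0 ?powR_gt0// ltr_wpDl// mulr_ge0.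
move=> x xc; rewrite (le_trans (HP x _))//.
  move=> i; have := ball_sub_cube xc i => /andP[-> /ltW h].
  rewrite /= (le_trans h)// lerD2l ler_peMl ?(ltW r20)//.
  by rewrite ler1n.
rewrite powRM ?(ltW r0)// mulrA ler_wpM2r ?(ltW rb0)// ler_wpM2r ?powR_ge0//.
by rewrite lerDl.
Qed.

(** On a ball of measure [m < 1] the oscillation is at most [K r^beta m]; as [r^beta] is at most a
    multiple of [m ^ (1 / p - 1)], this is at most a multiple of [m ^ (1 / p)], thus of the
    Luxemburg norm. For [m >= 1] that norm is at least [m / 2 ^ (1 / p)], and the sup bound on [gt]
    suffices. *)
Lemma lipschitz_in_camp : in_camp p g.
Proof.
split; first exact: lipschitz_L1loc.
have pi0 : 0 < p^-1 by rewrite invr_gt0.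
have pi1 : 1 <= p^-1 by rewrite invf_ge1// ltW.
have [K K0 HK] := lipschitz_osc.
pose a := p^-1 - 1; have a0 : 0 <= a by rewrite subr_ge0.
pose K1 := K * (2 * 2 `^ a * n.+1%:R `^ beta).
pose K2 := A * 2 `^ p^-1.
rewrite /camp_norm; apply: (@le_lt_trans _ _ (K1%:E + K2%:E)%E); last by rewrite -EFinD ltry.
apply: leeD; apply: ge_ereal_sup => _ [c [r [r0 cr ->]]].
- have [m [psi [[mE m0 psiE psi0] [lo hi _ psi_lo]]]] := ball_orlicz p0 c r0.
  move: cr; rewrite psiE mE lte_fin => m1.
  have mb := measurable_ball_of c r.
  have m20 : 0 < m / 2 by rewrite divr_gt0.
  rewrite lee_pdivrMr//; apply: le_trans (HK c r r0) _.
  rewrite -lmeasE// mE -!EFinM lee_fin.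
  have psi_ge : (m / 2) `^ p^-1 <= psi.
    rewrite (le_trans _ psi_lo)// le_min lexx andbT.
    rewrite -[leRHS]powRr1 ?(ltW m20)//; apply: ger_powR => //.
    by rewrite m20 /=; lra.
  apply: (@le_trans _ _ (K1 * (m / 2) `^ p^-1)); last first.
    rewrite ler_wpM2l// !mulr_ge0 ?powR_ge0// ltW//.
  have -> : (m / 2) `^ p^-1 = (m / 2) * (m / 2) `^ a.
    rewrite -{2}[m / 2]powRr1 ?(ltW m20)// -powRD; first by rewrite /a addrC subrK.
    by rewrite (gt_eqF m20) implybT.
  (* The lower volume bound raised to the power [a], using [n * a = beta]. *)
  have key : r `^ beta <= 2 `^ a * n.+1%:R `^ beta * (m / 2) `^ a.
    rewrite mulrAC -powRM ?(ltW m20)// [2 * _]mulrC divfK//.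
    apply: (@le_trans _ _ (((r / n.+1%:R) ^+ n) `^ a * n.+1%:R `^ beta)); last first.
      rewrite ler_wpM2r ?powR_ge0//; apply: ge0_ler_powR => //.
      - by rewrite nnegrE exprn_ge0// divr_ge0// ltW.
      - by rewrite nnegrE ltW.
    rewrite -powR_mulrn; last by rewrite divr_ge0// ltW.
    rewrite -powRrM -powRM ?divr_ge0 ?(ltW r0)// divfK//.
  have : 0 <= K * m by rewrite mulr_ge0// ltW.
  move=> /ler_wpM2l/(_ _ _ key); rewrite /K1.
  by move: (r `^ beta) (2 `^ a) (_ `^ beta) (_ `^ a) => u v w z; lra.
- have [m [psi [[mE m0 psiE psi0] [lo hi _ psi_lo]]]] := ball_orlicz p0 c r0.
  move: cr; rewrite psiE mE lee_fin => m1.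
  have mb := measurable_ball_of c r.
  rewrite lee_pdivrMr//; apply: le_trans (aint_bounded mb A0 ggt gtA) _.
  rewrite -lmeasE// mE -!EFinM lee_fin /K2 -mulrA ler_wpM2l//.
  have two : 0 < 2 `^ p^-1 :> R by rewrite powR_gt0.
  rewrite mulrC -ler_pdivrMr// (le_trans _ psi_lo)// le_min; apply/andP; split.
    rewrite ler_wpM2l ?(ltW m0)// lef_pV2 ?posrE//.
    by rewrite -{1}[2]powRr1// ler_powR// ler1n.
  have half : (2^-1 : R) `^ p^-1 = (2 `^ p^-1)^-1.
    by rewrite -powRN -mulN1r powRrM powR_inv1.
  rewrite powRM ?(ltW m0)// half.
  by rewrite ler_wpM2r ?invr_ge0 ?powR_ge0// -{1}[m]powRr1 ?(ltW m0)// ler_powR.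
Qed.

End LipschitzToCamp.
End Embeddings.

(** * The Lambda norm and pointwise multipliers *)

Section LambdaNorm.
Variables (R : realType) (n : nat) (beta : R).
Hypotheses (n0 : (0 < n)%N) (b0 : 0 < beta).
Local Notation V := (n.-tuple R).
Local Notation mu := (tuple_measure R n).
Local Notation k := (Num.truncn beta).+1.
Implicit Types f g : V -> R.

Definition lip_rep f ft (A M : R) := [/\ tcontinuous ft,
  mu.-negligible [set x | f x != ft x], (forall x, `|ft x| <= A) &
  forall (h x : V), h != 0 -> `|iter k (fdiff h) ft x| <= M * tnorm h `^ beta].

Lemma lip_rep_ge0 f ft A M : lip_rep f ft A M -> 0 <= A /\ 0 <= M.
Proof.
move=> [_ _ fA fM]; split; first exact: le_trans (fA 0).
pose h : V := [tuple 1 | i < n].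
have h0 : h != 0.
  apply/eqP => /(congr1 (fun x => tnth x (Ordinal n0))) /eqP.
  by rewrite tnth_mktuple tnth_zero oner_eq0.
have := le_trans (normr_ge0 _) (fM h 0 h0).
by rewrite pmulr_lge0// powR_gt0// tnorm_gt0.
Qed.

Lemma lam_norm_le f ft A M : lip_rep f ft A M -> (lam_norm beta f <= (A + M)%:E)%E.
Proof.
move=> rep; have [A0 M0] := lip_rep_ge0 rep; have [cf fft fA fM] := rep.
apply: (@le_trans _ _ (Linf_norm f + lip_seminorm beta ft)%E).
  apply: ereal_inf_lbound; exists ft => //; split => //.
  by apply/null_negligible.
rewrite EFinD; apply: leeD; first exact: lipschitz_Linf fft fA.
apply: ge_ereal_sup => _ [x _ [h h0 <-]]; rewrite lee_fin.
have h0' : h != 0 :> V by [].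
by rewrite ler_pdivrMr ?powR_gt0 ?tnorm_gt0//; exact: fM.
Qed.

Lemma Linf_norm_ge0 f : (0 <= Linf_norm f)%E.
Proof.
apply: le_ereal_inf_tmp => _ [M fM <-]; rewrite lee_fin leNgt; apply/negP => M0.
have [c [r [r0 c1]]] := large_ball n (@ltr01 R).
have : mu.-negligible (ball_of c r).
  apply: negligibleS; last exact/null_negligible/fM.
  by move=> x _ /=; rewrite (lt_le_trans M0).
move=> /(negligibleP _ (measurable_ball_of c r)) z.
by move: c1; rewrite lmeasE ?z ?lee_fin ?ler10//; exact: measurable_ball_of.
Qed.

Lemma Linf_norm_lt f A : (Linf_norm f < A%:E)%E -> mu.-negligible [set x | A < `|f x|].
Proof.
move=> /ereal_inf_lt[_ [M fM <-]]; rewrite lte_fin => MA.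
have /null_negligible := fM; apply: negligibleS => x /=; exact: lt_trans.
Qed.

Lemma lip_seminorm_ge0 f : (0 <= lip_seminorm beta f)%E.
Proof.
pose h : V := [tuple 1 | i < n].
have h0 : h != 0.
  apply/eqP => /(congr1 (fun x => tnth x (Ordinal n0))) /eqP.
  by rewrite tnth_mktuple tnth_zero oner_eq0.
apply: le_trans (ereal_sup_ubound _); last by exists (0 : V) => //; exists h => //; reflexivity.
by rewrite lee_fin divr_ge0// powR_ge0.
Qed.

Lemma lam_norm_ge0 f : (0 <= lam_norm beta f)%E.
Proof.
by apply: le_ereal_inf_tmp => _ [g _ <-]; rewrite adde_ge0 ?Linf_norm_ge0 ?lip_seminorm_ge0.
Qed.

(** Strict, because the infimum over representatives may not be attained. Continuity of [ft] turns
    the essential bound on [f] into a bound at every point. *)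
Lemma lam_norm_lt f L : (lam_norm beta f < L%:E)%E ->
  exists ft A M, lip_rep f ft A M /\ A + M <= L.
Proof.
move=> /ereal_inf_lt[_ [ft [cf fft] <-]] fL.
have f0 := Linf_norm_ge0 f; have l0 := lip_seminorm_ge0 ft.
have /null_negligible nft := fft.
have ffin : Linf_norm f \is a fin_num.
  rewrite ge0_fin_numE//; apply: le_lt_trans (lt_trans fL (ltry L)).
  exact: leeDl.
have lfin : lip_seminorm beta ft \is a fin_num.
  rewrite ge0_fin_numE//; apply: le_lt_trans (lt_trans fL (ltry L)).
  exact: leeDr.
exists ft, (fine (Linf_norm f)), (fine (lip_seminorm beta ft)); split; last first.
  by rewrite -lee_fin EFinD !fineK// ltW.
split => //.
  move=> x; apply/ler_addgt0Pr => e e0; apply: (continuous_ae_bound cf nft).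
  by apply: Linf_norm_lt; rewrite EFinD fineK// lteDl// lte_fin.
move=> h x h0; rewrite -ler_pdivrMr ?powR_gt0 ?tnorm_gt0//.
rewrite -lee_fin fineK//; apply: ereal_sup_ubound; exists x => //.
by exists h.
Qed.

Lemma lam_norm_mul : exists2 C : R, 0 < C & forall f g ft gt A M A' M',
  lip_rep f ft A M -> lip_rep g gt A' M' ->
  (lam_norm beta (fun x => (f x * g x)%R) <= (C * (A + M) * (A' + M'))%:E)%E.
Proof.
have [C C0 HC] := lipschitz_mul n b0 (truncnS_gt beta).
exists (1 + C); first by rewrite addr_gt0.
move=> f g ft gt A M A' M' rf rg.
have [A0 M0] := lip_rep_ge0 rf; have [A'0 M'0] := lip_rep_ge0 rg.
have [cf fft fA fM] := rf; have [cg ggt gA gM] := rg.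
have L0 : 0 <= A + M by exact: addr_ge0.
have L'0 : 0 <= A' + M' by exact: addr_ge0.
have fL x : `|ft x| <= A + M by rewrite (le_trans (fA x))// lerDl.
have gL x : `|gt x| <= A' + M' by rewrite (le_trans (gA x))// lerDl.
have rep : lip_rep (fun x => f x * g x) (fun x => ft x * gt x)
    ((A + M) * (A' + M')) (C * (A + M) * (A' + M')).
  split.
  - exact: tcontinuousM.
  - apply: negligibleS (negligibleU fft ggt) => x /=.
    have [->|fx] := eqVneq (f x) (ft x); last by left.
    by have [->|gx] := eqVneq (g x) (gt x); [rewrite eqxx|right].
  - by move=> x; rewrite normrM ler_pM.
  - apply: HC => //.
      by move=> h x h0; rewrite (le_trans (fM h x h0))// ler_wpM2r ?powR_ge0// lerDr.
    by move=> h x h0; rewrite (le_trans (gM h x h0))// ler_wpM2r ?powR_ge0// lerDr.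
apply: (le_trans (lam_norm_le rep)); rewrite lee_fin.
by rewrite le_eqVlt; apply/orP; left; apply/eqP; ring.
Qed.

Lemma lip_rep_cst1 : lip_rep (fun=> 1) (fun=> 1) 1 0.
Proof.
split.
- exact: tcontinuous_cst.
- by apply: negligibleS (negligible_set0 _) => x /=; rewrite eqxx.
- by move=> x; rewrite normr1.
- move=> h x h0; rewrite mul0r iterSr.
  have -> : fdiff h (fun=> 1) = fun=> 0 :> R by apply/funext => y; rewrite /fdiff subrr.
  apply: (@le_trans _ _ (2 ^+ Num.truncn beta * 0)); last by rewrite mulr0.
  by apply: iter_fdiff_pointwise => i _; rewrite normr0.
Qed.

(** Removes the slack: [s] is a sum of two norms of [g], each relaxed by [e], and [l] is the norm of
    [f], relaxed once. *)
Lemma le_approx2 (x : \bar R) (C s l : R) : 0 <= C -> 0 <= s -> 0 <= l ->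
  (forall e : R, 0 < e -> (x <= (C * (s + 2 * e) * (l + e))%:E)%E) ->
  (x <= (C * s * l)%:E)%E.
Proof.
move=> C0 s0 l0 xC; apply/lee_addgt0Pr => e e0.
have D0 : 0 < C * (s + 2 * l + 2) + 1.
  by rewrite ltr_wpDl// mulr_ge0// !addr_ge0// mulr_ge0.
pose t := Num.min 1 (e / (C * (s + 2 * l + 2) + 1)).
have t0 : 0 < t by rewrite lt_min ltr01 divr_gt0.
have t1 : t <= 1 by rewrite ge_min lexx.
have te : t * (C * (s + 2 * l + 2) + 1) <= e by rewrite -ler_pdivlMr// ge_min lexx orbT.
apply: (le_trans (xC t t0)); rewrite -EFinD lee_fin.
have h1 : 0 <= C * t * (1 - t) by rewrite !mulr_ge0// ?subr_ge0// ltW.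
move: t t0 t1 te h1 => t t0 t1 te h1.
by lra.
Qed.

End LambdaNorm.

Section Multipliers.
Variables (R : realType) (n : nat) (p : R).
Hypotheses (n0 : (0 < n)%N) (p0 : 0 < p) (p1 : p < 1).
Local Notation V := (n.-tuple R).
Local Notation beta := (n%:R * (p^-1 - 1)).

Lemma camp_lip_rep : exists2 C : R, 0 < C & forall (g : V -> R) (A N : R), 0 <= A ->
  (Linf_norm g < A%:E)%E -> (camp_norm p g < N%:E)%E ->
  exists gt, lip_rep beta g gt A (C * (A + N)).
Proof.
have b0 := beta_gt0 n0 p0 p1.
have [C1 C10 [r0 r00 H1]] := camp_to_bound n0 p0.
have [C2 C20 H2] := @campanato_lipschitz R n (Num.truncn beta) beta r0 b0 r00.
exists ((C2 + 1) * (1 + C1)).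
  by apply: mulr_gt0; [rewrite ltr_wpDl|rewrite addr_gt0].
move=> g A N A0 gA gN.
have N0 : 0 <= N by rewrite -lee_fin (le_trans (camp_norm_ge0 n0 p0 g))// ltW.
have CN0 : 0 <= C1 * N by rewrite mulr_ge0// ltW.
have [gt [cgt ggt gtA gtM]] := H2 g (C1 * N) A CN0 A0 (H1 g N gN) (Linf_norm_lt gA).
exists gt; split => // h x h0; rewrite (le_trans (gtM h x h0))// ler_wpM2r ?powR_ge0//.
rewrite -[leRHS]mulrA ler_pM// ?addr_ge0//; first by rewrite lerDl.
have := mulr_ge0 (ltW C10) A0; rewrite mulrDl mul1r mulrDr; lra.
Qed.

Lemma multiplier_bound : exists2 C : R, 0 < C & forall g f : V -> R,
  in_Linf g -> in_camp p g -> in_Lambda beta f ->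
  (lam_norm beta (fun x => (g x * f x)%R)
     <= C%:E * (Linf_norm g + camp_norm p g) * lam_norm beta f)%E.
Proof.
have b0 := beta_gt0 n0 p0 p1.
have [C1 C10 H1] := camp_lip_rep.
have [C2 C20 H2] := lam_norm_mul n0 b0.
exists (C2 * (1 + C1)); first by rewrite mulr_gt0// addr_gt0.
move=> g f [_ gfin] [_ cfin] ffin.
have gF : Linf_norm g \is a fin_num by rewrite ge0_fin_numE// Linf_norm_ge0.
have cF : camp_norm p g \is a fin_num by rewrite ge0_fin_numE// camp_norm_ge0.
have fF : lam_norm beta f \is a fin_num by rewrite ge0_fin_numE// lam_norm_ge0.
have a0 : 0 <= fine (Linf_norm g) by rewrite fine_ge0// Linf_norm_ge0.
have c0 : 0 <= fine (camp_norm p g) by rewrite fine_ge0// camp_norm_ge0.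
have l0 : 0 <= fine (lam_norm beta f) by rewrite fine_ge0// lam_norm_ge0.
rewrite -(fineK gF) -(fineK cF) -(fineK fF) -EFinD -!EFinM.
apply: le_approx2 => //; first by rewrite mulr_ge0 ?addr_ge0// ltW.
  exact: addr_ge0.
move=> e e0.
have [gt rg] : exists gt, lip_rep beta g gt (fine (Linf_norm g) + e)
    (C1 * ((fine (Linf_norm g) + e) + (fine (camp_norm p g) + e))).
  apply: H1; first by rewrite addr_ge0// ltW.
    by rewrite EFinD fineK// lteDl// lte_fin.
  by rewrite EFinD fineK// lteDl// lte_fin.
have [|ft [A [M [rf AM]]]] := @lam_norm_lt _ _ beta n0 f (fine (lam_norm beta f) + e).
  by rewrite EFinD fineK// lteDl// lte_fin.
apply: (le_trans (H2 _ _ _ _ _ _ _ _ rg rf)); rewrite lee_fin.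
have [rA0 rM0] := lip_rep_ge0 n0 rf.
move: (fine (Linf_norm g)) (fine (camp_norm p g)) a0 c0 => a c a0 c0.
apply: ler_pM => //.
- by rewrite mulr_ge0 ?(ltW C20)// addr_ge0 ?mulr_ge0 ?(ltW C10)// !addr_ge0// ltW.
- exact: addr_ge0.
rewrite -mulrA ler_wpM2l ?(ltW C20)// mulrDl mul1r lerD//; first by lra.
by rewrite ler_wpM2l ?(ltW C10)//; lra.
Qed.

Lemma multiplier_in_Lambda (g : V -> R) (C : R) : 0 < C ->
  (forall f : V -> R, in_Lambda beta f ->
     (lam_norm beta (fun x => (g x * f x)%R) <= C%:E * lam_norm beta f)%E) ->
  in_Linf g /\ in_camp p g.
Proof.
move=> C0 gC; have b0 := beta_gt0 n0 p0 p1.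
have lam1 : (lam_norm beta (fun _ : V => 1%R) <= 1%:E)%E.
  by have := lam_norm_le n0 (lip_rep_cst1 n beta); rewrite addr0.
(* The test function [1] has norm at most [1]; [C + 1] instead of [C] gives the strict inequality
   required by [lam_norm_lt]. *)
have gl : (lam_norm beta g < (C + 1)%:E)%E.
  have gE : (fun x => g x * 1) = g by apply/funext => x; rewrite mulr1.
  have := gC (fun=> 1) (le_lt_trans lam1 (ltry _)); rewrite gE => /le_lt_trans; apply.
  apply: (@le_lt_trans _ _ C%:E); last by rewrite lte_fin ltrDl.
  by rewrite -[leRHS]mule1 lee_wpmul2l// lee_fin ltW.
have [gt [A [M [rep _]]]] := lam_norm_lt n0 gl.
have [A0 M0] := lip_rep_ge0 n0 rep; have [cgt ggt gtA gtM] := rep.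
split; last exact: (lipschitz_in_camp n0 p0 p1 A0 M0 cgt ggt gtA gtM).
split; first exact: lipschitz_lmeasurable cgt ggt.
exact: le_lt_trans (lipschitz_Linf ggt gtA) (ltry _).
Qed.

End Multipliers.

Theorem theorem3p1 (R : realType) (n : nat) (p : R) :
  (1 <= n)%N -> 0 < p -> p < 1 ->
  let beta : R := n%:R * (p^-1 - 1) in
  (forall g : n.-tuple R -> R,
     (in_Linf g /\ in_camp p g) <->
     (exists2 Cg : R, 0 < Cg & forall f : n.-tuple R -> R, in_Lambda beta f ->
        (lam_norm beta (fun x => (g x * f x)%R) <= Cg%:E * lam_norm beta f)%E))
  /\
  (exists2 C : R, 0 < C & forall g : n.-tuple R -> R,
     in_Linf g -> in_camp p g ->
     forall f : n.-tuple R -> R, in_Lambda beta f ->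
       (lam_norm beta (fun x => (g x * f x)%R)
          <= C%:E * (Linf_norm g + camp_norm p g) * lam_norm beta f)%E).
Proof.
move=> n0 p0 p1 beta.
have [C C0 HC] := multiplier_bound n0 p0 p1.
split; last by exists C => // g gL gC f fL; exact: HC.
move=> g; split; last by move=> [Cg Cg0 HCg]; exact: multiplier_in_Lambda Cg0 HCg.
move=> [gL gC].
have gF : (Linf_norm g + camp_norm p g)%E \is a fin_num.
  rewrite ge0_fin_numE; first by rewrite lte_add_pinfty//; [case: gL|case: gC].
  by rewrite adde_ge0// ?Linf_norm_ge0// camp_norm_ge0.
have g0 : 0 <= fine (Linf_norm g + camp_norm p g).
  by rewrite fine_ge0// adde_ge0// ?Linf_norm_ge0// camp_norm_ge0.
(* The summand [1] makes the multiplier constant positive also when [g] has norm zero. *)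
exists (C * fine (Linf_norm g + camp_norm p g) + 1).
  by rewrite ltr_wpDl// mulr_ge0// ltW.
move=> f fL; apply: (le_trans (HC g f gL gC fL)).
apply: lee_wpmul2r; first exact: lam_norm_ge0.
by rewrite -(fineK gF) -EFinM lee_fin lerDl.
Qed.
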